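(* Let $0<\alpha<1$, let $\mathbb{G}_\alpha$ be a random variable with density $$f_{\mathbb{G}_\alpha}(x)=\frac{\alpha\sin(\pi\alpha)}{(1-\alpha)\pi}\,\frac{x^{\alpha-1}(1-x)^{\alpha-1}}{(1-x)^{2\alpha}-2(1-x)^\alpha x^\alpha\cos(\pi\alpha)+x^{2\alpha}}\,1_{[0,1]}(x),$$ and let $(\Gamma_t(1/\mathbb{G}_\alpha),\,t\ge0)$ be the subordinator characterized by $$E(e^{-\lambda\Gamma_t(1/\mathbb{G}_\alpha)})=\exp\left\{-t\int_0^\infty(1-e^{-\lambda x})\frac{dx}{x}E\left(e^{-x/\mathbb{G}_\alpha}\right)\right\}\qquad(\lambda,t\ge0).$$ Then: 1. (Laplace transform) For $\lambda>0$ and $t\ge0$, $$E(e^{-\lambda\Gamma_t(1/\mathbb{G}_\alpha)})=\left(\frac1\alpha\,\frac{(1+\lambda)^\alpha-1}{\lambda}\right)^{\frac{t}{1-\alpha}} .$$ 2. (Laws of $\Gamma_{1-\alpha}(1/\mathbb{G}_\alpha)$ and $D_{1-\alpha}(1/\mathbb{G}_\alpha)$) $$\Gamma_{1-\alpha}(1/\mathbb{G}_\alpha)\stackrel{(law)}{=}\gamma_{1-\alpha}\cdot U,\qquad D_{1-\alpha}(1/\mathbb{G}_\alpha)\stackrel{(law)}{=}U,$$ and the density of $\Gamma_{1-\alpha}(1/\mathbb{G}_\alpha)$ equals $$f_{\Gamma_{1-\alpha}(1/\mathbb{G}_\alpha)}(x)=\frac{1}{\Gamma(1-\alpha)}\,\frac{1}{x^\alpha}\left(\int_1^\infty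 e^{-xy}\frac{dy}{y^{\alpha+1}}\right)1_{[0,\infty[}(x).$$ 3. (Wiener-Gamma representation) For every $t>0$, $$\Gamma_t\left(\frac{1}{\mathbb{G}_\alpha}\right)\stackrel{(law)}{=}\int_0^t\frac{d\gamma_u}{1+\left(\frac{\sin\left(\pi(1-\alpha)\frac{t-u}{t}\right)}{\sin\left(\pi(1-\alpha)\frac ut\right)}\right)^{1/\alpha}}\stackrel{(law)}{=}\int_0^t\frac{d\gamma_u}{1+\left(\frac{\sin\left(\pi(1-\alpha)\frac ut\right)}{\sin\left(\pi(1-\alpha)\frac{t-u}{t}\right)}\right)^{1/\alpha}} .$$
   Context: $(\gamma_t,\,t\ge0)$ is the standard gamma process, i.e. the subordinator without drift and with Lévy measure $\frac{dx}{x}e^{-x}$, $x>0$. For fixed $t>0$, $\gamma_t$ is a gamma variable with density $e^{-a}a^{t-1}/\Gamma(t)$ on $(0,\infty)$. Integrals $\int_0^th(u)\,d\gamma_u$ with $h\ge0$ are pathwise Stieltjes integrals. $U$ is uniform on $[0,1]$. Random variables occurring together on one side of an equality in law are assumed independent. For $t>0$, $D_t(1/\mathbb{G}_\alpha)$ is the random variable whose law is characterized by $\Gamma_t(1/\mathbb{G}_\alpha)\stackrel{(law)}{=}\gamma_t\cdot D_t(1/\mathbb{G}_\alpha)$, with independent factors. *)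

(* Defs.v *)
From HB Require Import structures.
From mathcomp Require Import all_boot all_order all_algebra.
From mathcomp Require Import all_classical all_reals all_analysis.

Set Implicit Arguments.
Unset Strict Implicit.
Unset Printing Implicit Defensive.

Import Order.TTheory GRing.Theory Num.Theory.
Import numFieldNormedType.Exports.

Local Open Scope classical_set_scope.
Local Open Scope ring_scope.

Section laws.
Context {R : realType}.

(* X and Y may live on different probability spaces. *)
Definition eq_law d (T : measurableType d) (P : probability T R) (X : T -> R)
    d' (T' : measurableType d') (Q : probability T' R) (Y : T' -> R) : Prop :=
  forall B : set R, measurable B -> P (X @^-1` B) = Q (Y @^-1` B).

Definition has_law d (T : measurableType d) (P : probability T R) (X : T -> R)
    (nu : set R -> \bar R) : Prop :=
  forall B : set R, measurable B -> P (X @^-1` B) = nu B.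

Definition has_density d (T : measurableType d) (P : probability T R)
    (X : T -> R) (f : R -> R) : Prop :=
  [/\ measurable_fun setT f, (forall x, 0 <= f x) &
      has_law P X (fun B => \int[lebesgue_measure]_(x in B) (f x)%:E)%E].

Definition independent d (T : measurableType d) (P : probability T R)
    (X Y : T -> R) : Prop :=
  forall A B : set R, measurable A -> measurable B ->
    P (X @^-1` A `&` Y @^-1` B) = (P (X @^-1` A) * P (Y @^-1` B))%E.

(* The product rule for subfamilies follows by taking A i = setT for the
   other indices. *)
Definition mutually_independent d (T : measurableType d) (P : probability T R)
    n (X : 'I_n -> T -> R) : Prop :=
  forall A : 'I_n -> set R, (forall i, measurable (A i)) ->
    P (\bigcap_i (X i @^-1` A i)) = (\prod_(i < n) P (X i @^-1` A i))%E.

Definition is_uniform01 d (T : measurableType d) (P : probability T R)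
    (U : T -> R) : Prop :=
  has_law P U (uniform_prob (@ltr01 R)).

Definition Gamma_fun (t : R) : R :=
  \int[lebesgue_measure]_(x in `]0, +oo[) (expR (- x) * x `^ (t - 1)).

Definition is_gamma_var d (T : measurableType d) (P : probability T R)
    (t : R) (X : T -> R) : Prop :=
  has_density P X (fun a =>
    expR (- a) * a `^ (t - 1) / Gamma_fun t * \1_(`]0, +oo[%classic) a).

(* X =(law) g * D with g a gamma variable of parameter t independent of D:
   when X is Gamma_t(1/G), this is what characterizes the law of D_t(1/G). *)
Definition gamma_factorization d (T : measurableType d) (P : probability T R)
    (X : T -> R) (t : R) d' (T' : measurableType d') (Q : probability T' R)
    (g D : T' -> R) : Prop :=
  [/\ is_gamma_var Q t g, independent Q g D & eq_law P X Q (g \* D)].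

End laws.

Section subordinators.
Context {R : realType} d (T : measurableType d) (P : probability T R).
Implicit Type X : R -> {RV P >-> R}.

(* Times are the nonnegative reals; X t is irrelevant for t < 0.  Left limits
   exist automatically since the paths are nondecreasing. *)
Record subordinator X : Prop := Subordinator {
  subordinator_start : {ae P, forall w, X 0 w = 0} ;
  subordinator_stationary : forall s t, 0 <= s -> 0 <= t ->
    eq_law P (fun w => X (s + t) w - X s w) P (X t) ;
  subordinator_independent : forall n (s : nat -> R), 0 <= s 0%N ->
    (forall i, s i <= s i.+1) ->
    mutually_independent P
      (fun (i : 'I_n) (w : T) => X (s i.+1) w - X (s i) w) ;
  subordinator_paths : {ae P, forall w,
    (forall s t, 0 <= s -> s <= t -> X s w <= X t w) /\
    (forall s, 0 <= s -> X u w @[u --> s^'+] --> X s w)} }.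

(* The subordinator without drift with Levy measure l(x) dx on ]0, +oo[. *)
Definition driftless_subordinator (l : R -> \bar R) X : Prop :=
  subordinator X /\
  forall lambda t, 0 <= lambda -> 0 <= t ->
    ('E_P[fun w => expR (- lambda * X t w)] =
     expeR (- (t%:E * \int[lebesgue_measure]_(x in `]0%R, +oo[)
                        ((1 - expR (- lambda * x))%:E * l x))))%E.

Definition standard_gamma_process X : Prop :=
  driftless_subordinator (fun x => (expR (- x) / x)%:E) X.

(* I is a version of the pathwise Stieltjes integral of h over ]0, t].
   Almost every path is extended from [0, +oo[ to a nondecreasing
   right-continuous function F on the line; the value of the integral depends
   only on the path, not on the extension. *)
Definition is_stieltjes_integral X (t : R) (h : R -> \bar R)
    (I : {RV P >-> R}) : Prop :=
  {ae P, forall w, exists F : cumulative R R,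
    (forall s, 0 <= s -> F s = X s w) /\
    (\int[lebesgue_stieltjes_measure F]_(u in `]0%R, t]) h u = (I w)%:E)%E}.

End subordinators.

Section theorem_functions.
Context {R : realType}.
Variable alpha : R.

Definition f_G (x : R) : R :=
  alpha * sin (pi * alpha) / ((1 - alpha) * pi) *
  (x `^ (alpha - 1) * (1 - x) `^ (alpha - 1) /
   ((1 - x) `^ (2 * alpha)
    - 2 * (1 - x) `^ alpha * x `^ alpha * cos (pi * alpha)
    + x `^ (2 * alpha))) *
  \1_(`[0, 1]%classic) x.

(* The subordinator Gamma_t(1/G). *)
Definition is_Gamma_inv d (T : measurableType d) (P : probability T R)
    (G : {RV P >-> R}) d' (T' : measurableType d') (Q : probability T' R)
    (X : R -> {RV Q >-> R}) : Prop :=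
  driftless_subordinator
    (fun x => (x^-1)%:E * 'E_P[fun w => expR (- x / G w)])%E X.

Definition f_Gamma (x : R) : R :=
  (Gamma_fun (1 - alpha))^-1 * (x `^ alpha)^-1 *
  (\int[lebesgue_measure]_(y in `[1, +oo[) (expR (- x * y) / y `^ (alpha + 1)))
  * \1_(`[0, +oo[%classic) x.

(* 1 / (1 + (a / b) ^ (1 / alpha)), computed in the extended reals so that
   b = 0 < a gives 0, the limit of the expression as b tends to 0. *)
Definition wiener_gamma_kernel (a b : R) : \bar R :=
  ((1 + (a%:E / b%:E) `^ (alpha^-1))^-1)%E.

End theorem_functions.

(* Main.v *)
(* Write [G = 1 / (1 + exp (- X))].  Then [X] has the density
   [P x / (pi * (1 - alpha))], where [(alpha/2) coth (alpha z / 2) = Q - i P] on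
   the line [Im z = pi].  The integral over a horizontal line of a product of two
   such coth kernels, with exponents 1 and [alpha], does not depend on the line up
   to boundary terms; moving the line from [Im z = pi] to the real axis, where
   [P] tends to a point mass, gives
   [E (1 / (s + exp (- X))) =
      (1 / (s - 1) - alpha s^(alpha - 1) / (s^alpha - 1)) / (1 - alpha)].
   Integrating in [s], [E (ln (1 + lam G)) = Psi lam], where [exp (- t Psi lam)]
   is the Laplace transform of part 1; Frullani's integral identifies [t Psi lam]
   with the Levy exponent.
   Laplace transforms determine the laws of nonnegative variables, because the
   moments of [V = exp (- X)] determine [P (V < c)] as the limit of
   [E ((1 - V^n)^N)] for a suitable [N = N n].  In part 2 the Laplace transforms
   of [f_Gamma] and of [gamma U] follow from Tonelli's theorem, and the moments
   of [D] are the quotients of those of [Gamma] and of the gamma variable.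
   In part 3 the integral of [h] along a path is the limit of Riemann-Stieltjes
   sums, whose Laplace transforms are products by independence and tend to
   [exp (- \int_0^t ln (1 + lam h u) du)]; the kernel is such that [h] maps the
   Lebesgue measure on [0, t] to [t] times the law of [G]. *)

Require Import Defs.
From HB Require Import structures.
From mathcomp Require Import all_boot all_order all_algebra.
From mathcomp Require Import all_classical all_reals all_analysis.
From mathcomp Require Import measurable_realfun ring lra.

Set Implicit Arguments.
Unset Strict Implicit.
Unset Printing Implicit Defensive.

Import Order.TTheory GRing.Theory Num.Theory.
Import numFieldNormedType.Exports.

Local Open Scope classical_set_scope.
Local Open Scope ring_scope.

(** No complex integration is used. At height [phi] the product of the two kernels is [cZ - i cW];
    by its Cauchy-Riemann equation the [phi]-derivative of [cW] is minus the [x]-derivative of [cZ].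
    So the integral of [cW] over a segment changes with the height only through the values of [cZ]
    at the two ends, and these cancel in the limit because both tend to alpha / 4. With s = e^a, the
    exponent-1 kernel shifted by a produces 1 / (s + e^-x), since at height pi that kernel plus 1/2
    is the logistic function. The obstacle is height 0, where the poles x = 0 and x = - a lie on the
    line itself. Near each of them one factor concentrates a mass pi while the other is regular, and
    the error must be dominated uniformly in the height, at both points at once. The two poles yield
    the two terms of the Stieltjes transform, up to constants that the added 1/2 completes. *)

Section real_facts.
Context {R : realType}.

Lemma is_derive_continuous (f : R -> R) (df : R -> R) :
  (forall x : R, is_derive x 1 f (df x)) -> continuous f.
Proof.
by move=> h x; apply/differentiable_continuous/derivable1_diffP; exact: ex_derive.
Qed.

Lemma derive_ge0_homo (f df : R -> R) (a b : R) :
  (forall x : R, is_derive x 1 f (df x)) -> (forall x, a <= x -> x <= b -> 0 <= df x) ->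
  a <= b -> f a <= f b.
Proof.
move=> h df0 ab.
have cf : {within `[a, b], continuous f}.
  exact/continuous_subspaceT/(is_derive_continuous h).
have [c cab e] := MVT_segment ab (fun x _ => h x) cf.
rewrite -subr_ge0 e mulr_ge0 ?subr_ge0//.
by apply: df0; move: cab; rewrite in_itv/= => /andP[].
Qed.

Lemma integral_is_derive (f F : R -> R) (a b : R) : a < b ->
  (forall x, a <= x <= b -> is_derive x 1 F (f x)) ->
  (forall x, a <= x <= b -> {for x, continuous f}) ->
  (\int[lebesgue_measure]_(x in `[a, b]) (f x)%:E = (F b)%:E - (F a)%:E)%E.
Proof.
move=> ab dF cf.
have cF (x : R) : a <= x <= b -> {for x, continuous F}.
  by move=> xab; apply/differentiable_continuous/derivable1_diffP; case: (dF x xab).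
have oc (x : R) : x \in `]a, b[ -> a <= x <= b by rewrite in_itv/= => /andP[/ltW -> /ltW].
apply: continuous_FTC2 => //.
- by apply: continuous_in_subspaceT => x; rewrite inE/= in_itv/= => /cf.
- split=> [x /oc xab| |]; first by case: (dF x xab).
    by apply/cvg_at_right_filter/cF; rewrite lexx ltW.
  by apply/cvg_at_left_filter/cF; rewrite lexx ltW.
- by move=> x /oc xab; rewrite derive1E; case: (dF x xab).
Qed.

Lemma ge0_integral_is_derivey (f F : R -> R) (a l : R) :
  (forall x, a <= x -> 0 <= f x) ->
  (forall x, a <= x -> is_derive x 1 F (f x)) ->
  (forall x, a <= x -> {for x, continuous f}) ->
  F x @[x --> +oo] --> l ->
  (\int[lebesgue_measure]_(x in `[a, +oo[) (f x)%:E = l%:E - (F a)%:E)%E.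
Proof.
move=> f0 dF cf Fl; apply: ge0_continuous_FTC2y => //.
- by apply: continuous_in_subspaceT => x; rewrite inE/= in_itv/= andbT => /cf.
- by move=> x /ltW ax; case: (dF x ax).
- by apply/cvg_at_right_filter/differentiable_continuous/derivable1_diffP; case: (dF a (lexx a)).
- by move=> x; rewrite in_itv/= andbT => /ltW ax; rewrite derive1E; case: (dF x ax).
Qed.

(** Both sides agree at 0 and, as cosine decreases on [0, pi], the derivative k (cos (k t) - cos t)
    of the difference is nonnegative. *)
Lemma sin_Ml_ge (k x : R) : 0 < k <= 1 -> 0 <= x <= pi -> k * sin x <= sin (k * x).
Proof.
move=> /andP[k0 k1] /andP[x0 xpi].
pose f t := sin (k * t) - k * sin t.
have df (t : R) : is_derive t 1 f (k * (cos (k * t) - cos t)).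
  by rewrite /f; apply: is_derive_eq; rewrite /GRing.scale/=; ring.
suff : f 0 <= f x by rewrite /f mulr0 sin0; lra.
apply: (derive_ge0_homo df) => // t t0 tx.
rewrite mulr_ge0 ?(ltW k0)// subr_ge0.
have ktt : k * t <= t by rewrite ler_piMl.
have tpi : t <= pi by apply: le_trans tx _.
by rewrite leNgt ltr_cos ?in_itv/= ?mulr_ge0 ?(ltW k0) ?(le_trans ktt)//= ?t0// -leNgt.
Qed.

Lemma sin_Ml_le (k x : R) : 0 < k <= 1 -> 0 <= x <= pi / 2 -> sin (k * x) <= sin x.
Proof.
move=> /andP[k0 k1] /andP[x0 xpi].
have kxx : k * x <= x by rewrite ler_piMl.
have kx0 : 0 <= k * x by rewrite mulr_ge0 // ltW.
have p0 := pi_ge0 R.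
rewrite leNgt ltr_sin ?in_itv/= -?leNgt//; apply/andP; split; lra.
Qed.

Lemma onem_cos_le_sin (x : R) : 0 <= x <= pi / 2 -> 1 - cos x <= sin x.
Proof.
move=> xp.
have s0 : 0 <= sin x by rewrite sin_ge0_pi//; have := pi_ge0 R; lra.
have c0 : 0 <= cos x by rewrite cos_ge0_pihalf//; have := pi_ge0 R; lra.
have := cos2Dsin2 x; nra.
Qed.

(** Since k <= 1, the argument k x stays in [k eta, 2 pi - k eta], where cosine is largest at the
    ends. This keeps the heights in [eta, 2 pi - eta] away from the poles at heights 0 and 2 pi. *)
Lemma cos_le_away (k eta x : R) : 0 < k <= 1 -> 0 <= eta -> eta <= x -> x <= 2 * pi - eta ->
  cos (k * x) <= cos (k * eta).
Proof.
move=> /andP[k0 k1] e0 ex xe.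
have p0 := pi_ge0 R.
have ke0 : 0 <= k * eta by rewrite mulr_ge0 // ltW.
have kex : k * eta <= k * x by rewrite ler_pM2l.
have kep : k * eta <= pi by apply: (@le_trans _ _ eta); [rewrite ler_piMl//|lra].
have [kxp|kxp] := leP (k * x) pi.
  by rewrite leNgt ltr_cos ?in_itv/= ?ke0 ?kxp ?kep ?(le_trans ke0 kex)// -leNgt.
have -> : cos (k * x) = cos (2 * pi - k * x).
  by rewrite cosB mulr_natl cos2pi sin2pi mul0r addr0 mul1r.
have h : k * x <= 2 * pi - k * eta.
  by have := ler_pM2l k0 x (2 * pi - eta); rewrite xe; nra.
by rewrite leNgt ltr_cos ?in_itv/= ?ke0 ?kep -?leNgt//; [lra|apply/andP; split; lra].
Qed.

End real_facts.

(** * Hyperbolic cotangent kernels *)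

Section coth_kernels.
Context {R : realType}.
Implicit Types (k phi x a e : R).

(** With z = x + i phi, [cden] is 4 |sinh (k z / 2)|^2 and [cQ - i cP] is (k / 2) coth (k z / 2).
    [cD] and [cH] are the components of the derivative: [cD] is the [phi]-derivative of [cP] and
    minus the [x]-derivative of [cQ], and [cH] is the [phi]-derivative of [cQ] and the
    [x]-derivative of [cP]. *)
Definition cden k phi x : R := expR (k * x) + expR (- (k * x)) - 2 * cos (k * phi).
Definition cP k phi x : R := k * sin (k * phi) / cden k phi x.
Definition cQ k phi x : R := k / 2 * (expR (k * x) - expR (- (k * x))) / cden k phi x.
Definition cD k phi x : R :=
  k ^+ 2 * ((expR (k * x) + expR (- (k * x))) * cos (k * phi) - 2) / cden k phi x ^+ 2.
Definition cH k phi x : R :=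
  - (k ^+ 2 * (expR (k * x) - expR (- (k * x))) * sin (k * phi)) / cden k phi x ^+ 2.

Lemma is_derive_div (f g : R -> R) (x df dg : R) : g x != 0 ->
  is_derive x 1 f df -> is_derive x 1 g dg ->
  is_derive x 1 (fun y => f y / g y) ((df * g x - f x * dg) / g x ^+ 2).
Proof.
move=> gx0 hf hg.
have hV : is_derive x 1 (fun y => (g y)^-1) (- (g x) ^- 2 *: dg).
  exact: is_deriveV.
by apply: is_derive_eq; rewrite /GRing.scale/=; field.
Qed.

Lemma is_derive_expRMl k x : is_derive x 1 (fun y => expR (k * y)) (k * expR (k * x)).
Proof.
by apply: is_derive_eq; rewrite /GRing.scale/=; ring.
Qed.

Lemma is_derive_expRNMl k x : is_derive x 1 (fun y => expR (- (k * y))) (- (k * expR (- (k * x)))).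
Proof.
by apply: is_derive_eq; rewrite /GRing.scale/=; ring.
Qed.

Lemma is_derive_cosMl k x : is_derive x 1 (fun y => cos (k * y)) (- (k * sin (k * x))).
Proof.
by apply: is_derive_eq; rewrite /GRing.scale/=; ring.
Qed.

Lemma is_derive_sinMl k x : is_derive x 1 (fun y => sin (k * y)) ( (k * cos (k * x))).
Proof.
by apply: is_derive_eq; rewrite /GRing.scale/=; ring.
Qed.

Lemma is_derive_cdenx k phi x : is_derive x 1 (cden k phi) (k * (expR (k * x) - expR (- (k * x)))).
Proof.
rewrite /cden.
have h1 := is_derive_expRMl k x. have h2 := is_derive_expRNMl k x.
apply: is_derive_eq.
ring.
Qed.

Lemma is_derive_cdenphi k phi x :
  is_derive phi 1 (fun p => cden k p x) (2 * k * sin (k * phi)).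
Proof.
have h1 := is_derive_cosMl k phi.
rewrite /cden; apply: is_derive_eq.
by rewrite /GRing.scale/=; ring.
Qed.

Lemma expRMN1 (y : R) : expR y * expR (- y) = 1.
Proof. by rewrite -expRD subrr expR0. Qed.

Lemma is_derive_cPphi k phi x : cden k phi x != 0 ->
  is_derive phi 1 (fun p => cP k p x) (cD k phi x).
Proof.
move=> N0; have h1 := is_derive_sinMl k phi.
have h2 : is_derive phi 1 (fun p => k * sin (k * p)) (k * (k * cos (k * phi))).
  by apply: is_derive_eq; rewrite /GRing.scale/=; ring.
have := is_derive_div (g := fun p => cden k p x) N0 h2 (is_derive_cdenphi k phi x).
move=> h; apply: (is_derive_eq h); rewrite /cD; congr (_ / _).
rewrite /cden; have e := sin2cos2 (k * phi).
ring: e.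
Qed.

Lemma is_derive_cQx k phi x : cden k phi x != 0 ->
  is_derive x 1 (cQ k phi) (- cD k phi x).
Proof.
move=> N0; have h1 := is_derive_expRMl k x; have h2 := is_derive_expRNMl k x.
have h3 : is_derive x 1 (fun y => k / 2 * (expR (k * y) - expR (- (k * y))))
    (k / 2 * (k * (expR (k * x) + expR (- (k * x))))).
  by apply: is_derive_eq; rewrite /GRing.scale/=; ring.
have h := is_derive_div N0 h3 (is_derive_cdenx k phi x).
apply: (is_derive_eq h); rewrite /cD -[RHS]mulNr; congr (_ / _).
rewrite /cden; have := expRMN1 (k * x) => e.
by field: e.
Qed.

Lemma is_derive_cQphi k phi x : cden k phi x != 0 ->
  is_derive phi 1 (fun p => cQ k p x) (cH k phi x).
Proof.
move=> N0.
have h3 : is_derive phi 1 (fun y : R => k / 2 * (expR (k * x) - expR (- (k * x)))) 0.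
  exact: is_derive_cst.
have h := is_derive_div (g := fun p => cden k p x) N0 h3 (is_derive_cdenphi k phi x).
apply: (is_derive_eq h); rewrite /cH; congr (_ / _).
by field.
Qed.

Lemma is_derive_cPx k phi x : cden k phi x != 0 ->
  is_derive x 1 (cP k phi) (cH k phi x).
Proof.
move=> N0.
have h3 : is_derive x 1 (fun y : R => k * sin (k * phi)) 0.
  exact: is_derive_cst.
have h := is_derive_div N0 h3 (is_derive_cdenx k phi x).
apply: (is_derive_eq h); rewrite /cH; congr (_ / _).
by ring.
Qed.

(** Integrate e^t + e^-t >= 2 twice from 0; that inequality follows from e^t >= 1 + t. Negative y
    follow by symmetry. *)
Lemma cosh_ge (y : R) : 2 + y ^+ 2 <= expR y + expR (- y).
Proof.
suff h (z : R) : 0 <= z -> 2 + z ^+ 2 <= expR z + expR (- z).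
  have [y0|y0] := leP 0 y; first exact: h.
  by have := h (- y); rewrite sqrrN opprK (addrC (expR (- y))); apply; rewrite oppr_ge0 ltW.
move=> z0; pose g (t : R) := expR t - expR (- t) - 2 * t.
have dg (t : R) : is_derive t 1 g (expR t + expR (- t) - 2).
  by rewrite /g; apply: is_derive_eq; rewrite /GRing.scale/=; ring.
have g0 (t : R) : 0 <= t -> 0 <= g t.
  move=> t0.
  have -> : 0 = g 0 by rewrite /g oppr0 mulr0 subr0 subrr.
  apply: (derive_ge0_homo dg) => // x _.
  by have := expR_ge1Dx x; have := expR_ge1Dx (- x); lra.
pose f (t : R) := expR t + expR (- t) - t ^+ 2.
have df (t : R) : is_derive t 1 f (g t).
  by rewrite /f /g; apply: is_derive_eq; rewrite /GRing.scale/=; ring.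
have : f 0 <= f z.
  by apply: (derive_ge0_homo df) => // x x0 _; exact: g0.
by rewrite /f oppr0 expR0 expr0n/=; lra.
Qed.

(** Uses 2 - 2 cos c = (1 - cos c)^2 + sin^2 c. A lower bound by a sum of two squares lets [cden]
    control products by the arithmetic-geometric inequality. *)
Lemma cden_ge k phi x : (k * x) ^+ 2 + sin (k * phi) ^+ 2 <= cden k phi x.
Proof.
rewrite /cden; have := cosh_ge (k * x); have := cos2Dsin2 (k * phi).
have := sqr_ge0 (1 - cos (k * phi)); nra.
Qed.

Lemma cden_ge2 k phi x : 2 - 2 * cos (k * phi) <= cden k phi x.
Proof.
rewrite /cden; have := cosh_ge (k * x); have := sqr_ge0 (k * x); nra.
Qed.

Lemma cden_gt0 k phi x : sin (k * phi) != 0 -> 0 < cden k phi x.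
Proof.
move=> h; apply: lt_le_trans (cden_ge k phi x).
by rewrite ltr_wpDl ?sqr_ge0// exprn_even_gt0.
Qed.

Lemma ler_norm_div (u v M : R) : 0 < v -> `|u| <= M * v -> `|u / v| <= M.
Proof. by move=> v0 h; rewrite normf_div (gtr0_norm v0) ler_pdivrMr. Qed.

(** Applied with i = e^-1 and M = [cden] >= e: the numerators of [cD] and [cH] are at most M + 4,
    and they are divided by M^2. *)
Lemma inv_quadratic_bound (i M : R) : 0 < i -> 0 < M -> 1 <= i * M ->
  M + 4 <= (i + 4 * i ^+ 2) * M ^+ 2.
Proof.
move=> i0 M0 iM; have : M <= i * M ^+ 2 by rewrite expr2 mulrA ler_peMl// ltW.
have : 1 <= i ^+ 2 * M ^+ 2 by rewrite -exprMn expr_ge1// mulr_ge0 ?ltW.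
lra.
Qed.

(* [e] bounds the distance from the poles. *)
Lemma cP_le k phi x e : 0 < e -> 0 < k <= 1 -> e <= 2 - 2 * cos (k * phi) -> `|cP k phi x| <= e^-1.
Proof.
move=> e0 /andP[k0 k1] he.
have N := le_trans he (cden_ge2 k phi x); have Np := lt_le_trans e0 N.
rewrite /cP; apply: ler_norm_div => //.
have := sin_max (k * phi); rewrite normrM (gtr0_norm k0) => s1.
have : 1 <= e^-1 * cden k phi x by rewrite mulrC ler_pdivlMr// mul1r.
have := normr_ge0 (sin (k * phi)); nra.
Qed.

Lemma sinh_le (y : R) : `|expR y - expR (- y)| <= expR y + expR (- y).
Proof. have := expR_gt0 y; have := expR_gt0 (- y); rewrite ler_norml; lra. Qed.

Lemma cQ_le k phi x e : 0 < e -> 0 < k <= 1 -> e <= 2 - 2 * cos (k * phi) -> `|cQ k phi x| <= 2^-1 + e^-1.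
Proof.
move=> e0 /andP[k0 k1] he.
have N := le_trans he (cden_ge2 k phi x); have Np := lt_le_trans e0 N.
rewrite /cQ; apply: ler_norm_div => //.
rewrite normrM (gtr0_norm (divr_gt0 k0 (ltr0n R 2))).
have := sinh_le (k * x).
have : 1 <= e^-1 * cden k phi x by rewrite mulrC ler_pdivlMr// mul1r.
have : expR (k * x) + expR (- (k * x)) <= cden k phi x + 2.
  by rewrite /cden; have := cos_le1 (k * phi); lra.
have := normr_ge0 (expR (k * x) - expR (- (k * x))).
nra.
Qed.

Lemma cD_le k phi x e : 0 < e -> 0 < k <= 1 -> e <= 2 - 2 * cos (k * phi) ->
  `|cD k phi x| <= e^-1 + 4 * e^-1 ^+ 2.
Proof.
move=> e0 /andP[k0 k1] he.
have N := le_trans he (cden_ge2 k phi x); have Np := lt_le_trans e0 N.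
rewrite /cD; apply: ler_norm_div; first by rewrite exprn_gt0.
have i1 : 1 <= e^-1 * cden k phi x by rewrite mulrC ler_pdivlMr// mul1r.
have c1 : expR (k * x) + expR (- (k * x)) <= cden k phi x + 2.
  by rewrite /cden; have := cos_le1 (k * phi); lra.
have c0 : 0 <= expR (k * x) + expR (- (k * x)) by rewrite addr_ge0 ?expR_ge0.
rewrite normrM (ger0_norm (sqr_ge0 k)).
have h1 : `|(expR (k * x) + expR (- (k * x))) * cos (k * phi) - 2| <= cden k phi x + 4.
  apply: le_trans (ler_normB _ _) _.
  rewrite normrM (ger0_norm c0) (ger0_norm (ler0n R 2)).
  have := ler_piMr c0 (cos_max (k * phi)); lra.
have k2 : k ^+ 2 <= 1 by rewrite exprn_ile1 ?(ltW k0).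
have k20 := sqr_ge0 k.
have s0 := normr_ge0 ((expR (k * x) + expR (- (k * x))) * cos (k * phi) - 2).
apply: (@le_trans _ _ (cden k phi x + 4)).
  by apply: le_trans h1; rewrite ler_piMl.
by apply: inv_quadratic_bound; rewrite ?invr_gt0.
Qed.

Lemma cH_le k phi x e : 0 < e -> 0 < k <= 1 -> e <= 2 - 2 * cos (k * phi) ->
  `|cH k phi x| <= e^-1 + 4 * e^-1 ^+ 2.
Proof.
move=> e0 /andP[k0 k1] he.
have N := le_trans he (cden_ge2 k phi x); have Np := lt_le_trans e0 N.
rewrite /cH; apply: ler_norm_div; first by rewrite exprn_gt0.
have i1 : 1 <= e^-1 * cden k phi x by rewrite mulrC ler_pdivlMr// mul1r.
have c1 : expR (k * x) + expR (- (k * x)) <= cden k phi x + 2.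
  by rewrite /cden; have := cos_le1 (k * phi); lra.
rewrite normrN normrM normrM (ger0_norm (sqr_ge0 k)).
have h1 := sinh_le (k * x).
have k2 : k ^+ 2 <= 1 by rewrite exprn_ile1 ?(ltW k0).
have k20 := sqr_ge0 k.
have s0 := normr_ge0 (expR (k * x) - expR (- (k * x))).
have s1 := sin_max (k * phi).
have s2 := normr_ge0 (sin (k * phi)).
apply: (@le_trans _ _ (cden k phi x + 4)).
  apply: (@le_trans _ _ (`|expR (k * x) - expR (- (k * x))|)); last lra.
  rewrite -[leRHS]mulr1 ler_pM ?mulr_ge0 ?(ltW k0)//.
  by rewrite ler_piMl.
by apply: inv_quadratic_bound; rewrite ?invr_gt0.
Qed.

End coth_kernels.

(** * Moving the line of integration *)

Section contour.
Context {R : realType}.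
Implicit Types (k l phi x a e : R).
Local Notation mu := (@lebesgue_measure R).

Lemma cQ_continuous k phi x : cden k phi x != 0 -> {for x, continuous (cQ k phi)}.
Proof.
by move=> N0; apply/differentiable_continuous/derivable1_diffP; case: (is_derive_cQx N0).
Qed.

Lemma cP_continuous k phi x : cden k phi x != 0 -> {for x, continuous (cP k phi)}.
Proof.
by move=> N0; apply/differentiable_continuous/derivable1_diffP; case: (is_derive_cPx N0).
Qed.

Lemma cden_continuous k phi : continuous (cden k phi).
Proof. apply: is_derive_continuous => x; exact: is_derive_cdenx. Qed.

Lemma cD_continuous k phi x : cden k phi x != 0 -> {for x, continuous (cD k phi)}.
Proof.
move=> N0.
have cn : {for x, continuous (fun y => k ^+ 2 * ((expR (k * y) + expR (- (k * y))) * cos (k * phi) - 2))}.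
  apply/differentiable_continuous/derivable1_diffP.
  have h1 := is_derive_expRMl k x; have h2 := is_derive_expRNMl k x.
  by apply: ex_derive.
apply: cvgM; first exact: cn.
apply: cvgV; first by rewrite expf_neq0.
by apply: cvgM; apply: cden_continuous.
Qed.

Lemma cH_continuous k phi x : cden k phi x != 0 -> {for x, continuous (cH k phi)}.
Proof.
move=> N0.
have cn : {for x, continuous (fun y => - (k ^+ 2 * (expR (k * y) - expR (- (k * y))) * sin (k * phi)))}.
  apply/differentiable_continuous/derivable1_diffP.
  have h1 := is_derive_expRMl k x; have h2 := is_derive_expRNMl k x.
  by apply: ex_derive.
apply: cvgM; first exact: cn.
apply: cvgV; first by rewrite expf_neq0.
by apply: cvgM; apply: cden_continuous.
Qed.

(* Imaginary and real parts of a product of two coth kernels. *)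
Definition cW a k l phi x : R :=
  cQ k phi (a + x) * cP l phi x + cP k phi (a + x) * cQ l phi x.
Definition cZ a k l phi x : R :=
  cQ k phi (a + x) * cQ l phi x - cP k phi (a + x) * cP l phi x.
Definition cdW a k l phi x : R :=
  cH k phi (a + x) * cP l phi x + cQ k phi (a + x) * cD l phi x
  + (cD k phi (a + x) * cQ l phi x + cP k phi (a + x) * cH l phi x).

Lemma is_derive_shiftl (f : R -> R) a x df :
  is_derive (a + x) 1 f df -> is_derive x 1 (fun y => f (a + y)) df.
Proof.
move=> h.
have h2 : is_derive x 1 (fun y : R => a + y) 1.
  by apply: is_derive_eq; rewrite add0r mulr1.
have := @is_derive1_comp R f (fun y => a + y) x _ _ h h2.
by rewrite mulr1.
Qed.

Lemma is_derive_cWphi a k l phi x :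
  cden k phi (a + x) != 0 -> cden l phi x != 0 ->
  is_derive phi 1 (fun p => cW a k l p x) (cdW a k l phi x).
Proof.
move=> N1 N2.
have h1 := is_derive_cQphi N1; have h2 := is_derive_cPphi N1.
have h3 := is_derive_cQphi N2; have h4 := is_derive_cPphi N2.
apply: is_derive_eq; rewrite /cdW /GRing.scale/=; ring.
Qed.

(** [cZ - i cW] is holomorphic in x + i phi; together with [is_derive_cWphi] this is one of its
    Cauchy-Riemann equations. *)
Lemma is_derive_cZx a k l phi x :
  cden k phi (a + x) != 0 -> cden l phi x != 0 ->
  is_derive x 1 (cZ a k l phi) (- cdW a k l phi x).
Proof.
move=> N1 N2.
have h1 := is_derive_shiftl (is_derive_cQx N1).
have h2 := is_derive_shiftl (is_derive_cPx N1).
have h3 := is_derive_cQx N2; have h4 := is_derive_cPx N2.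
rewrite /cZ; apply: is_derive_eq; rewrite /cdW /GRing.scale/=; ring.
Qed.

Lemma continuous_shiftl (f : R -> R) a x :
  {for a + x, continuous f} -> {for x, continuous (fun y => f (a + y))}.
Proof.
move=> h.
by apply: (@continuous_comp _ _ _ (fun y => a + y) f x) => //; apply: cvgD => //; exact: cvg_cst.
Qed.

Lemma cW_continuous a k l phi x :
  cden k phi (a + x) != 0 -> cden l phi x != 0 ->
  {for x, continuous (cW a k l phi)}.
Proof.
move=> N1 N2.
have h1 := continuous_shiftl (cQ_continuous N1).
have h2 := continuous_shiftl (cP_continuous N1).
have h3 := cQ_continuous N2; have h4 := cP_continuous N2.
by apply: cvgD; apply: cvgM.
Qed.

Lemma cdW_continuous a k l phi x :
  cden k phi (a + x) != 0 -> cden l phi x != 0 ->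
  {for x, continuous (cdW a k l phi)}.
Proof.
move=> N1 N2.
have h1 := continuous_shiftl (cQ_continuous N1).
have h2 := continuous_shiftl (cP_continuous N1).
have h3 := cQ_continuous N2; have h4 := cP_continuous N2.
have h5 := continuous_shiftl (cD_continuous N1).
have h6 := continuous_shiftl (cH_continuous N1).
have h7 := cD_continuous N2; have h8 := cH_continuous N2.
by apply: cvgD; apply: cvgD; apply: cvgM.
Qed.

(** The mean value theorem in the height: differentiating under the integral gives the integral of
    [cdW], which is a difference of end values of [cZ]. An unspecified height c suffices, because
    the end values are later bounded uniformly in the height. *)
Lemma cW_diff a k l (A B phi0 : R) : 0 < k <= 1 -> 0 < l <= 1 -> A < B ->
  0 < phi0 < pi ->
  exists2 c, phi0 < c < pi &
   \int[mu]_(x in `[A, B]) cW a k l pi x - \int[mu]_(x in `[A, B]) cW a k l phi0 x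
   = - (cZ a k l c B - cZ a k l c A) * (pi - phi0).
Proof.
move=> k01 l01 AB /andP[p0 ppi].
(* The heights in ]eta, 2 pi - eta[ form an open neighbourhood of [phi0, pi] on which the distance
   to the poles at heights 0 and 2 pi is bounded below. *)
pose eta := phi0 / 2.
have eta0 : 0 < eta by rewrite divr_gt0.
have keta m : 0 < m <= 1 -> 0 < 2 - 2 * cos (m * eta).
  move=> /andP[m0 m1].
  have h : cos (m * eta) < cos 0.
    rewrite ltr_cos ?in_itv/= ?lexx ?pi_ge0 ?mulr_gt0//.
    rewrite mulr_ge0 ?(ltW m0) ?(ltW eta0)//= (@le_trans _ _ eta)//; first by rewrite ler_piMl// ltW.
    by rewrite /eta; lra.
  by move: h; rewrite cos0; lra.
have kmin m phi : 0 < m <= 1 -> eta < phi < 2 * pi - eta -> 2 - 2 * cos (m * eta) <= 2 - 2 * cos (m * phi).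
  move=> m01 /andP[h1 h2].
  have := cos_le_away m01 (ltW eta0) (ltW h1) (ltW h2); lra.
have den0 m phi x : 0 < m <= 1 -> eta < phi < 2 * pi - eta -> cden m phi x != 0.
  move=> m01 h; rewrite gt_eqF//; apply: lt_le_trans (cden_ge2 _ _ _).
  exact: lt_le_trans (keta _ m01) (kmin _ _ m01 h).
have cint (f : R -> R) : (forall x, {for x, continuous f}) -> mu.-integrable `[A, B] (EFin \o f).
  move=> cf; apply: continuous_compact_integrable; first exact: segment_compact.
  exact: continuous_subspaceT.
pose F p := \int[mu]_(x in `[A, B]) cW a k l p x.
have dF p : eta < p < 2 * pi - eta -> is_derive p 1 F (- (cZ a k l p B - cZ a k l p A)).
  move=> hp.
  have pI : (`]eta, (2 * pi - eta)[%classic : set R) p by rewrite /= in_itv/=.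
  (* With u the first inverse, u + 4 u^2 + 1/2 dominates the bounds of all four functions of
     exponent k, and likewise for l; the factor 4 counts the products in [cdW]. *)
  pose M := ((2 - 2 * cos (k * eta))^-1 + 4 * (2 - 2 * cos (k * eta))^-1 ^+ 2 + 2^-1) *
            ((2 - 2 * cos (l * eta))^-1 + 4 * (2 - 2 * cos (l * eta))^-1 ^+ 2 + 2^-1) * 4.
  have intf q : (`]eta, (2 * pi - eta)[%classic : set R) q -> mu.-integrable `[A, B] (EFin \o cW a k l q).
    rewrite /= in_itv/= => hq; apply: cint => x; apply: cW_continuous; exact: den0.
  have derf q x : (`]eta, (2 * pi - eta)[%classic : set R) q -> `[A, B]%classic x -> derivable (cW a k l ^~ x) q 1.
    rewrite /= in_itv/= => hq _.
    by case: (is_derive_cWphi (den0 _ _ (a + x) k01 hq) (den0 _ _ x l01 hq)).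
  have d1E q x : (`]eta, (2 * pi - eta)[%classic : set R) q -> partial1of2 (cW a k l) q x = cdW a k l q x.
    rewrite /= in_itv/= => hq.
    have h := is_derive_cWphi (den0 _ _ (a + x) k01 hq) (den0 _ _ x l01 hq).
    by rewrite partial1of2E; apply: derive_val.
  have M0 : 0 <= M.
    by rewrite /M mulr_ge0 ?mulr_ge0 ?addr_ge0 ?(mulr_ge0 (ler0n R 4)) ?sqr_ge0 ?invr_ge0 ?(ltW (keta _ k01)) ?(ltW (keta _ l01)).
  have intM : mu.-integrable `[A, B] (EFin \o cst M).
    by apply: cint => x; exact: cst_continuous.
  have bnd q x : (`]eta, (2 * pi - eta)[%classic : set R) q -> `[A, B]%classic x -> `|partial1of2 (cW a k l) q x| <= (cst M) x.
    move=> hq _; rewrite d1E//; move: hq; rewrite /= in_itv/= => hq.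
    have hk := kmin _ _ k01 hq; have hl := kmin _ _ l01 hq.
    have k0 := keta _ k01; have l0 := keta _ l01.
    rewrite /M /cdW.
    have ki : 0 < (2 - 2 * cos (k * eta))^-1 by rewrite invr_gt0.
    have li : 0 < (2 - 2 * cos (l * eta))^-1 by rewrite invr_gt0.
    have qk := cQ_le (a + x) k0 k01 hk; have pk := cP_le (a + x) k0 k01 hk.
    have dk := cD_le (a + x) k0 k01 hk; have hhk := cH_le (a + x) k0 k01 hk.
    have ql := cQ_le x l0 l01 hl; have pl := cP_le x l0 l01 hl.
    have dl := cD_le x l0 l01 hl; have hhl := cH_le x l0 l01 hl.
    move: (2 - 2 * cos (k * eta))^-1 (2 - 2 * cos (l * eta))^-1 ki li qk pk dk hhk ql pl dl hhl => u v u0 v0.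
    have u2 := sqr_ge0 u; have v2 := sqr_ge0 v => b1 b2 b3 b4 b5 b6 b7 b8.
    have t (s r : R) : `|s| <= u + 4 * u ^+ 2 + 2^-1 -> `|r| <= v + 4 * v ^+ 2 + 2^-1 ->
        `|s * r| <= (u + 4 * u ^+ 2 + 2^-1) * (v + 4 * v ^+ 2 + 2^-1).
      by move=> *; rewrite normrM ler_pM.
    have t1 : `|cH k q (a + x) * cP l q x| <= (u + 4 * u ^+ 2 + 2^-1) * (v + 4 * v ^+ 2 + 2^-1).
      by apply: t; [apply: le_trans b4 _|apply: le_trans b6 _]; lra.
    have t2 : `|cQ k q (a + x) * cD l q x| <= (u + 4 * u ^+ 2 + 2^-1) * (v + 4 * v ^+ 2 + 2^-1).
      by apply: t; [apply: le_trans b1 _|apply: le_trans b7 _]; lra.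
    have t3 : `|cD k q (a + x) * cQ l q x| <= (u + 4 * u ^+ 2 + 2^-1) * (v + 4 * v ^+ 2 + 2^-1).
      by apply: t; [apply: le_trans b3 _|apply: le_trans b5 _]; lra.
    have t4 : `|cP k q (a + x) * cH l q x| <= (u + 4 * u ^+ 2 + 2^-1) * (v + 4 * v ^+ 2 + 2^-1).
      by apply: t; [apply: le_trans b2 _|apply: le_trans b8 _]; lra.
    apply: le_trans (ler_normD _ _) _.
    apply: le_trans (lerD (ler_normD _ _) (ler_normD _ _)) _.
    lra.
  have DF : derivable F p 1 := @derivable_under_integral R _ _ mu (cW a k l) _ (measurable_itv _) p _ _ pI intf derf (cst M) (fun=> M0) intM bnd.
  apply: DeriveDef => //.
  rewrite -derive1E (@differentiation_under_integral R _ _ mu (cW a k l) _ (measurable_itv _) p _ _ pI intf derf (cst M) (fun=> M0) intM bnd).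
  under eq_Rintegral do rewrite d1E//.
  have dN x : cden k p (a + x) != 0 /\ cden l p x != 0 by split; exact: den0.
  rewrite /Rintegral.
  have dZ x : is_derive x 1 (fun y => - cZ a k l p y) (cdW a k l p x).
    have [n1 n2] := dN x; have h := is_derive_cZx n1 n2.
    by apply: is_derive_eq; rewrite opprK.
  rewrite (integral_is_derive AB (fun x _ => dZ x)) /=; first by ring.
  by move=> x _; have [] := dN x; exact: cdW_continuous.
have cF : {within `[phi0, pi], continuous F}.
  apply: derivable_within_continuous => x; rewrite in_itv/= => /andP[h1 h2].
  suff h : eta < x < 2 * pi - eta by case: (dF x h).
  by rewrite /eta; apply/andP; split; lra.
have [c cab e] := @MVT R F (fun p => - (cZ a k l p B - cZ a k l p A)) phi0 pi ppi
  (fun x hx => dF x (ltac:(move: hx; rewrite in_itv/= /eta => /andP[? ?]; apply/andP; split; lra))) cF.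
by exists c => //; move: cab; rewrite in_itv.
Qed.
End contour.

(** * The imaginary part of the kernel as an approximate point mass *)

Section approximate_identity.
Context {R : realType}.
Implicit Types (k l phi x y b c rho : R).
Local Notation mu := (@lebesgue_measure R).

Lemma expR_lipschitz rho (u v : R) : `|u| <= rho -> `|v| <= rho ->
  `|expR u - expR v| <= expR rho * `|u - v|.
Proof.
wlog uv : u v / v <= u => [h|] hu hv.
  have [/h->//|/ltW vu] := leP v u.
  by rewrite distrC (distrC u) h.
have h1 : expR v = expR u * expR (v - u) by rewrite -expRD; congr expR; ring.
have h2 := expR_ge1Dx (v - u).
have h3 : expR u <= expR rho by rewrite ler_expR (le_trans (ler_norm _)).
have h4 := expR_gt0 u.
rewrite !ger0_norm ?subr_ge0 ?ler_expR//.
rewrite {1}h1; have : expR u * (1 + (v - u)) <= expR u * expR (v - u) by rewrite ler_pM2l.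
have : expR u * (u - v) <= expR rho * (u - v) by rewrite ler_wpM2r ?subr_ge0.
lra.
Qed.

Lemma cexp_lipschitz k rho (u v : R) : 0 < k <= 1 -> `|u| <= rho -> `|v| <= rho ->
  `|(expR (k * u) - expR (- (k * u))) - (expR (k * v) - expR (- (k * v)))| <= 2 * expR rho * `|u - v| /\
  `|(expR (k * u) + expR (- (k * u))) - (expR (k * v) + expR (- (k * v)))| <= 2 * expR rho * `|u - v|.
Proof.
move=> /andP[k0 k1] hu hv.
have kle (t : R) : `|t| <= rho -> `|k * t| <= rho.
  by move=> h; rewrite normrM gtr0_norm// (le_trans _ h)// ler_piMl.
have h1 := expR_lipschitz (kle _ hu) (kle _ hv).
have h2 := @expR_lipschitz rho (- (k * u)) (- (k * v)).
rewrite !normrN in h2; have {}h2 := h2 (kle _ hu) (kle _ hv).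
have e2 : - (k * u) - - (k * v) = - (k * u - k * v) by ring.
rewrite e2 normrN in h2.
have h3 : expR rho * `|k * u - k * v| <= expR rho * `|u - v|.
  by rewrite ler_pM2l ?expR_gt0// -mulrBr normrM gtr0_norm// ler_piMl.
split.
  have -> : expR (k * u) - expR (- (k * u)) - (expR (k * v) - expR (- (k * v))) =
    (expR (k * u) - expR (k * v)) - (expR (- (k * u)) - expR (- (k * v))) by ring.
  by apply: le_trans (ler_normB _ _) _; lra.
have -> : expR (k * u) + expR (- (k * u)) - (expR (k * v) + expR (- (k * v))) =
    (expR (k * u) - expR (k * v)) + (expR (- (k * u)) - expR (- (k * v))) by ring.
by apply: le_trans (ler_normD _ _) _; lra.
Qed.

Lemma amgm_quotient (s t : R) : 0 < s ^+ 2 + t ^+ 2 -> `|s| * `|t| / (s ^+ 2 + t ^+ 2) <= 1.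
Proof.
move=> h; rewrite ler_pdivrMr// mul1r.
have := sqr_ge0 (`|s| - `|t|); have := real_normK (num_real s); have := real_normK (num_real t).
have := sqr_ge0 s; have := sqr_ge0 t; nra.
Qed.

Section bounds.
Variables (k l b rho phi y : R).
Hypotheses (k01 : 0 < k <= 1) (l01 : 0 < l <= 1) (b0 : b != 0) (phi_gt0 : 0 < phi)
  (phi_le : phi <= pi / 2) (yrho : `|y| <= rho) (brho : `|b| <= rho) (byrho : `|b + y| <= rho).

Let phipi : 0 <= phi <= pi.
Proof. by have := pi_ge0 R; move: phi_le phi_gt0; lra. Qed.

Lemma sinMl_gt0 (m : R) : 0 < m <= 1 -> 0 < sin (m * phi).
Proof.
move=> m01; apply: lt_le_trans (sin_Ml_ge m01 phipi).
have /andP[m0 _] := m01.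
rewrite mulr_gt0// sin_gt0_pi// phi_gt0/=.
have := pi_gt0 R; move: phi_le; lra.
Qed.

(** As phi tends to 0 the sines attached to the two exponents vanish at comparable rates; this lets
    the small factor of one kernel absorb the pole of the other. *)
Lemma sinMl_compare (m n : R) : 0 < m <= 1 -> 0 < n <= 1 -> n * sin (m * phi) <= sin (n * phi).
Proof.
move=> m01 n01; apply: le_trans (sin_Ml_ge n01 phipi).
have /andP[n0 _] := n01.
by rewrite ler_pM2l// sin_Ml_le// ltW//=.
Qed.

(** Away from y = 0 the factor [cP] is O(sin (l phi)). The other factor may be near its pole y = -
    b, but by the arithmetic-geometric inequality in the denominator it is at most of order 1 / sin
    (k phi), and the two sines are comparable. The bound involves neither phi nor y, as dominated
    convergence demands. *)
Lemma approx_bound_far : `|b| / 2 <= `|y| ->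
  `|(cQ k phi (b + y) - cQ k 0 b) * cP l phi y| <= (expR rho / k + `|cQ k 0 b|) / (l * b ^+ 2 / 4).
Proof.
move=> hy.
have sk := sinMl_gt0 k01; have sl := sinMl_gt0 l01.
have slk := sinMl_compare l01 k01.
have /andP[k0 k1] := k01; have /andP[l0 l1] := l01.
have b2 : 0 < b ^+ 2 by rewrite exprn_even_gt0.
have m0 : 0 < l * b ^+ 2 / 4 by rewrite divr_gt0// mulr_gt0.
have y2 : b ^+ 2 / 4 <= y ^+ 2.
  have : (`|b| / 2) ^+ 2 <= `|y| ^+ 2 by rewrite ler_pXn2r ?nnegrE ?divr_ge0.
  by rewrite expr_div_n !real_normK ?num_real//; lra.
have Nl := cden_gt0 y (lt0r_neq0 sl).
have P1 : `|cP l phi y| <= sin (l * phi) / (l * b ^+ 2 / 4).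
  rewrite /cP; apply: ler_norm_div => //.
  rewrite (ger0_norm (mulr_ge0 (ltW l0) (ltW sl))).
  rewrite mulrAC ler_pdivlMr//.
  rewrite [leLHS]mulrC (mulrC (sin _)) mulrA ler_pM2r//.
  apply: le_trans (cden_ge _ _ _).
  have : l ^+ 2 * (b ^+ 2 / 4) <= l ^+ 2 * y ^+ 2 by rewrite ler_wpM2l ?sqr_ge0.
  by rewrite exprMn; have := sqr_ge0 (sin (l * phi)); lra.
have Nk := cden_gt0 (b + y) (lt0r_neq0 sk).
have Q1 : `|cQ k phi (b + y)| * sin (l * phi) <= expR rho / k.
  have r0 : `|0 : R| <= rho by rewrite normr0 (le_trans _ yrho).
  have [h1 _] := cexp_lipschitz k01 byrho r0.
  rewrite mulr0 oppr0 subrr !subr0 ?addr0 in h1.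
  have am := amgm_quotient (_ : 0 < (k * (b + y)) ^+ 2 + sin (k * phi) ^+ 2).
  have {am}am : `|k * (b + y)| * `|sin (k * phi)| <= cden k phi (b + y).
    apply: le_trans (cden_ge _ _ _).
    rewrite -[leRHS]mul1r -ler_pdivrMr ?am//; by rewrite ltr_wpDl ?sqr_ge0// exprn_gt0.
  rewrite normrM (gtr0_norm k0) (gtr0_norm sk) in am.
  rewrite /cQ normf_div (gtr0_norm Nk) normrM (gtr0_norm (divr_gt0 k0 (ltr0n R 2))).
  rewrite mulrAC ler_pdivrMr// [leRHS]mulrAC ler_pdivlMr//.
  have t1 : `|expR (k * (b + y)) - expR (- (k * (b + y)))| * (k * sin (l * phi)) <=
     (2 * expR rho * `|b + y|) * sin (k * phi).
    by apply: ler_pM => //; apply: mulr_ge0; apply: ltW.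
  have t2 : expR rho * (k * `|b + y| * sin (k * phi)) <= expR rho * cden k phi (b + y).
    by rewrite ler_pM2l ?expR_gt0.
  have t3 : k / 2 * (`|expR (k * (b + y)) - expR (- (k * (b + y)))| * (k * sin (l * phi))) <=
     k / 2 * ((2 * expR rho * `|b + y|) * sin (k * phi)).
    by rewrite ler_wpM2l// ltW// divr_gt0.
  lra.
rewrite normrM; apply: (@le_trans _ _ ((`|cQ k phi (b + y)| + `|cQ k 0 b|) * (sin (l * phi) / (l * b ^+ 2 / 4)))).
  by apply: ler_pM => //; exact: ler_normB.
rewrite mulrA ler_pM2r ?invr_gt0// mulrDl lerD//.
by rewrite ler_piMr// sin_le1.
Qed.

(** Here b + y stays at distance |b| / 2 from the pole, so the difference of the two [cQ] is of
    order |y| + (1 - cos (k phi)). Each term is bounded after multiplication by [cP]: |y| by the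
    arithmetic-geometric inequality, 1 - cos (k phi) by comparison with sin (l phi). *)
Lemma approx_bound_near : `|y| <= `|b| / 2 ->
  `|(cQ k phi (b + y) - cQ k 0 b) * cP l phi y| <=
  k * (expR rho + `|expR (k * b) - expR (- (k * b))| / cden k 0 b * (expR rho + 1)) / (k ^+ 2 * b ^+ 2 / 4).
Proof.
move=> hy.
have sk := sinMl_gt0 k01; have sl := sinMl_gt0 l01.
have skl := sinMl_compare k01 l01.
have /andP[k0 k1] := k01; have /andP[l0 l1] := l01.
have b2 : 0 < b ^+ 2 by rewrite exprn_even_gt0.
have m0 : 0 < k ^+ 2 * b ^+ 2 / 4 by rewrite divr_gt0// mulr_gt0// exprn_gt0.
have z2 : b ^+ 2 / 4 <= (b + y) ^+ 2.
  have h : `|b| / 2 <= `|b + y|.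
    by have := lerB_dist b (- y); rewrite opprK normrN; lra.
  have : (`|b| / 2) ^+ 2 <= `|b + y| ^+ 2 by rewrite ler_pXn2r ?nnegrE ?divr_ge0.
  by rewrite expr_div_n !real_normK ?num_real//; lra.
have N0 : 0 < cden k 0 b.
  apply: lt_le_trans (cden_ge _ _ _); rewrite mulr0 sin0 expr0n/= addr0 exprMn.
  by rewrite mulr_gt0// exprn_gt0.
have Nk := cden_gt0 (b + y) (lt0r_neq0 sk).
have Nl := cden_gt0 y (lt0r_neq0 sl).
have Nkm : k ^+ 2 * b ^+ 2 / 4 <= cden k phi (b + y).
  apply: le_trans (cden_ge _ _ _).
  have : k ^+ 2 * (b ^+ 2 / 4) <= k ^+ 2 * (b + y) ^+ 2 by rewrite ler_wpM2l ?sqr_ge0.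
  by rewrite exprMn; have := sqr_ge0 (sin (k * phi)); lra.
have [h1 h2] := cexp_lipschitz k01 byrho brho.
rewrite (_ : b + y - b = y) in h1 h2; last by ring.
have c1 : 1 - cos (k * phi) <= sin (k * phi).
  apply: onem_cos_le_sin; rewrite mulr_ge0 ?(ltW k0) ?(ltW phi_gt0)//=.
  by apply: le_trans phi_le; rewrite ler_piMl// ltW.
have c0 : 0 <= 1 - cos (k * phi) by rewrite subr_ge0 cos_le1.
set sg := `|expR (k * b) - _| / _.
have sg0 : 0 <= sg by rewrite divr_ge0// ltW.
set E := expR rho in h1 h2 *.
have E0 : 0 < E by rewrite expR_gt0.
have dN : `|cden k phi (b + y) - cden k 0 b| <= 2 * E * `|y| + 2 * (1 - cos (k * phi)).
  have -> : cden k phi (b + y) - cden k 0 b =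
     (expR (k * (b + y)) + expR (- (k * (b + y))) - (expR (k * b) + expR (- (k * b)))) + 2 * (1 - cos (k * phi)).
    by rewrite /cden mulr0 cos0; ring.
  apply: le_trans (ler_normD _ _) _; apply: lerD => //.
  by rewrite ger0_norm// mulr_ge0.
have dQ : `|cQ k phi (b + y) - cQ k 0 b| <= k * (E * `|y| + sg * (E * `|y| + (1 - cos (k * phi)))) / (k ^+ 2 * b ^+ 2 / 4).
  have -> : cQ k phi (b + y) - cQ k 0 b = (k / 2 * ((expR (k * (b + y)) - expR (- (k * (b + y)))
     - (expR (k * b) - expR (- (k * b)))) - (expR (k * b) - expR (- (k * b))) / cden k 0 b * (cden k phi (b + y) - cden k 0 b)))
      / cden k phi (b + y).
    by rewrite /cQ; field; rewrite !gt_eqF.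
  rewrite normf_div (gtr0_norm Nk) ler_pM ?invr_ge0 ?(ltW Nk)//; last by rewrite lef_pV2.
  rewrite normrM (gtr0_norm (divr_gt0 k0 (ltr0n R 2))) -[leLHS]mulrA ler_pM2l//.
  rewrite mulrC ler_pdivrMr//; apply: le_trans (ler_normB _ _) _.
  rewrite normrM normf_div (gtr0_norm N0) -/sg.
  have := ler_wpM2l sg0 dN; lra.
have am := amgm_quotient (_ : 0 < (l * y) ^+ 2 + sin (l * phi) ^+ 2).
have {am}am : `|l * y| * `|sin (l * phi)| <= cden l phi y.
  apply: le_trans (cden_ge _ _ _).
  rewrite -[leRHS]mul1r -ler_pdivrMr ?am//; by rewrite ltr_wpDl ?sqr_ge0// exprn_gt0.
rewrite normrM (gtr0_norm l0) (gtr0_norm sl) in am.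
have P0 : 0 <= cP l phi y by rewrite /cP !mulr_ge0 ?invr_ge0 ?ltW.
have yP : `|y| * cP l phi y <= 1.
  by rewrite /cP mulrA ler_pdivrMr// mul1r; lra.
have cPb : (1 - cos (k * phi)) * cP l phi y <= 1.
  rewrite /cP mulrA ler_pdivrMr// mul1r; apply: le_trans (cden_ge _ _ _).
  have : l * (1 - cos (k * phi)) <= sin (l * phi).
    by apply: le_trans skl; rewrite ler_pM2l.
  move=> h; have := ler_wpM2r (ltW sl) h; have := sqr_ge0 (l * y); rewrite expr2; lra.
rewrite normrM (ger0_norm P0); apply: le_trans (ler_wpM2r P0 dQ) _.
rewrite mulrAC ler_pM2r ?invr_gt0// -mulrA ler_pM2l//.
have := ler_wpM2l (ltW E0) yP; have := ler_wpM2l sg0 cPb.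
have := ler_wpM2l (mulr_ge0 sg0 (ltW E0)) yP.
lra.
Qed.
End bounds.
End approximate_identity.

(** * Dominated convergence with a constant bound *)

Section bounded_convergence.
Context d (T : measurableType d) (R : realType) (mu : {measure set T -> \bar R}).

Lemma bounded_convergence (D : set T) (f_ : nat -> T -> R) (f : T -> R) (M : R) :
  measurable D -> (mu D < +oo)%E -> (forall n, measurable_fun D (f_ n)) ->
  measurable_fun D f -> {ae mu, forall x, D x -> f_ ^~ x @ \oo --> f x} ->
  (forall n x, D x -> `|f_ n x| <= M) ->
  (\int[mu]_(x in D) (f_ n x)%:E @[n --> \oo] --> \int[mu]_(x in D) (f x)%:E)%E.
Proof.
move=> mD Dfin mf_ mf cvf bf.
have [//|//||//||//] := @dominated_convergence _ _ _ mu D mD (fun n x => (f_ n x)%:E) (fun x => (f x)%:E) (cst M%:E).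
- by move=> n; exact/measurable_EFinP.
- exact/measurable_EFinP.
- by apply: filterS cvf => x h Dx; apply: cvg_EFin; [exact: nearW|exact: h].
- apply: (@measurable_bounded_integrable _ _ _ mu (cst M) D mD Dfin) => //.
  exact: bounded_cst.
- by apply: aeW => x n Dx; rewrite /= lee_fin; exact: bf.
Qed.

End bounded_convergence.

(** * Limits of the integrals as the height tends to 0 *)

Section poisson_kernel_limits.
Context {R : realType}.
Implicit Types (k l phi x y b c rho e : R).
Local Notation mu := (@lebesgue_measure R).

Lemma sin_le_id x : 0 <= x -> sin x <= x.
Proof.
move=> x0; pose f (t : R) := t - sin t.
have df (t : R) : is_derive t 1 f (1 - cos t).
  by rewrite /f; apply: is_derive_eq; rewrite /GRing.scale/=; ring.
have : f 0 <= f x by apply: (derive_ge0_homo df) => // t _ _; rewrite subr_ge0 cos_le1.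
by rewrite /f sin0; lra.
Qed.

(** The heights 1 / (n + 1) tend to 0 within ]0, pi / 2], the range of validity of the two bounds
    above. *)
Lemma harmonic_pihalf n : 0 < (harmonic n : R) <= (pi / 2 : R).
Proof.
rewrite /harmonic invr_gt0 ltr0Sn/=; apply: (@le_trans _ _ 1); first by rewrite invf_le1 ?ler1n ?ltr0Sn.
by have := pi_ge2 R; lra.
Qed.

(** The numerator is at least e - 1 > 0 and the sine is at most 1 / (n + 1). Together with the next
    lemma: the primitive of [cP] tends to a step of height pi at the pole. *)
Lemma atan_pole_cvgr l e : 0 < l <= 1 -> 1 < e ->
  atan ((e - cos (l * harmonic n)) / sin (l * harmonic n)) @[n --> \oo] --> (pi / 2 : R).
Proof.
move=> l01 e1; have /andP[l0 l1] := l01.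
apply: (cvg_comp _ _ _ (@cvgy_atan R)).
apply/cvgryPge => M; near=> n.
have /andP[h0 h1] := @harmonic_pihalf n.
have s0 := sinMl_gt0 h0 h1 l01.
rewrite ler_pdivlMr//; apply: (@le_trans _ _ (e - 1)); last by have := cos_le1 (l * (harmonic n : R)); lra.
have sn : sin (l * (harmonic n : R)) <= (n.+1%:R)^-1.
  by apply: le_trans (sin_le_id _) _; [rewrite mulr_ge0 // ltW|rewrite ler_piMl// ltW].
have [M0|M0] := leP M 0; first by apply: (@le_trans _ _ 0); [rewrite mulr_le0_ge0// ltW|lra].
apply: (@le_trans _ _ (M * n.+1%:R^-1)); first by rewrite ler_pM2l.
rewrite ler_pdivrMr ?ltr0Sn// mulrC -ler_pdivrMr; last by lra.
apply: (@le_trans _ _ n%:R); last by rewrite ler_nat.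
near: n; exact: nbhs_infty_ger.
Unshelve. all: by end_near. Qed.

Lemma atan_pole_cvgl l e : 0 < l <= 1 -> e < 1 ->
  atan ((e - cos (l * harmonic n)) / sin (l * harmonic n)) @[n --> \oo] --> (- (pi / 2) : R).
Proof.
move=> l01 e1; have /andP[l0 l1] := l01.
under eq_fun do rewrite -[atan _]opprK -atanN.
apply: cvgN; apply: (cvg_comp _ _ _ (@cvgy_atan R)).
apply/cvgryPge => M; near=> n.
have /andP[h0 h1] := @harmonic_pihalf n.
have s0 := sinMl_gt0 h0 h1 l01.
rewrite -mulNr ler_pdivlMr//.
have c1 : 1 - cos (l * (harmonic n : R)) <= sin (l * (harmonic n : R)).
  apply: onem_cos_le_sin; rewrite mulr_ge0 ?(ltW l0) ?(ltW h0)//=.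
  by apply: le_trans h1; rewrite ler_piMl// ltW.
have sn : sin (l * (harmonic n : R)) <= (n.+1%:R)^-1.
  by apply: le_trans (sin_le_id _) _; [rewrite mulr_ge0 // ltW|rewrite ler_piMl// ltW].
suff : (`|M| + 1) * sin (l * (harmonic n : R)) <= 1 - e.
  have : M * sin (l * (harmonic n : R)) <= `|M| * sin (l * (harmonic n : R)) by rewrite ler_pM2r// ler_norm.
  lra.
apply: (@le_trans _ _ ((`|M| + 1) * n.+1%:R^-1)); first by rewrite ler_wpM2l// addr_ge0.
rewrite ler_pdivrMr ?ltr0Sn// mulrC -ler_pdivrMr; last by lra.
apply: (@le_trans _ _ n%:R); last by rewrite ler_nat.
near: n; exact: nbhs_infty_ger.
Unshelve. all: by end_near. Qed.

Lemma is_derive_atan_cP l phi x : sin (l * phi) != 0 ->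
  is_derive x 1 (fun y => atan ((expR (l * y) - cos (l * phi)) / sin (l * phi))) (cP l phi x).
Proof.
move=> s0; have h1 := is_derive_expRMl l x.
have h2 : is_derive x 1 (fun y => (expR (l * y) - cos (l * phi)) / sin (l * phi)) (l * expR (l * x) / sin (l * phi)).
  by apply: is_derive_eq; rewrite /GRing.scale/=; ring.
have h := @is_derive1_comp R _ (fun y => (expR (l * y) - cos (l * phi)) / sin (l * phi)) _ _ _ (is_derive1_atan ((expR (l * x) - cos (l * phi)) / sin (l * phi))) h2.
apply: (is_derive_eq h); rewrite /cP /cden.
have e := expRMN1 (l * x); have e0 := expR_gt0 (l * x); have s2 := sin2cos2 (l * phi).
have N0 : cden l phi x != 0 by rewrite gt_eqF// cden_gt0.
rewrite -/(cden l phi x).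
have -> : 1 + ((expR (l * x) - cos (l * phi)) / sin (l * phi)) ^+ 2 =
    expR (l * x) * cden l phi x / sin (l * phi) ^+ 2.
  rewrite expr_div_n -[1](divff (_ : sin (l * phi) ^+ 2 != 0)) ?expf_neq0// -mulrDl; congr (_ / _).
  by rewrite s2 /cden; ring: e.
by field; rewrite s0 N0 gt_eqF.
Qed.

Lemma cP_integral l phi c (A B : R) : sin (l * phi) != 0 -> A < B ->
  (\int[mu]_(x in `[A, B]) (cP l phi (c + x))%:E =
  (atan ((expR (l * (c + B)) - cos (l * phi)) / sin (l * phi)) -
  atan ((expR (l * (c + A)) - cos (l * phi)) / sin (l * phi)))%:E)%E.
Proof.
move=> s0 AB.
have dF x : is_derive x 1 (fun y => atan ((expR (l * (c + y)) - cos (l * phi)) / sin (l * phi))) (cP l phi (c + x)).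
  exact: (is_derive_shiftl (is_derive_atan_cP (c + x) s0)).
rewrite (integral_is_derive _ (fun x _ => dF x))//.
move=> x _; apply: continuous_shiftl.
by apply: cP_continuous; rewrite gt_eqF// cden_gt0.
Qed.

Lemma cP_integral_cvg l c (A B : R) : 0 < l <= 1 -> A < - c < B ->
  (\int[mu]_(x in `[A, B]) (cP l (harmonic n) (c + x))%:E @[n --> \oo] --> pi%:E)%E.
Proof.
move=> l01 /andP[Ac cB]; have /andP[l0 l1] := l01.
have -> : (pi : R) = pi / 2 - - (pi / 2) by lra.
have -> : (fun n => \int[mu]_(x in `[A, B]) (cP l (harmonic n) (c + x))%:E)%E =
   (fun n => (atan ((expR (l * (c + B)) - cos (l * harmonic n)) / sin (l * harmonic n)) -
  atan ((expR (l * (c + A)) - cos (l * harmonic n)) / sin (l * harmonic n)))%:E).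
  apply/funext => n; have /andP[h0 h1] := @harmonic_pihalf n.
  by rewrite cP_integral ?(lt_trans Ac cB)// gt_eqF// sinMl_gt0.
apply: cvg_EFin; first exact: nearW.
apply: cvgB.
  by apply: atan_pole_cvgr => //; rewrite expR_gt1 mulr_gt0//; lra.
apply: atan_pole_cvgl => //; rewrite expR_lt1.
by rewrite pmulr_rlt0//; lra.
Qed.

Lemma cQcP_integral_cvg k l b c (A B : R) : 0 < k <= 1 -> 0 < l <= 1 -> b != 0 ->
  A < - c < B ->
  (\int[mu]_(x in `[A, B]) (cQ k (harmonic n) (b + (c + x)) * cP l (harmonic n) (c + x))%:E @[n --> \oo]
   --> (cQ k 0 b * pi)%:E)%E.
Proof.
move=> k01 l01 b0 AcB; have /andP[Ac cB] := AcB.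
have /andP[k0 k1] := k01; have /andP[l0 l1] := l01.
have AB := lt_trans Ac cB.
pose h := fun n => harmonic n : R.
have den n m x : 0 < m <= 1 -> cden m (h n) x != 0.
  move=> m01; have /andP[h0 h1] := @harmonic_pihalf n.
  by rewrite gt_eqF// cden_gt0// gt_eqF// sinMl_gt0.
have den0 m x : 0 < m -> x != 0 -> cden m 0 x != 0.
  move=> m0 x0; rewrite gt_eqF//; apply: lt_le_trans (cden_ge _ _ _).
  by rewrite mulr0 sin0 expr0n/= addr0 exprn_even_gt0//= mulf_neq0// gt_eqF.
have cP_c n : continuous (fun x => cP l (h n) (c + x)).
  by move=> x; apply: continuous_shiftl; apply: cP_continuous; exact: den.
have cQ_c n : continuous (fun x => cQ k (h n) (b + (c + x))).
  by move=> x; apply: (@continuous_shiftl _ (fun y => cQ k (h n) (b + y)));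
  apply: continuous_shiftl; apply: cQ_continuous; exact: den.
pose f n x := (cQ k (h n) (b + (c + x)) - cQ k 0 b) * cP l (h n) (c + x).
have cf n : continuous (f n).
  by move=> x; apply: cvgM; [apply: cvgB; [exact: cQ_c|exact: cvg_cst]|exact: cP_c].
have cint (g : R -> R) : continuous g -> mu.-integrable `[A, B] (EFin \o g).
  move=> cg; apply: continuous_compact_integrable; first exact: segment_compact.
  exact: continuous_subspaceT.
have f0 : (\int[mu]_(x in `[A, B]) (f n x)%:E @[n --> \oo] --> 0)%E.
  have -> : (0 = \int[mu]_(x in `[A, B]) (cst 0 x)%:E)%E by rewrite integral0.
  (* rho bounds |c + x|, |b + (c + x)| and |b| for x in [A, B]. *)
  pose rho := `|A| + `|B| + `|c| + `|b|.
  pose M1 := (expR rho / k + `|cQ k 0 b|) / (l * b ^+ 2 / 4).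
  pose M2 := k * (expR rho + `|expR (k * b) - expR (- (k * b))| / cden k 0 b * (expR rho + 1)) / (k ^+ 2 * b ^+ 2 / 4).
  apply: (@bounded_convergence _ _ _ _ _ _ _ (Num.max M1 M2)) => //.
  - by rewrite /= lebesgue_measure_itv/= lte_fin AB -EFinB ltry.
  - by move=> n; apply: measurable_funTS; exact: continuous_measurable_fun.
  (* The two excluded points are the poles of the factors at height 0; everywhere else [cP] tends to
     its value 0 at that height. *)
  - exists ([set - c] `|` [set - b - c]); split.
    + exact: measurableU.
    + by rewrite null_set_setU//= lebesgue_measure_set1.
    + move=> x /= nP; apply: contrapT => /not_orP[x1 x2]; apply: nP => _.
      have cx0 : c + x != 0 by apply/eqP => e; apply: x1; lra.
      have bcx0 : b + (c + x) != 0 by apply/eqP => e; apply: x2; lra.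
      have e0 : (cQ k 0 (b + (c + x)) - cQ k 0 b) * cP l 0 (c + x) = 0.
        by rewrite /cP mulr0 sin0 mulr0 mul0r mulr0.
      suff : f n x @[n --> \oo] --> (cQ k 0 (b + (c + x)) - cQ k 0 b) * cP l 0 (c + x) by rewrite e0.
      apply: cvgM.
        apply: cvgB; last exact: cvg_cst.
        apply: (cvg_comp _ (fun p => cQ k p (b + (c + x))) (@cvg_harmonic R)).
        have hc : {for 0, continuous (fun p => cQ k p (b + (c + x)))}.
          by apply/differentiable_continuous/derivable1_diffP; case: (is_derive_cQphi (den0 k _ k0 bcx0)).
        exact: hc.
      apply: (cvg_comp _ (fun p => cP l p (c + x)) (@cvg_harmonic R)).
      have hc : {for 0, continuous (fun p => cP l p (c + x))}.
        by apply/differentiable_continuous/derivable1_diffP; case: (is_derive_cPphi (den0 l _ l0 cx0)).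
      exact: hc.
  - move=> n x; rewrite /= in_itv/= => /andP[Ax xB].
    have /andP[h0 h1] := @harmonic_pihalf n.
    have r1 : `|c + x| <= rho.
      have : `|x| <= `|A| + `|B|.
        by rewrite ler_norml; have := ler_norm (- A); have := ler_norm B; rewrite normrN;
           have := normr_ge0 A; have := normr_ge0 B; lra.
      by have := ler_normD c x; have := normr_ge0 b; rewrite /rho; lra.
    have r2 : `|b + (c + x)| <= rho.
      have : `|x| <= `|A| + `|B|.
        by rewrite ler_norml; have := ler_norm (- A); have := ler_norm B; rewrite normrN;
           have := normr_ge0 A; have := normr_ge0 B; lra.
      by have := ler_normD b (c + x); have := ler_normD c x; rewrite /rho; lra.
    have r3 : `|b| <= rho by rewrite /rho lerDr !addr_ge0.
    rewrite le_max; have [hy|/ltW hy] := leP (`|b| / 2) `|c + x|.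
      by rewrite (approx_bound_far k01 l01 b0 h0 h1 r1 r2 hy).
    by rewrite (approx_bound_near k01 l01 b0 h0 h1 r3 r2 hy) orbT.
have E n : (\int[mu]_(x in `[A, B]) (cQ k (harmonic n) (b + (c + x)) * cP l (harmonic n) (c + x))%:E =
   \int[mu]_(x in `[A, B]) (f n x)%:E + (cQ k 0 b)%:E * \int[mu]_(x in `[A, B]) (cP l (harmonic n) (c + x))%:E)%E.
  rewrite -integralZl//; last exact: cint.
  rewrite -integralD//; [|exact: cint|].
    by apply: eq_integral => x _; rewrite -EFinM -EFinD /f; congr EFin; ring.
  have mI : measurable (`[A, B]%classic : set R) by exact: measurable_itv.
  exact: (@integrableZl _ _ _ mu _ mI (cQ k 0 b) _ (cint _ (cP_c n))).
under eq_fun do rewrite E.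
have -> : (cQ k 0 b * pi)%:E = (0 + (cQ k 0 b)%:E * pi%:E)%E by rewrite add0e EFinM.
apply: cvgeD => //.
apply: cvgeZl => //; exact: cP_integral_cvg.
Qed.

End poisson_kernel_limits.

(** * From the real axis to the line of height pi *)

Section stieltjes_transform.
Context {R : realType}.
Implicit Types (k l phi x a b e : R).
Local Notation mu := (@lebesgue_measure R).

Lemma cP_le_sqr k phi x : 0 < k <= 1 -> x != 0 -> `|cP k phi x| <= ((k * x) ^+ 2)^-1.
Proof.
move=> /andP[k0 k1] x0.
have N1 : (k * x) ^+ 2 <= cden k phi x by apply: le_trans (cden_ge _ _ _); rewrite lerDl sqr_ge0.
have kx : 0 < (k * x) ^+ 2 by rewrite exprn_even_gt0//= mulf_neq0// gt_eqF.
have N0 := lt_le_trans kx N1.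
rewrite /cP normf_div (gtr0_norm N0) ler_pdivrMr//.
apply: (@le_trans _ _ 1); last by rewrite mulrC ler_pdivlMr// mul1r.
by rewrite normrM gtr0_norm// mulr_ile1 ?(ltW k0)// sin_max.
Qed.

(** (k / 2) coth tends to k / 2 and - k / 2 at the two ends. The true rate is exponential, but a
    quadratic one, uniform in the height, is enough. *)
Lemma cQ_sub_le_sqr k phi x : 0 < k <= 1 -> x != 0 ->
  `|cQ k phi x - Num.sg x * (k / 2)| <= 2 * ((k * x) ^+ 2)^-1.
Proof.
move=> /andP[k0 k1] x0.
have N1 : (k * x) ^+ 2 <= cden k phi x by apply: le_trans (cden_ge _ _ _); rewrite lerDl sqr_ge0.
have kx : 0 < (k * x) ^+ 2 by rewrite exprn_even_gt0//= mulf_neq0// gt_eqF.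
have N0 := lt_le_trans kx N1.
have main (t : R) : `|t| <= 2 -> `|k * t / cden k phi x| <= 2 * ((k * x) ^+ 2)^-1.
  move=> t2; rewrite normf_div (gtr0_norm N0) ler_pM ?invr_ge0 ?(ltW N0)//; last by rewrite lef_pV2.
  by rewrite normrM gtr0_norm// -[leRHS]mul1r ler_pM// (ltW k0).
have c1 := cos_max (k * phi).
have [x1|x1] : 0 < x \/ x < 0 by apply/orP; rewrite -real_neqr_lt ?num_real// eq_sym.
  rewrite gtr0_sg// mul1r.
  have -> : cQ k phi x - k / 2 = k * (cos (k * phi) - expR (- (k * x))) / cden k phi x.
    by rewrite /cQ; move: N0; rewrite /cden => N0; field; rewrite gt_eqF.
  apply: main; apply: le_trans (ler_normB _ _) _.
  have : expR (- (k * x)) <= 1 by rewrite expR_le1 oppr_le0 mulr_ge0 ?ltW.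
  by rewrite (ger0_norm (expR_ge0 _)); lra.
rewrite ltr0_sg// mulN1r opprK.
have -> : cQ k phi x + k / 2 = k * (expR (k * x) - cos (k * phi)) / cden k phi x.
  by rewrite /cQ; move: N0; rewrite /cden => N0; field; rewrite gt_eqF.
apply: main; apply: le_trans (ler_normB _ _) _.
have : expR (k * x) <= 1 by rewrite expR_le1 mulr_ge0_le0 ?ltW.
by rewrite (ger0_norm (expR_ge0 _)); lra.
Qed.

Section fixed.
Variables (alpha : R) (alpha_gt0 : 0 < alpha) (alpha_lt1 : alpha < 1).

Let one01 : 0 < (1 : R) <= 1. Proof. by rewrite ltr01 lexx. Qed.
Let a01 : 0 < alpha <= 1. Proof. by rewrite alpha_gt0 ltW. Qed.

(** At either end the two [cQ] have the same sign, so their product tends to alpha / 4 at both ends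
    and the boundary terms cancel. The single quantity d bounds all errors, since |x| and |a + x|
    are at least n - a at both ends and both exponents are at least alpha. *)
Lemma cZ_ends a c (n : nat) : 0 < a -> a < n%:R ->
  forall d, d = ((alpha * (n%:R - a)) ^+ 2)^-1 ->
  `|cZ a 1 alpha c n%:R - cZ a 1 alpha c (- n%:R)| <= 4 * d + 10 * d ^+ 2.
Proof.
move=> a0 an d dE.
have n0 : 0 < n%:R :> R by rewrite (lt_trans a0).
have na : 0 < n%:R - a by rewrite subr_gt0.
have d0 : 0 <= d by rewrite dE invr_ge0 sqr_ge0.
have dle k x : 0 < k <= 1 -> alpha <= k -> (n%:R - a) <= `|x| -> ((k * x) ^+ 2)^-1 <= d.
  move=> /andP[k0 k1] ak nx.
  have xn0 : 0 < `|x| by apply: lt_le_trans nx.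
  rewrite dE.
  have p1 : 0 < (alpha * (n%:R - a)) ^+ 2 by rewrite exprn_gt0// mulr_gt0.
  have p2 : 0 < (k * x) ^+ 2.
    rewrite exprn_even_gt0//=; apply: mulf_neq0; first by rewrite gt_eqF.
    by rewrite -normr_gt0.
  rewrite lef_pV2 ?posrE//.
  have -> : (k * x) ^+ 2 = (k * `|x|) ^+ 2 by rewrite !exprMn real_normK ?num_real.
  by rewrite ler_pXn2r ?nnegrE ?mulr_ge0 ?(ltW alpha_gt0) ?(ltW na) ?(ltW k0)// ler_pM ?(ltW alpha_gt0) ?(ltW na).
(* s is the common sign of the two real parts u and v. *)
have bnd (u v p q : R) (s : R) : s ^+ 2 = 1 -> `|u - s * (1 / 2)| <= 2 * d -> `|v - s * (alpha / 2)| <= 2 * d ->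
  `|p| <= d -> `|q| <= d -> `|u * v - p * q - alpha / 4| <= 2 * d + 5 * d ^+ 2.
  move=> s2 hu hv hp hq.
  have s1 : `|s| = 1 by apply/eqP; rewrite -(@eqrXn2 _ 2)// real_normK ?num_real// s2 expr1n.
  have -> : u * v - p * q - alpha / 4 = s * (alpha / 2) * (u - s * (1 / 2)) + s * (1 / 2) * (v - s * (alpha / 2))
      + (u - s * (1 / 2)) * (v - s * (alpha / 2)) - p * q + (s ^+ 2 - 1) * (alpha / 4) by field.
  rewrite s2 subrr mul0r addr0.
  have e1 : `|s * (alpha / 2) * (u - s * (1 / 2))| <= d.
    rewrite normrM normrM s1 (gtr0_norm (divr_gt0 alpha_gt0 (ltr0n R 2))).
    have : alpha / 2 * `|u - s * (1 / 2)| <= alpha / 2 * (2 * d) by rewrite ler_pM2l ?divr_gt0.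
    have : alpha * d <= d by rewrite ler_piMl// ltW.
    lra.
  have e2 : `|s * (1 / 2) * (v - s * (alpha / 2))| <= d.
    by rewrite normrM normrM s1 (gtr0_norm (divr_gt0 ltr01 (ltr0n R 2))); lra.
  have e3 : `|(u - s * (1 / 2)) * (v - s * (alpha / 2))| <= 4 * d ^+ 2.
    have -> : 4 * d ^+ 2 = (2 * d) * (2 * d) by ring.
    by rewrite normrM ler_pM.
  have e4 : `|p * q| <= d ^+ 2 by rewrite normrM expr2 ler_pM.
  apply: le_trans (ler_normB _ _) _.
  apply: le_trans (lerD (ler_normD _ _) (lexx _)) _.
  apply: le_trans (lerD (lerD (ler_normD _ _) (lexx _)) (lexx _)) _.
  lra.
have X1 : `|cZ a 1 alpha c n%:R - alpha / 4| <= 2 * d + 5 * d ^+ 2.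
  have an0 : a + n%:R != 0 by rewrite gt_eqF// addr_gt0.
  apply: (bnd _ _ _ _ 1); first by rewrite expr1n.
  - have := cQ_sub_le_sqr c one01 an0; rewrite gtr0_sg ?addr_gt0// => /le_trans; apply.
    by rewrite ler_pM2l// dle ?(ltW alpha_lt1)// ger0_norm ?addr_ge0 ?ltW//; lra.
  - have := cQ_sub_le_sqr c a01 (lt0r_neq0 n0); rewrite gtr0_sg// => /le_trans; apply.
    by rewrite ler_pM2l// dle// gtr0_norm//; lra.
  - apply: le_trans (cP_le_sqr c one01 an0) _.
    by rewrite dle ?(ltW alpha_lt1)// ger0_norm ?addr_ge0 ?ltW//; lra.
  - apply: le_trans (cP_le_sqr c a01 (lt0r_neq0 n0)) _.
    by rewrite dle// gtr0_norm//; lra.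
have X2 : `|cZ a 1 alpha c (- n%:R) - alpha / 4| <= 2 * d + 5 * d ^+ 2.
  have an0 : a + - n%:R < 0 by lra.
  have nn0 : - n%:R < 0 :> R by lra.
  apply: (bnd _ _ _ _ (-1)); first by rewrite sqrrN expr1n.
  - have := cQ_sub_le_sqr c one01 (ltr0_neq0 an0); rewrite ltr0_sg// => /le_trans; apply.
    by rewrite ler_pM2l// dle ?(ltW alpha_lt1)// ltr0_norm//; lra.
  - have := cQ_sub_le_sqr c a01 (ltr0_neq0 nn0); rewrite ltr0_sg// => /le_trans; apply.
    by rewrite ler_pM2l// dle// normrN gtr0_norm//; lra.
  - apply: le_trans (cP_le_sqr c one01 (ltr0_neq0 an0)) _.
    by rewrite dle ?(ltW alpha_lt1)// ltr0_norm//; lra.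
  - apply: le_trans (cP_le_sqr c a01 (ltr0_neq0 nn0)) _.
    by rewrite dle// normrN gtr0_norm//; lra.
have -> : cZ a 1 alpha c n%:R - cZ a 1 alpha c (- n%:R) =
  (cZ a 1 alpha c n%:R - alpha / 4) - (cZ a 1 alpha c (- n%:R) - alpha / 4) by ring.
by apply: le_trans (ler_normB _ _) _; lra.
Qed.

(** In the limit the kernel of exponent alpha has its pole at x = 0 and that of exponent 1 at x = -
    a, both inside ]A, B[. Each of the two products in [cW] pairs a [cP] with a [cQ] that is regular
    at the pole of that [cP]. *)
Lemma cW_integral_cvg a (A B : R) : 0 < a -> A < - a -> 0 < B ->
  (\int[mu]_(x in `[A, B]) (cW a 1 alpha (harmonic n) x)%:E @[n --> \oo] -->
   ((cQ 1 0 a + cQ alpha 0 (- a)) * pi)%:E)%E.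
Proof.
move=> a0 Aa B0.
have den n m x : 0 < m <= 1 -> cden m (harmonic n : R) x != 0.
  move=> m01; have /andP[h0 h1] := @harmonic_pihalf R n.
  by rewrite gt_eqF// cden_gt0// gt_eqF// sinMl_gt0.
have cint (g : R -> R) : continuous g -> mu.-integrable `[A, B] (EFin \o g).
  move=> cg; apply: continuous_compact_integrable; first exact: segment_compact.
  exact: continuous_subspaceT.
have E n : (\int[mu]_(x in `[A, B]) (cW a 1 alpha (harmonic n) x)%:E =
  \int[mu]_(x in `[A, B]) (cQ 1 (harmonic n) (a + (0 + x)) * cP alpha (harmonic n) (0 + x))%:E +
  \int[mu]_(x in `[A, B]) (cQ alpha (harmonic n) (- a + (a + x)) * cP 1 (harmonic n) (a + x))%:E)%E.
  rewrite -integralD//.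
  - apply: eq_integral => x _; rewrite -EFinD /cW add0r addrA addNr add0r; congr EFin.
    by ring.
  - apply: cint => x; apply: cvgM; last by apply: continuous_shiftl; apply: cP_continuous; exact: den.
    apply: (@continuous_shiftl _ (fun y => cQ 1 (harmonic n) (a + y)));
    by apply: continuous_shiftl; apply: cQ_continuous; exact: den.
  - apply: cint => x; apply: cvgM; last by apply: continuous_shiftl; apply: cP_continuous; exact: den.
    apply: (@continuous_shiftl _ (fun y => cQ alpha (harmonic n) (- a + y)));
    by apply: continuous_shiftl; apply: cQ_continuous; exact: den.
under eq_fun do rewrite E.
rewrite mulrDl EFinD; apply: cvgeD => //.
  by apply: cQcP_integral_cvg => //; rewrite ?gt_eqF// oppr0; apply/andP; split; lra.
by apply: cQcP_integral_cvg => //; rewrite ?lt_eqF//; lra.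
Qed.

(** The difference of heights is less than pi and the end terms are bounded at every height, so the
    error bound survives the passage to height 0. *)
Lemma cW_pi_integral a (n : nat) : 0 < a -> a < n%:R ->
  forall d, d = ((alpha * (n%:R - a)) ^+ 2)^-1 ->
  `|\int[mu]_(x in `[- n%:R, n%:R]) cW a 1 alpha pi x - (cQ 1 0 a + cQ alpha 0 (- a)) * pi|
  <= (4 * d + 10 * d ^+ 2) * pi.
Proof.
move=> a0 an d dE.
have n0 : 0 < n%:R :> R by rewrite (lt_trans a0).
have d0 : 0 <= 4 * d + 10 * d ^+ 2 by rewrite dE addr_ge0 ?mulr_ge0 ?invr_ge0 ?sqr_ge0.
pose W p := \int[mu]_(x in `[- n%:R, n%:R]) cW a 1 alpha p x.
have Wc : (W (harmonic m) @[m --> \oo] --> (cQ 1 0 a + cQ alpha 0 (- a)) * pi).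
  have nNa : - n%:R < - a by rewrite ltrN2.
  exact: fine_cvg (cW_integral_cvg a0 nNa n0).
have Wd m : `|W pi - W (harmonic m)| <= (4 * d + 10 * d ^+ 2) * pi.
  have /andP[h0 h1] := @harmonic_pihalf R m.
  have p0 := pi_gt0 R.
  have hp : 0 < (harmonic m : R) < pi by apply/andP; split; lra.
  have nn : - n%:R < n%:R :> R by lra.
  have [c _] := @cW_diff R a 1 alpha _ _ _ one01 a01 nn hp.
  rewrite -!/(W _) => ->; rewrite normrM normrN ler_pM//.
    exact: (cZ_ends c a0 an dE).
  by rewrite ger0_norm//; lra.
have Wc2 : (`|W pi - W (harmonic m)| @[m --> \oo] --> `|W pi - (cQ 1 0 a + cQ alpha 0 (- a)) * pi|).
  by apply: cvg_norm; apply: cvgB => //; exact: cvg_cst.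
rewrite -(cvg_lim _ Wc2)//; apply: limr_le; last exact: nearW.
by apply/cvg_ex; exists `|W pi - (cQ 1 0 a + cQ alpha 0 (- a)) * pi|.
Qed.

End fixed.
End stieltjes_transform.

(** * Measurability and Tonelli's theorem *)

Section measure_tools.
Context {R : realType}.

(** 1 / x is x times a real power of x^2; with the convention that 0 has inverse 0 this also holds
    at 0. *)
Lemma measurable_inv : measurable_fun [set: R] (fun x : R => x^-1).
Proof.
have -> : (fun x : R => x^-1) = (fun x => x * (x ^+ 2) `^ (-1)).
  apply/funext => x; have [->|x0] := eqVneq x 0; first by rewrite invr0 mul0r.
  by rewrite powR_inv1 ?sqr_ge0// expr2 invfM mulrA divff// mul1r.
apply: measurable_funM => //.
by apply: (measurableT_comp (measurable_powR _)); exact: measurable_funX.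
Qed.

Lemma measurable_funV d (T : measurableType d) (D : set T) (f : T -> R) :
  measurable_fun D f -> measurable_fun D (fun x => (f x)^-1).
Proof. by move=> mf; exact: (measurableT_comp measurable_inv). Qed.

Lemma measurable_fun_expR d (T : measurableType d) (D : set T) (f : T -> R) :
  measurable_fun D f -> measurable_fun D (fun x => expR (f x)).
Proof. by move=> mf; exact: (measurableT_comp (@measurable_expR R)). Qed.

Lemma measurable_fun_powR d (T : measurableType d) (D : set T) (f : T -> R) p :
  measurable_fun D f -> measurable_fun D (fun x => (f x) `^ p).
Proof. by move=> mf; exact: (measurableT_comp (@measurable_powR R p)). Qed.

Lemma measurable_fun_ln d (T : measurableType d) (D : set T) (f : T -> R) :
  measurable_fun D f -> measurable_fun D (fun x => ln (f x)).
Proof. by move=> mf; exact: (measurableT_comp (@measurable_ln R)). Qed.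

Lemma measurable_fun_opp d (T : measurableType d) (D : set T) (f : T -> R) :
  measurable_fun D f -> measurable_fun D (fun x => - f x).
Proof. by move=> mf; exact: measurableT_comp. Qed.

End measure_tools.

Ltac mfun := repeat first
  [ exact: measurable_cst | exact: measurable_id | exact: measurable_fst
  | exact: measurable_snd | assumption
  | apply: measurable_funM | apply: measurable_funD | apply: measurable_funB
  | apply: measurable_fun_opp | apply: measurable_funX
  | apply: measurable_fun_expR | apply: measurable_fun_powR
  | apply: measurable_fun_ln | apply: measurable_funV ].

Section tonelli.
Context d1 d2 (T1 : measurableType d1) (T2 : measurableType d2) (R : realType).
Variables (m1 : {sigma_finite_measure set T1 -> \bar R})
  (m2 : {sigma_finite_measure set T2 -> \bar R}).

(** Extending f by 0 outside A x B reduces to the whole product space, so that measurability and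
    sign have to be checked on A x B only. *)
Lemma tonelli_on (A : set T1) (B : set T2) (f : T1 -> T2 -> R) :
  measurable A -> measurable B ->
  measurable_fun (A `*` B) (fun z => f z.1 z.2) ->
  (forall x y, A x -> B y -> 0 <= f x y) ->
  (\int[m1]_(x in A) \int[m2]_(y in B) (f x y)%:E =
   \int[m2]_(y in B) \int[m1]_(x in A) (f x y)%:E)%E.
Proof.
move=> mA mB mf f0.
pose F := (fun z : T1 * T2 => (f z.1 z.2)%:E) \_ (A `*` B).
have mF : measurable_fun setT F.
  apply/(measurable_restrictT _ (measurableX mA mB)); exact/measurable_EFinP.
have F0 z : (0 <= F z)%E.
  by apply: erestrict_ge0 => -[x y] [Ax By]; rewrite lee_fin f0.
have := @fubini_tonelli _ _ _ _ R m1 m2 F mF F0; congr (_ = _).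
- rewrite [RHS]integral_mkcond; apply: eq_integral => x _.
  rewrite [RHS]patchE; case: ifPn => xA.
    rewrite [RHS]integral_mkcond; apply: eq_integral => y _.
    by rewrite /F !patchE in_setX xA.
  by apply: integral0_eq => y _; rewrite /F patchE in_setX (negbTE xA).
- rewrite [RHS]integral_mkcond; apply: eq_integral => y _.
  rewrite [RHS]patchE; case: ifPn => yB.
    rewrite [RHS]integral_mkcond; apply: eq_integral => x _.
    by rewrite /F !patchE in_setX yB andbT.
  by apply: integral0_eq => x _; rewrite /F patchE in_setX (negbTE yB) andbF.
Qed.

Lemma measurable_integral_on (A : set T1) (B : set T2) (f : T1 -> T2 -> R) :
  measurable A -> measurable B ->
  measurable_fun (A `*` B) (fun z => f z.1 z.2) ->
  (forall x y, A x -> B y -> 0 <= f x y) ->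
  measurable_fun B (fun y => \int[m1]_(x in A) (f x y)%:E)%E.
Proof.
move=> mA mB mf f0.
pose F := (fun z : T1 * T2 => (f z.1 z.2)%:E) \_ (A `*` B).
have mF : measurable_fun setT F.
  apply/(measurable_restrictT _ (measurableX mA mB)); exact/measurable_EFinP.
have F0 z : (0 <= F z)%E.
  by apply: erestrict_ge0 => -[x y] [Ax By]; rewrite lee_fin f0.
have mG := @measurable_fun_fubini_tonelli_G _ _ _ _ R m1 F mF F0.
apply: (eq_measurable_fun (fubini_G m1 F)); last exact: measurable_funTS.
move=> y yB; rewrite /fubini_G [RHS]integral_mkcond; apply: eq_integral => x _.
by rewrite /F !patchE in_setX yB andbT.
Qed.

End tonelli.

(** * The Stieltjes transform of the law of G *)

Section density_of_X.
Context {R : realType}.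
Local Notation mu := (@lebesgue_measure R).

Lemma is_derive_ln1D (c x : R) : 0 < c + x ->
  is_derive x 1 (fun y => ln (c + y)) (c + x)^-1.
Proof.
move=> cx; have h := is_derive1_ln cx; exact: is_derive_shiftl h.
Qed.

Lemma integral_inv_shift (c lam : R) : 0 < c -> 0 < lam ->
  (\int[mu]_(m in `[0%R, lam]) ((c + m)^-1)%:E = (ln (1 + lam / c)%R)%:E)%E.
Proof.
move=> c0 l0.
have dF (x : R) : 0 <= x -> is_derive x 1 (fun y => ln (c + y)) (c + x)^-1.
  by move=> x0; apply: is_derive_ln1D; rewrite ltr_pwDl.
rewrite (integral_is_derive l0 (fun x xlam => dF x (proj1 (andP xlam)))) => [|x /andP[x0 _]].
- rewrite addr0 -EFinB; congr EFin; rewrite -ln_div ?posrE ?addr_gt0//.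
  by rewrite mulrDl divff ?gt_eqF.
- by apply: cvgV; [rewrite gt_eqF// ltr_pwDl|apply: cvgD; [exact: cvg_cst|exact: cvg_id]].
Qed.

Section fixed.
Variables (alpha : R) (alpha_gt0 : 0 < alpha) (alpha_lt1 : alpha < 1).

Let one01 : 0 < (1 : R) <= 1. Proof. by rewrite ltr01 lexx. Qed.
Let a01 : 0 < alpha <= 1. Proof. by rewrite alpha_gt0 ltW. Qed.
Let pi0 : 0 < pi :> R. Proof. exact: pi_gt0. Qed.

Lemma sin_pialpha_gt0 : 0 < sin (alpha * pi).
Proof. by rewrite sin_gt0_pi// mulr_gt0//= gtr_pMl. Qed.

Let s_neq0 : sin (alpha * pi) != 0. Proof. by rewrite gt_eqF// sin_pialpha_gt0. Qed.

Lemma den_pi_gt0 (k x : R) : 0 < k <= 1 -> 0 < cden k pi x.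
Proof.
move=> /andP[k0 k1]; have [->|k1'] := eqVneq k 1.
  by rewrite /cden !mul1r cospi; have := expR_gt0 x; have := expR_gt0 (- x); lra.
have : k < 1 by rewrite lt_neqAle k1' k1.
by move=> kl; rewrite cden_gt0// gt_eqF// sin_gt0_pi// mulr_gt0//= gtr_pMl.
Qed.

(* [gdens] is the density of [X] when [1 / (1 + expR (- X))] has density [f_G]. *)
Definition gdens (x : R) := cP alpha pi x / (pi * (1 - alpha)).

Lemma beta_gt0 : 0 < pi * (1 - alpha).
Proof. by rewrite mulr_gt0// subr_gt0. Qed.

Lemma cP_pi_ge0 x : 0 <= cP alpha pi x.
Proof.
rewrite /cP divr_ge0// ?(ltW (den_pi_gt0 x a01))// mulr_ge0 ?(ltW alpha_gt0)//.
exact: ltW sin_pialpha_gt0.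
Qed.

Lemma gdens_ge0 x : 0 <= gdens x.
Proof. by rewrite divr_ge0 ?cP_pi_ge0// ltW// beta_gt0. Qed.

Lemma cP_pi_continuous : continuous (cP alpha pi).
Proof. by move=> x; apply: cP_continuous; rewrite gt_eqF// den_pi_gt0. Qed.

Lemma gdens_continuous : continuous gdens.
Proof. by move=> x; apply: cvgM; [exact: cP_pi_continuous|exact: cvg_cst]. Qed.

Lemma measurable_gdens : measurable_fun setT gdens.
Proof. apply: continuous_measurable_fun; exact: gdens_continuous. Qed.

(** On the line of height pi the coth of exponent 1 becomes a tanh, and 1/2 plus half a tanh is the
    logistic function. *)
Lemma cQ1_pi (x : R) : 2^-1 + cQ 1 pi x = (1 + expR (- x))^-1.
Proof.
rewrite /cQ /cden !mul1r cospi expRN.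
have := expR_gt0 x; move: (expR x) => y y0.
have y1 : 1 + y != 0 by rewrite gt_eqF// addr_gt0.
have h1 : y + y^-1 - 2 * -1 = (1 + y) ^+ 2 / y by field; rewrite gt_eqF.
have h2 : 1 + y^-1 = (1 + y) / y by field; rewrite gt_eqF.
rewrite h1 h2; field; rewrite y1 gt_eqF//=.
Qed.

Lemma atan_cot : atan (- cos (alpha * pi) / sin (alpha * pi)) = alpha * pi - pi / 2.
Proof.
have h : alpha * pi - pi / 2 \in `](- (pi / 2)), (pi / 2)[.
  rewrite in_itv/=; have := mulr_gt0 alpha_gt0 pi0.
  have : alpha * pi < pi by rewrite gtr_pMl.
  by move=> ? ?; apply/andP; split; lra.
rewrite -[RHS](tanK h); congr atan.
by rewrite /tan sinBpihalf cosBpihalf.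
Qed.

Lemma expR_ny_cvg (n : nat) : expR (alpha * - n%:R) = expR (- alpha) ^+ n.
Proof. by rewrite mulrN -mulNr expRM_natr. Qed.

Lemma atan_top_cvg :
  atan ((expR (alpha * n%:R) - cos (alpha * pi)) / sin (alpha * pi)) @[n --> \oo] --> (pi / 2 : R).
Proof.
apply: (cvg_comp _ _ _ (@cvgy_atan R)).
apply/cvgryPge => M; near=> n.
rewrite ler_pdivlMr ?sin_pialpha_gt0//.
have h1 : 1 + alpha * n%:R <= expR (alpha * n%:R) by exact: expR_ge1Dx.
have h2 := cos_le1 (alpha * pi).
suff : M * sin (alpha * pi) <= alpha * n%:R by lra.
rewrite mulrC -ler_pdivrMl//.
by near: n; exact: nbhs_infty_ger.
Unshelve. all: by end_near. Qed.

Lemma atan_bot_cvg :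
  atan ((expR (alpha * - n%:R) - cos (alpha * pi)) / sin (alpha * pi)) @[n --> \oo] --> (alpha * pi - pi / 2 : R).
Proof.
rewrite -atan_cot; apply: continuous_cvg; first exact: continuous_atan.
apply: cvgM; last exact: cvg_cst.
rewrite -[X in _ --> X]add0r; apply: cvgB; last exact: cvg_cst.
under eq_fun do rewrite expR_ny_cvg.
by apply: cvg_expr; rewrite ger0_norm ?expR_ge0// expR_lt1 oppr_lt0.
Qed.

(** The primitive of [cP] at height pi rises from alpha pi - pi / 2 to pi / 2; this is the origin of
    the normalising constant of [gdens]. *)
Lemma cP_pi_integral_cvg :
  (\int[mu]_(x in `[- n%:R, n%:R]) cP alpha pi x) @[n --> \oo] --> pi * (1 - alpha).
Proof.
have -> : pi * (1 - alpha) = pi / 2 - (alpha * pi - pi / 2) by field.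
apply: (@cvg_trans _ ((fun n : nat => atan ((expR (alpha * n%:R) - cos (alpha * pi)) / sin (alpha * pi)) -
   atan ((expR (alpha * - n%:R) - cos (alpha * pi)) / sin (alpha * pi))) @ \oo)).
  apply: near_eq_cvg; near=> n.
  have n0 : 0 < n%:R :> R by rewrite ltr0n; near: n; exact: nbhs_infty_gt.
  have h := @cP_integral R alpha pi 0 (- n%:R) n%:R s_neq0.
  rewrite /Rintegral; under eq_integral do rewrite -[X in cP _ _ X]add0r.
  by rewrite h// ?add0r//; lra.
by apply: cvgB; [exact: atan_top_cvg|exact: atan_bot_cvg].
Unshelve. all: by end_near. Qed.

Definition nnitv (n : nat) : set R := `[- n%:R, n%:R]%classic.

Lemma measurable_nnitv n : measurable (nnitv n).
Proof. exact: measurable_itv. Qed.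

Lemma nnitv_bigcup : \bigcup_n nnitv n = setT.
Proof.
rewrite -subTset => x _; exists (Num.truncn `|x|).+1 => //=.
by rewrite /nnitv/= in_itv/= -ler_norml ltW// truncnS_gt.
Qed.

Lemma integral_setT_nnitv (f : R -> R) (l : \bar R) :
  measurable_fun setT f -> (forall x, 0 <= f x) ->
  (\int[mu]_(x in nnitv n) (f x)%:E @[n --> \oo] --> l)%E ->
  (\int[mu]_x (f x)%:E = l)%E.
Proof.
move=> mf f0 fl.
have := @ge0_nondecreasing_set_cvg_integral _ (measurableTypeR R) R nnitv (EFin \o f) (@lebesgue_measure R).
rewrite nnitv_bigcup => h; apply/esym; apply: cvg_unique fl (h _ _ _ _) => //.
- apply/nondecreasing_seqP => n; rewrite subsetEset; apply: subset_itv;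
  by rewrite bnd_simp ?lerN2 ler_nat.
- exact: measurable_nnitv.
- by move=> n; apply/measurable_EFinP; exact: measurable_funTS.
- by move=> n x _; rewrite /= lee_fin.
Qed.

Lemma gap_cvg0 (a : R) :
  (4 * ((alpha * (n%:R - a)) ^+ 2)^-1 + 10 * ((alpha * (n%:R - a)) ^+ 2)^-1 ^+ 2) * pi @[n --> \oo] --> (0 : R).
Proof.
have d0 : ((alpha * (n%:R - a)) ^+ 2)^-1 @[n --> \oo] --> (0 : R).
  apply/gtr0_cvgV0; last first.
    apply/cvgryPge => M; near=> n.
    have h : 1 + `|M| <= alpha * (n%:R - a).
      rewrite -ler_pdivrMl// lerBrDr.
      by near: n; exact: nbhs_infty_ger.
    have := ler_norm M; have := normr_ge0 M; rewrite expr2; nra.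
  near=> n; rewrite exprn_gt0// mulr_gt0// subr_gt0.
  by near: n; exact: nbhs_infty_gtr.
rewrite [X in _ --> X](_ : _ = (4 * 0 + 10 * (0 * 0)) * pi); last by rewrite !mulr0 addr0 mul0r.
apply: cvgM; last exact: cvg_cst.
apply: cvgD; apply: cvgM; [exact: cvg_cst|exact: d0|exact: cvg_cst|].
by apply: cvgM; exact: d0.
Unshelve. all: by end_near. Qed.

Lemma cW_pi a x : cW a 1 alpha pi x = cQ 1 pi (a + x) * cP alpha pi x.
Proof. by rewrite /cW /cP [1 * pi]mul1r sinpi mulr0 !mul0r addr0. Qed.

(** At height pi the exponent-1 kernel is real, so [cW] reduces to one product. Adding 2^-1 makes
    the integrand nonnegative, so its integral over the line is the limit over [-n, n]; the added
    part contributes half of the mass pi (1 - alpha). *)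
Lemma cQcP_pi_integral (a : R) : 0 < a ->
  (\int[mu]_x ((2^-1 + cQ 1 pi (a + x)) * cP alpha pi x)%:E =
   (pi * (1 - alpha) / 2 + (cQ 1 0 a + cQ alpha 0 (- a)) * pi)%:E)%E.
Proof.
move=> a0.
have cQc : continuous (fun x => cQ 1 pi (a + x)).
  by move=> x; apply: continuous_shiftl; apply: cQ_continuous; rewrite gt_eqF// den_pi_gt0.
have cint n (g : R -> R) : continuous g -> mu.-integrable (nnitv n) (EFin \o g).
  move=> cg; apply: continuous_compact_integrable; first exact: segment_compact.
  exact: continuous_subspaceT.
have cWc : continuous (cW a 1 alpha pi).
  move=> x; apply: cW_continuous; by rewrite gt_eqF// den_pi_gt0.
have cPc : continuous (fun x => 2^-1 * cP alpha pi x).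
  by move=> x; apply: cvgM; [exact: cvg_cst|exact: cP_pi_continuous].
have cs : continuous (fun x => (2^-1 + cQ 1 pi (a + x)) * cP alpha pi x).
  move=> x; apply: cvgM; last exact: cP_pi_continuous.
  by apply: cvgD; [exact: cvg_cst|exact: cQc].
apply: integral_setT_nnitv.
- exact: continuous_measurable_fun.
- by move=> x; rewrite mulr_ge0 ?cP_pi_ge0// cQ1_pi invr_ge0 addr_ge0 ?expR_ge0.
have E n : (\int[mu]_(x in nnitv n) ((2^-1 + cQ 1 pi (a + x)) * cP alpha pi x)%:E)%E =
   (2^-1 * (\int[mu]_(x in nnitv n) cP alpha pi x) +
    \int[mu]_(x in nnitv n) cW a 1 alpha pi x)%:E.
  have mI := measurable_nnitv n.
  rewrite -RintegralZl//; last exact/cint/cP_pi_continuous.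
  rewrite -RintegralD//; [|exact: cint|exact: cint].
  rewrite /Rintegral fineK; last first.
    apply: integrable_fin_num => //; apply: cint => x; apply: cvgD; [exact: cPc|exact: cWc].
  by apply: eq_integral => x _; congr EFin; rewrite cW_pi; ring.
under eq_fun do rewrite E.
apply: cvg_EFin; first exact: nearW.
apply: cvgD.
  by rewrite mulrC; apply: cvgM; [exact: cvg_cst|exact: cP_pi_integral_cvg].
apply/subr_cvg0; apply: (@squeeze_cvgr _ _ _ _ (fun n => - ((4 * ((alpha * (n%:R - a)) ^+ 2)^-1 + 10 * ((alpha * (n%:R - a)) ^+ 2)^-1 ^+ 2) * pi))
  (fun n => (4 * ((alpha * (n%:R - a)) ^+ 2)^-1 + 10 * ((alpha * (n%:R - a)) ^+ 2)^-1 ^+ 2) * pi)).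
- near=> n; rewrite -ler_norml; apply: cW_pi_integral => //.
  by near: n; exact: nbhs_infty_gtr.
- by rewrite [X in _ --> X](_ : _ = - 0); [apply: cvgN; exact: gap_cvg0|rewrite oppr0].
- exact: gap_cvg0.
Unshelve. all: by end_near. Qed.

(** With s = e^a, 1 / (s + e^-x) is 1 / s times the logistic function at a + x. The hypothesis s > 1
    gives a > 0, which separates the two poles. *)
Lemma gdens_stieltjes (s : R) : 1 < s ->
  (\int[mu]_x (gdens x * (s + expR (- x))^-1)%:E =
   ((1 - alpha)^-1 * ((s - 1)^-1 - alpha * s `^ alpha / (s * (s `^ alpha - 1))))%:E)%E.
Proof.
move=> s1; have s0 : 0 < s by lra.
pose a := ln s; have a0 : 0 < a by rewrite ln_gt0.
have sE : s = expR a by rewrite /a lnK.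
have b0 := beta_gt0.
have E x : gdens x * (s + expR (- x))^-1 = (s * (pi * (1 - alpha)))^-1 * ((2^-1 + cQ 1 pi (a + x)) * cP alpha pi x).
  rewrite cQ1_pi opprD expRD (expRN a) -sE /gdens.
  have e0 := expR_gt0 (- x).
  have p0 := pi0; move: (cP alpha pi x) p0; move: (pi : R) => p c p0.
  by field; rewrite ?gt_eqF//= ?subr_gt0// ?addr_gt0//.
under eq_integral do rewrite E EFinM.
rewrite ge0_integralZl_EFin//; last 3 first.
- by move=> x _; rewrite lee_fin mulr_ge0 ?cP_pi_ge0// cQ1_pi invr_ge0 addr_ge0 ?expR_ge0.
- apply/measurable_EFinP; apply: continuous_measurable_fun => x.
  apply: cvgM; last exact: cP_pi_continuous.
  apply: cvgD; first exact: cvg_cst.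
  have : {for x, continuous (fun x => cQ 1 pi (a + x))}; last exact.
  by apply: continuous_shiftl; apply: cQ_continuous; rewrite gt_eqF// den_pi_gt0.
- by rewrite invr_ge0 mulr_ge0 ?ltW.
rewrite cQcP_pi_integral// -EFinM; congr EFin.
have sg1 : 1 < s `^ alpha by rewrite sE -expRM expR_gt1 mulr_gt0.
have -> : cQ 1 0 a = (s + 1) / (2 * (s - 1)).
  rewrite /cQ /cden mulr0 cos0 !mul1r expRN -sE.
  have -> : s + s^-1 - 2 * 1 = (s - 1) ^+ 2 / s by field; rewrite gt_eqF.
  by field; rewrite !gt_eqF// subr_gt0.
have -> : cQ alpha 0 (- a) = - (alpha * (s `^ alpha + 1) / (2 * (s `^ alpha - 1))).
  rewrite /cQ /cden mulr0 cos0 mulrN opprK expRN mulrC.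
  have -> : expR (alpha * a) = s `^ alpha by rewrite sE -expRM mulrC.
  have s2 : s `^ alpha != 0 by rewrite gt_eqF//; lra.
  have -> : (s `^ alpha)^-1 + s `^ alpha - 2 * 1 = (s `^ alpha - 1) ^+ 2 / (s `^ alpha) by field.
  by field; rewrite s2 !gt_eqF// subr_gt0.
have p0 := pi0; move: p0; move: (pi : R) => p p0.
by field; rewrite !gt_eqF//= ?subr_gt0.
Qed.

End fixed.
End density_of_X.

(** * The logarithmic transform *)

Section log_transform.
Context {R : realType}.
Local Notation mu := (@lebesgue_measure R).
Variables (alpha : R) (alpha_gt0 : 0 < alpha) (alpha_lt1 : alpha < 1).

(* [kap] is the derivative of [Psi], [Psi] vanishing at [0+]. *)
Definition kap (m : R) : R :=
  (1 - alpha)^-1 * (m^-1 - alpha * (1 + m) `^ alpha / ((1 + m) * ((1 + m) `^ alpha - 1))).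
Definition Psi (m : R) : R :=
  ln (alpha * m / ((1 + m) `^ alpha - 1)) / (1 - alpha).

Lemma powR_sub1_gt0 (m : R) : 0 < m -> 0 < (1 + m) `^ alpha - 1.
Proof.
move=> m0; rewrite subr_gt0.
have : (1 : R) `^ alpha < (1 + m) `^ alpha.
  by rewrite gt0_ltr_powR ?nnegrE ?addr_ge0 ?(ltW m0)// ltrDl.
by rewrite powR1.
Qed.

Lemma is_derive_Psi (m : R) : 0 < m -> is_derive m 1 Psi (kap m).
Proof.
move=> m0; have g0 := powR_sub1_gt0 m0.
have m1 : 0 < 1 + m by rewrite addr_gt0.
have h1 : is_derive m 1 (fun y => (1 + y) `^ alpha) (alpha * (1 + m) `^ (alpha - 1)).
  exact: (is_derive_shiftl (@is_derive1_powR R alpha _ m1)).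
have h2 : is_derive m 1 (fun y => (1 + y) `^ alpha - 1) (alpha * (1 + m) `^ (alpha - 1)).
  by apply: is_derive_eq; rewrite subr0.
have h3 : is_derive m 1 (fun y => alpha * y) alpha.
  by apply: is_derive_eq; rewrite /GRing.scale/=; ring.
have q0 : 0 < alpha * m / ((1 + m) `^ alpha - 1) by rewrite divr_gt0// mulr_gt0.
have h4 := is_derive_div (f := fun y => alpha * y) (g := fun y => (1 + y) `^ alpha - 1) (lt0r_neq0 g0) h3 h2.
have h5 := @is_derive1_comp R _ (fun y => alpha * y / ((1 + y) `^ alpha - 1)) _ _ _ (is_derive1_ln q0) h4.
have h6 : is_derive m 1 Psi ((1 - alpha)^-1 * ((alpha * m / ((1 + m) `^ alpha - 1))^-1 * ((alpha * ((1 + m) `^ alpha - 1) - alpha * m * (alpha * (1 + m) `^ (alpha - 1))) /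
        ((1 + m) `^ alpha - 1) ^+ 2))).
  rewrite /Psi; apply: is_derive_eq; rewrite /GRing.scale/=; ring.
apply: (is_derive_eq h6); rewrite /kap; congr (_ * _).
have -> : (1 + m) `^ (alpha - 1) = (1 + m) `^ alpha / (1 + m).
  by rewrite powRB ?powRr1 ?(ltW m1)// (gt_eqF m1) implybT.
by field; rewrite ?gt_eqF//=.
Qed.

(** The argument of the logarithm is alpha divided by a difference quotient of y^alpha at 1, and
    that quotient tends to alpha. *)
Lemma Psi_cvg0 (u : R^nat) : (forall n, 0 < u n) -> u @ \oo --> 0 -> Psi (u n) @[n --> \oo] --> 0.
Proof.
move=> u0 ul.
have d1 : is_derive (1 : R) 1 (fun y : R => y `^ alpha) alpha.
  have := @is_derive1_powR R alpha _ (@ltr01 R); by rewrite powR1 mulr1.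
have h : (u n)^-1 * ((1 + u n) `^ alpha - 1) @[n --> \oo] --> alpha.
  have [dd dv] := d1.
  have ud : u @ \oo --> (0 : R)^'.
    move=> P /= h; have H : \forall n \near \oo, u n != 0 -> P (u n) := ul _ h.
    change (\forall n \near \oo, P (u n)).
    by apply: filterS H => n; apply; rewrite gt_eqF.
  have H : (fun h : R => h^-1 *: (((fun y : R => y `^ alpha) \o shift 1) (h *: 1) - 1 `^ alpha)) (u n) @[n --> \oo]
      --> 'D_1 (fun y : R => y `^ alpha) 1 := cvg_comp _ _ ud dd.
  rewrite dv in H; apply: cvg_trans H; apply: near_eq_cvg; apply: nearW => n /=.
  by rewrite powR1 /GRing.scale/= mulr1 [1 + u n]addrC.
have a10 : (1 : R) = alpha / alpha by rewrite divff// gt_eqF.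
have -> : (0 : R) = ln (alpha / alpha) / (1 - alpha) by rewrite -a10 ln1 mul0r.
apply: cvgM; last exact: cvg_cst.
apply: continuous_cvg; first by apply: continuous_ln; rewrite -a10.
have -> : (fun n => alpha * u n / ((1 + u n) `^ alpha - 1)) = (fun n => alpha * ((u n)^-1 * ((1 + u n) `^ alpha - 1))^-1).
  by apply/funext => n; have := powR_sub1_gt0 (u0 n); have := u0 n => *; field; rewrite !gt_eqF.
by apply: cvgM; [exact: cvg_cst|apply: cvgV => //; rewrite gt_eqF].
Qed.

(** The logarithm is the integral of 1 / (1 + e^-x + m) over m in [0, lam]; after Tonelli the
    integral in x is the Stieltjes transform at s = 1 + m > 1, that is, [kap m]. *)
Lemma gdens_ln (lam : R) : 0 < lam ->
  (\int[mu]_x (gdens alpha x * ln (1 + lam / (1 + expR (- x))))%:E = (Psi lam)%:E)%E.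
Proof.
move=> l0.
have e0 x : 0 < 1 + expR (- x) :> R by rewrite addr_gt0 ?expR_gt0.
have g0 x := gdens_ge0 alpha_gt0 alpha_lt1 x.
transitivity (\int[mu]_x \int[mu]_(m in `[0%R, lam]) (gdens alpha x * ((1 + expR (- x)) + m)^-1)%:E)%E.
  apply: eq_integral => x _; rewrite EFinM -integral_inv_shift// -ge0_integralZl_EFin//.
  - by move=> m /=; rewrite in_itv/= => /andP[m0 _]; rewrite lee_fin invr_ge0 addr_ge0// ltW.
  - by apply/measurable_EFinP; mfun.
rewrite (@tonelli_on _ _ _ _ R mu mu setT `[0%R, lam] (fun x m => gdens alpha x * ((1 + expR (- x)) + m)^-1))//; last 2 first.
- apply: measurable_funTS; mfun.
- by move=> x m _; rewrite /= in_itv/= => /andP[m0 _]; rewrite mulr_ge0// invr_ge0 addr_ge0// ltW.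
rewrite -integral_itv_obnd_cbnd; last first.
  apply: measurable_integral_on => //.
  - by apply: measurable_funTS; mfun.
  - move=> x m _; rewrite /= in_itv/= => /andP[/ltW m0 _].
    by rewrite mulr_ge0// invr_ge0 addr_ge0// ltW.
transitivity (\int[mu]_(m in `]0%R, lam]) (kap m)%:E)%E.
  apply: eq_integral => m; rewrite inE/= in_itv/= => /andP[m0 _].
  under eq_integral do rewrite addrAC.
  rewrite gdens_stieltjes ?ltrDl//; congr EFin; rewrite /kap.
  by rewrite [1 + m - 1]addrC addKr.
(* [is_derive_Psi] holds at positive arguments only, so the fundamental theorem is applied on
   segments away from 0 that exhaust ]0, lam]. *)
pose S (n : nat) : set R := `[lam / n.+2%:R, lam]%classic.
have lamn n : 0 < lam / n.+2%:R by rewrite divr_gt0.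
have SU : `]0, lam]%classic = \bigcup_n S n.
  apply/seteqP; split => x /=; rewrite in_itv/=.
    move=> /andP[x0 xl]; exists (Num.truncn (lam / x)) => //=.
    rewrite /S/= in_itv/= xl andbT ler_pdivrMr// mulrC -ler_pdivrMr//.
    by apply: ltW; apply: (lt_trans (truncnS_gt _)); rewrite ltr_nat.
  by move=> [n _]; rewrite /S/= in_itv/= => /andP[h ->]; rewrite (lt_le_trans (lamn n)).
have Skap n : (\int[mu]_(m in S n) (kap m)%:E = (Psi lam)%:E - (Psi (lam / n.+2%:R))%:E)%E.
  have dP (x : R) : lam / n.+2%:R <= x -> is_derive x 1 Psi (kap x).
    by move=> h; apply: is_derive_Psi; rewrite (lt_le_trans (lamn n)).
  have ln1 : lam / n.+2%:R < lam by rewrite ltr_pdivrMr// ltr_pMr// ltr1n.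
  rewrite (integral_is_derive ln1 (fun x xlam => dP x (proj1 (andP xlam))))// => x /andP[x0 _].
  have x0' : 0 < x by apply: lt_le_trans x0.
  have h1 : {for x, continuous (fun y : R => (1 + y) `^ alpha)}.
    apply/differentiable_continuous/derivable1_diffP.
    by case: (is_derive_shiftl (@is_derive1_powR R alpha _ (addr_gt0 ltr01 x0'))).
  apply: cvgM; first exact: cvg_cst.
  apply: cvgB; first by apply: cvgV; [rewrite gt_eqF|exact: cvg_id].
  apply: cvgM; first by apply: cvgM; [exact: cvg_cst|exact: h1].
  apply: cvgV; first by rewrite mulf_neq0// gt_eqF ?powR_sub1_gt0// addr_gt0.
  apply: cvgM; first by apply: cvgD; [exact: cvg_cst|exact: cvg_id].
  by apply: cvgB; [exact: h1|exact: cvg_cst].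
have mkap : measurable_fun setT kap by rewrite /kap; mfun.
(* The sign of [kap m] is read off from the integral that it equals. *)
have kap0 m : 0 < m -> 0 <= kap m.
  move=> m0; rewrite -lee_fin.
  have := @gdens_stieltjes R alpha alpha_gt0 alpha_lt1 (1 + m) (ltac:(rewrite ltrDl//)).
  rewrite [1 + m - 1]addrC addKr -/(kap m) => <-.
  by apply: integral_ge0 => x _; rewrite lee_fin mulr_ge0// invr_ge0 !addr_ge0 ?expR_ge0// ltW.
have h := @ge0_nondecreasing_set_cvg_integral _ (measurableTypeR R) R S (EFin \o kap) (@lebesgue_measure R).
rewrite SU; apply/esym; apply: (cvg_unique _ _ (h _ _ _ _)) => //.
- have Pl : Psi (lam / n.+2%:R) @[n --> \oo] --> 0.
    apply: Psi_cvg0 => //.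
    rewrite -(mulr0 lam); apply: cvgM; first exact: cvg_cst.
    by have := @cvg_harmonic R; rewrite -(cvg_shiftS).
  have := cvgB (cvg_cst (Psi lam)) Pl; rewrite subr0 => Pl2.
  rewrite (_ : (fun n => _) = (fun n => (Psi lam - Psi (lam / n.+2%:R))%:E)).
    by apply: cvg_EFin; [exact: nearW|exact: Pl2].
  by apply/funext => n; rewrite EFinB; exact: Skap.
- apply/nondecreasing_seqP => n; rewrite subsetEset; apply: subset_itv; rewrite bnd_simp//.
  by rewrite ler_pM2l// lef_pV2 ?posrE// ler_nat.
- by move=> n; exact: measurable_itv.
- by move=> n; apply/measurable_EFinP; exact: measurable_funTS.
- move=> n x; rewrite /S/= in_itv/= => /andP[hx _]; rewrite lee_fin kap0//.
  exact: lt_le_trans hx.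
Qed.
End log_transform.

(** * Integrals and equality in law *)

Section layer_cake.
Context d (T : measurableType d) (R : realType) (mu : {sigma_finite_measure set T -> \bar R}).
Local Notation leb := (@lebesgue_measure R).

Lemma layer_cake (W X : T -> R) (h : R -> R) :
  measurable_fun setT W -> measurable_fun setT X -> measurable_fun setT h ->
  (forall w, 0 <= W w) -> (forall x, 0 <= h x) ->
  (\int[mu]_w (W w * h (X w))%:E =
   \int[leb]_(s in `[0%R, +oo[) \int[mu]_w (W w * \1_(h @^-1` `]s, +oo[) (X w))%:E)%E.
Proof.
move=> mW mX mh W0 h0.
have mhX : measurable_fun setT (h \o X) by exact: measurableT_comp.
have mind : measurable_fun [set: T * R] (fun z => \1_(h @^-1` `]z.2, +oo[) (X z.1) : R).
  have -> : (fun z => \1_(h @^-1` `]z.2, +oo[) (X z.1) : R) = \1_((fun z : T * R => h (X z.1) - z.2) @^-1` `]0, +oo[).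
    apply/funext => z; rewrite !indicE; congr ((nat_of_bool _)%:R).
    by apply/idP/idP; rewrite !inE/= !in_itv/= !andbT subr_gt0.
  apply: measurable_indic; rewrite -(setTI (_ @^-1` _)).
  have : measurable_fun [set: T * R] (fun z : T * R => h (X z.1) - z.2).
    apply: measurable_funB; last exact: measurable_snd.
    exact: (measurableT_comp mhX measurable_fst).
  by apply => //.
rewrite -(@tonelli_on _ _ _ _ R mu leb setT `[0%R, +oo[ (fun w s => W w * \1_(h @^-1` `]s, +oo[) (X w)))//.
- apply: eq_integral => w _.
  under eq_integral do rewrite EFinM.
  rewrite ge0_integralZl_EFin//; last first.
    apply/measurable_EFinP; apply: measurable_funTS.
    exact: (measurableT_comp mind (measurable_pair1 w)).
  rewrite EFinM; congr (_ * _)%E.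
  transitivity (\int[leb]_(s in `[0%R, +oo[) (\1_(`[0%R, h (X w)[%classic) s)%:E)%E.
    rewrite integral_indic// (_ : _ `&` _ = `[0%R, h (X w)[%classic); last first.
      by apply/seteqP; split => x /=; rewrite !in_itv/= ?andbT; [move=> []|move=> /andP[-> ->]].
    rewrite /= lebesgue_measure_itv/= lte_fin; case: ltP; first by rewrite sube0.
    by move=> hX; congr EFin; apply/eqP; rewrite eq_le hX h0.
  apply: eq_integral => s; rewrite inE/= in_itv/= andbT => s0; rewrite !indicE; congr ((nat_of_bool _)%:R%:E).
  by apply/idP/idP; rewrite !inE/= !in_itv/= ?andbT ?s0.
- apply: measurable_funTS; apply: measurable_funM => //.
  exact: (measurableT_comp mW measurable_fst).
- by move=> w s _ _; rewrite mulr_ge0.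
Qed.

End layer_cake.

Section transfer.
Context d (T : measurableType d) d' (T' : measurableType d') (R : realType).
Variables (mu : {sigma_finite_measure set T -> \bar R}) (nu : {sigma_finite_measure set T' -> \bar R}).

(** Equality on indicators passes to h by integrating over its level sets. The weights let one
    statement cover laws (W = 1), densities (W = f on Lebesgue measure) and, for independent
    variables, the product of the remaining factors. *)
Lemma eq_integral_law (W X : T -> R) (W' X' : T' -> R) (h : R -> R) :
  measurable_fun setT W -> measurable_fun setT X -> (forall w, 0 <= W w) ->
  measurable_fun setT W' -> measurable_fun setT X' -> (forall w, 0 <= W' w) ->
  (forall B : set R, measurable B ->
    \int[mu]_w (W w * \1_B (X w))%:E = \int[nu]_w (W' w * \1_B (X' w))%:E)%E ->
  measurable_fun setT h -> (forall x, 0 <= h x) ->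
  (\int[mu]_w (W w * h (X w))%:E = \int[nu]_w (W' w * h (X' w))%:E)%E.
Proof.
move=> mW mX W0 mW' mX' W'0 WW' mh h0.
rewrite !layer_cake//; apply: eq_integral => s _; apply: WW'.
by rewrite -(setTI (_ @^-1` _)); exact: mh.
Qed.

End transfer.

Section indic_law.
Context d (T : measurableType d) (R : realType) (P : probability T R).
Local Notation leb := (@lebesgue_measure R).

Lemma probability_indic (X : T -> R) (B : set R) : measurable_fun setT X -> measurable B ->
  P (X @^-1` B) = (\int[P]_w (1 * \1_B (X w))%:E)%E.
Proof.
move=> mX mB; have mXB : measurable (X @^-1` B) by rewrite -(setTI (_ @^-1` _)); exact: mX.
rewrite -[in LHS](setIT (X @^-1` B)) -integral_indic//.
by apply: eq_integral => w _; rewrite mul1r !indicE.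
Qed.

End indic_law.

Section laws.
Context d (T : measurableType d) (R : realType) (P : probability T R).
Local Notation leb := (@lebesgue_measure R).

Lemma integral_eq_law d' (T' : measurableType d') (Q : probability T' R)
   (X : T -> R) (Y : T' -> R) (h : R -> R) :
  measurable_fun setT X -> measurable_fun setT Y -> eq_law P X Q Y ->
  measurable_fun setT h -> (forall x, 0 <= h x) ->
  (\int[P]_w (h (X w))%:E = \int[Q]_w (h (Y w))%:E)%E.
Proof.
move=> mX mY XY mh h0.
under eq_integral do rewrite -[h _]mul1r; under [RHS]eq_integral do rewrite -[h _]mul1r.
apply: (eq_integral_law (W := cst 1) (X := X) (W' := cst 1) (X' := Y)) => //.
by move=> B mB; rewrite -(probability_indic P mX)// XY// (probability_indic Q mY).
Qed.

Lemma integral_density (X : T -> R) (f h : R -> R) :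
  measurable_fun setT X -> has_density P X f ->
  measurable_fun setT h -> (forall x, 0 <= h x) ->
  (\int[P]_w (h (X w))%:E = \int[leb]_x (f x * h x)%:E)%E.
Proof.
move=> mX [mf f0 Xf] mh h0.
under eq_integral do rewrite -[h _]mul1r.
apply: (@eq_integral_law _ _ _ (measurableTypeR R) _ P leb (cst 1) X f id) => //.
move=> B mB; rewrite -(probability_indic P mX)// Xf// integral_mkcond.
apply: eq_integral => x _; rewrite patchE indicE; case: ifPn => _; by rewrite ?mulr1 ?mulr0.
Qed.

End laws.

(** * The density of G and the Wiener-Gamma kernel *)

Section substitution.
Context {R : realType}.
Local Notation mu := (@lebesgue_measure R).

(** Substitution on [-n, n], then monotone convergence on both sides. G is only controlled on the
    open interval, since [f_G] is unbounded near 0 and 1. *)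
Lemma ge0_integration_by_substitution_oo (F f G : R -> R) (c d : R) :
  (forall x : R, is_derive x 1 F (f x)) -> continuous f -> (forall x, 0 < f x) ->
  (forall x, c < F x < d) ->
  F (- n%:R) @[n --> \oo] --> c -> F n%:R @[n --> \oo] --> d ->
  {in `]c, d[, continuous G} -> (forall y, c < y < d -> 0 <= G y) ->
  (\int[mu]_(y in `]c, d[) (G y)%:E = \int[mu]_x (G (F x) * f x)%:E)%E.
Proof.
move=> dF cf f0 Fcd Fc Fd cG G0.
have cF := is_derive_continuous dF.
have F'E : (F^`())%classic = f by apply/funext => x; rewrite derive1E; case: (dF x).
have Finc : {homo F : x y / x < y}.
  move=> x y xy.
  have [z _ e] := MVT xy (fun z _ => dF z) (continuous_subspaceT cF).
  by rewrite -subr_gt0 e mulr_gt0// subr_gt0.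
have Fndec : {homo F : x y / x <= y}.
  by move=> x y; rewrite le_eqVlt => /predU1P[->//|/Finc/ltW].
pose S (n : nat) : set R := `[F (- n%:R), F n%:R]%classic.
have mG : measurable_fun `]c, d[ G by apply: open_continuous_measurable_fun => // x; rewrite inE; exact: cG.
have SU : \bigcup_n S n = `]c, d[%classic.
  apply/seteqP; split => y /=.
    move=> [n _]; rewrite /S/= !in_itv/= => /andP[h1 h2].
    have /andP[h3 _] := Fcd (- n%:R); have /andP[_ h4] := Fcd n%:R.
    by rewrite (lt_le_trans h3)//= (le_lt_trans h2).
  rewrite in_itv/= => /andP[cy yd].
  have : \forall n \near \oo, F (- n%:R) < y by move/cvgr_lt : Fc; apply.
  have : \forall n \near \oo, y < F n%:R by move/cvgr_gt : Fd; apply.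
  move=> h1 h2; have [n [hn1 hn2]] : exists n, y < F n%:R /\ F (- n%:R) < y.
    near \oo => n; exists n; split; near: n; [exact: h1|exact: h2].
  by exists n => //; rewrite /S/= in_itv/= !ltW.
have Ssub n : S n `<=` `]c, d[%classic by rewrite -SU; exact: bigcup_sup.
have cGF x : {for x, continuous (G \o F)}.
  by apply: continuous_comp; [exact: cF|apply: cG; rewrite in_itv/=].
have mGF : measurable_fun [set: R] (fun x => G (F x) * f x).
  by apply: continuous_measurable_fun => x; apply: cvgM; [exact: cGF|exact: cf].
have GF0 x : 0 <= G (F x) * f x by rewrite mulr_ge0 ?G0// ltW.
apply/esym; apply: integral_setT_nnitv => //.
suff : (\int[mu]_(y in S n) (G y)%:E @[n --> \oo] --> \int[mu]_(y in `]c, d[) (G y)%:E)%E.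
  apply: cvg_trans; apply: near_eq_cvg; apply: nearW => n.
  rewrite /S (@integration_by_substitution_increasing R F G (- n%:R) n%:R).
  - by apply: eq_integral => x _; rewrite F'E.
  - by rewrite (@le_trans _ _ 0)// oppr_le0.
  - by move=> x y _ _; exact: Finc.
  - by rewrite F'E => x _; exact: cf.
  - by rewrite F'E; apply/cvg_ex; exists (f (- n%:R)); exact/cvg_at_right_filter/cf.
  - by rewrite F'E; apply/cvg_ex; exists (f n%:R); exact/cvg_at_left_filter/cf.
  - split=> [x _| |]; first by case: (dF x).
      exact/cvg_at_right_filter/cF.
    exact/cvg_at_left_filter/cF.
  - apply: continuous_in_subspaceT => y; rewrite inE => Sy; apply: cG.
    by have := Ssub n y Sy; rewrite /= in_itv.
rewrite -SU; apply: (@ge0_nondecreasing_set_cvg_integral _ (measurableTypeR R) R S (EFin \o G) (@lebesgue_measure R)).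
- apply/nondecreasing_seqP => n; rewrite subsetEset; apply: subset_itv; rewrite bnd_simp.
    by apply: Fndec; rewrite lerN2 ler_nat.
  by apply: Fndec; rewrite ler_nat.
- by move=> n; exact: measurable_itv.
- by move=> n; apply/measurable_EFinP; apply: measurable_funS mG.
- move=> n y Sy; rewrite lee_fin; apply: G0; have := Ssub _ _ Sy.
  by rewrite /= in_itv.
Unshelve. all: by end_near. Qed.
End substitution.

Section laws_of_kernels.
Context {R : realType}.
Local Notation mu := (@lebesgue_measure R).
Variables (alpha : R) (alpha_gt0 : 0 < alpha) (alpha_lt1 : alpha < 1).

Let pi0 : 0 < pi :> R. Proof. exact: pi_gt0. Qed.

Definition logistic (x : R) : R := (1 + expR (- x))^-1.

Lemma logistic_itv x : 0 < logistic x < 1.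
Proof.
have e := expR_gt0 (- x); rewrite /logistic invr_gt0 addr_gt0//=.
by rewrite invf_lt1 ?addr_gt0// ltrDl.
Qed.

Lemma is_derive_logistic (x : R) :
  is_derive x 1 logistic (logistic x * (1 - logistic x)).
Proof.
have e := expR_gt0 (- x).
have n0 : 1 + expR (- x) != 0 by rewrite gt_eqF// addr_gt0.
have h1 : is_derive x 1 (fun y : R => 1 + expR (- y)) (- expR (- x)).
  by apply: is_derive_eq; rewrite /GRing.scale/=; ring.
have h2 : is_derive x 1 (fun y : R => 1 : R) 0 by exact: is_derive_cst.
have h3 := is_derive_div (f := fun y : R => 1) (g := fun y : R => 1 + expR (- y)) n0 h2 h1.
have -> : logistic = (fun y : R => 1 / (1 + expR (- y))) by apply/funext => y; rewrite div1r.
by apply: (is_derive_eq h3); field.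
Qed.

Lemma expRNn_cvg0 : expR (- n%:R) @[n --> \oo] --> (0 : R).
Proof. exact: cvgn_expR. Qed.

Lemma expRn_cvgy : expR (n%:R) @[n --> \oo] --> (+oo : set_system R).
Proof.
apply/cvgryPge => M; near=> n; apply: (@le_trans _ _ n%:R).
  by near: n; exact: nbhs_infty_ger.
by apply: le_trans (expR_ge1Dx _); rewrite lerDr.
Unshelve. all: by end_near. Qed.

Lemma logistic_cvg0 : logistic (- n%:R) @[n --> \oo] --> (0 : R).
Proof.
rewrite /logistic; under eq_fun do rewrite opprK.
apply/gtr0_cvgV0; first by apply: nearW => n; rewrite addr_gt0// expR_gt0.
apply/cvgryPge => M; have /cvgryPge/(_ M) := expRn_cvgy.
by apply: filterS => n /le_trans; apply; rewrite lerDr.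
Qed.

Lemma logistic_cvg1 : logistic n%:R @[n --> \oo] --> (1 : R).
Proof.
rewrite [X in _ --> X](_ : _ = (1 + 0)^-1); last by rewrite addr0 invr1.
apply: cvgV; first by rewrite addr0.
by apply: cvgD; [exact: cvg_cst|exact: expRNn_cvg0].
Qed.

Definition fG0 (x : R) : R := alpha * sin (pi * alpha) / ((1 - alpha) * pi) *
  (x `^ (alpha - 1) * (1 - x) `^ (alpha - 1) /
   ((1 - x) `^ (2 * alpha) - 2 * (1 - x) `^ alpha * x `^ alpha * cos (pi * alpha) + x `^ (2 * alpha))).

Lemma fG0E x : 0 < x < 1 -> f_G alpha x = fG0 x.
Proof.
move=> /andP[x0 x1]; rewrite /f_G indicE mem_set ?mulr1//=.
by rewrite in_itv/= !ltW.
Qed.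

(** The indicator keeps the end points 0 and 1, but there the density vanishes as well: a power of 0
    with nonzero exponent is 0 by convention, even when the exponent is negative. *)
Lemma f_G_out x : ~ (0 < x < 1) -> f_G alpha x = 0.
Proof.
move=> nx; rewrite /f_G indicE; case: (boolP (x \in _)); last by rewrite mulr0.
rewrite inE/= in_itv/= => /andP[x0 x1]; rewrite mulr1.
have a1 : alpha - 1 != 0 by rewrite lt_eqF// subr_lt0.
have [e|x0'] := eqVneq x 0; first by rewrite e powR0// !(mul0r, mulr0).
have [e|x1'] := eqVneq x 1; first by rewrite e subrr powR0// !(mul0r, mulr0).
by exfalso; apply: nx; rewrite !lt_neqAle x0 x1 x1' eq_sym x0'.
Qed.

(** For p = [logistic x] one has (1 - p) / p = e^-x, so the denominator of [f_G] is p^(2 alpha) e^(-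
    alpha x) times [cden] at height pi. *)
Lemma fG0_logistic x : fG0 (logistic x) * (logistic x * (1 - logistic x)) = gdens alpha x.
Proof.
have /andP[p0 p1] := logistic_itv x.
have e0 := expR_gt0 (- x).
have qE : 1 - logistic x = expR (- x) * logistic x.
  by rewrite /logistic; field; rewrite gt_eqF// addr_gt0.
have q0 : 0 < 1 - logistic x by rewrite subr_gt0.
have pB (y : R) : 0 < y -> y `^ (alpha - 1) = y `^ alpha / y.
  by move=> y0; rewrite powRB ?powRr1 ?(ltW y0)// (gt_eqF y0) implybT.
have p2 (y : R) : 0 < y -> y `^ (2 * alpha) = (y `^ alpha) ^+ 2.
  by move=> y0; rewrite mulrC powRrM powR_mulrn// powR_ge0.
rewrite /fG0 !pB// !p2// /gdens /cP /cden (mulrC pi).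
have -> : (1 - logistic x) `^ alpha = expR (- (alpha * x)) * logistic x `^ alpha.
  rewrite qE powRM ?expR_ge0 ?(ltW p0)//; congr (_ * _).
  by rewrite -expRM; congr expR; ring.
have := @den_pi_gt0 R alpha x.
rewrite alpha_gt0 (ltW alpha_lt1)/= => /(_ erefl); rewrite /cden.
rewrite (_ : expR (alpha * x) = (expR (- (alpha * x)))^-1); last by rewrite -expRN opprK.
have E0 := expR_gt0 (- (alpha * x)); have A0 : 0 < logistic x `^ alpha by rewrite powR_gt0.
have b1 : 0 < 1 - alpha by rewrite subr_gt0.
move: pi0 p0 q0 E0 A0; move: (cos _) (sin _); move: (pi : R) => p.
move: (logistic x) (_ `^ _) (expR _) => l A E c s pp p0 q0 E0 A0 D0.
have D1 : 0 < E ^+ 2 - 2 * E * c + 1.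
  have -> : E ^+ 2 - 2 * E * c + 1 = E * (E^-1 + E - 2 * c) by field; rewrite gt_eqF.
  by rewrite mulr_gt0.
have -> : E^-1 + E - 2 * c = (E ^+ 2 - 2 * E * c + 1) / E by field; rewrite gt_eqF.
have -> : (E * A) ^+ 2 - 2 * (E * A) * A * c + A ^+ 2 = (E ^+ 2 - 2 * E * c + 1) * A ^+ 2 by ring.
by field; rewrite !gt_eqF.
Qed.

Lemma powR_continuous (a x : R) : 0 < x -> {for x, continuous (fun y : R => y `^ a)}.
Proof.
by move=> x0; apply/differentiable_continuous/derivable1_diffP; case: (is_derive1_powR a x0).
Qed.

Lemma powR1B_continuous (a x : R) : x < 1 -> {for x, continuous (fun y : R => (1 - y) `^ a)}.
Proof.
move=> x1; apply: (@continuous_comp _ _ _ (fun y : R => 1 - y) (fun y : R => y `^ a)).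
  by apply: cvgB; [exact: cvg_cst|exact: cvg_id].
by apply: powR_continuous; rewrite subr_gt0.
Qed.

(** The denominator is the squared modulus of (1 - x)^alpha - x^alpha e^(i pi alpha). *)
Lemma fG0_den_gt0 x : 0 < x < 1 ->
  0 < (1 - x) `^ (2 * alpha) - 2 * (1 - x) `^ alpha * x `^ alpha * cos (pi * alpha) + x `^ (2 * alpha).
Proof.
move=> /andP[x0 x1]; have q0 : 0 < 1 - x by rewrite subr_gt0.
have p2 (y : R) : 0 < y -> y `^ (2 * alpha) = (y `^ alpha) ^+ 2.
  by move=> y0; rewrite mulrC powRrM powR_mulrn// powR_ge0.
rewrite !p2//; have A0 : 0 < x `^ alpha by rewrite powR_gt0.
have B0 : 0 < (1 - x) `^ alpha by rewrite powR_gt0.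
have s0 := sin_pialpha_gt0 alpha_gt0 alpha_lt1; rewrite mulrC in s0.
have := cos2Dsin2 (pi * alpha).
move: (_ `^ _) (x `^ _) A0 B0 s0; move=> b a a0 b0; move: (sin _) (cos _) => s c s0 cs.
have -> : b ^+ 2 - 2 * b * a * c + a ^+ 2 = (b - a * c) ^+ 2 + (a * s) ^+ 2 + a ^+ 2 * (1 - (c ^+ 2 + s ^+ 2)) by ring.
by rewrite cs subrr mulr0 addr0 ltr_wpDl ?sqr_ge0// exprn_gt0// mulr_gt0.
Qed.

Lemma fG0_continuous x : 0 < x < 1 -> {for x, continuous fG0}.
Proof.
move=> x01; have /andP[x0 x1] := x01.
have c1 a := @powR_continuous a x x0.
have c2 a := @powR1B_continuous a x x1.
apply: cvgM; first exact: cvg_cst.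
apply: cvgM; first by apply: cvgM; [exact: c1|exact: c2].
apply: cvgV; first by rewrite gt_eqF// fG0_den_gt0.
apply: cvgD; last exact: c1.
apply: cvgB; first exact: c2.
apply: cvgM; last exact: cvg_cst.
apply: cvgM; last exact: c1.
by apply: cvgM; [exact: cvg_cst|exact: c2].
Qed.

Lemma fG0_ge0 x : 0 < x < 1 -> 0 <= fG0 x.
Proof.
move=> x01; have /andP[x0 x1] := x01.
have s0 := sin_pialpha_gt0 alpha_gt0 alpha_lt1; rewrite mulrC in s0.
have d0 := fG0_den_gt0 x01.
rewrite /fG0 mulr_ge0//; last by rewrite mulr_ge0 ?mulr_ge0 ?powR_ge0// invr_ge0 ltW.
by rewrite divr_ge0// mulr_ge0 ?ltW// subr_gt0.
Qed.

Lemma integral_f_G (h : R -> R) :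
  {in `]0, 1[, continuous h} -> (forall x, 0 < x < 1 -> 0 <= h x) ->
  (\int[mu]_x (f_G alpha x * h x)%:E = \int[mu]_x (gdens alpha x * h (logistic x))%:E)%E.
Proof.
move=> ch h0.
transitivity (\int[mu]_(x in `]0%R, 1%R[) (fG0 x * h x)%:E)%E.
  rewrite [RHS]integral_mkcond; apply: eq_integral => x _; rewrite patchE.
  case: ifPn => [|]; rewrite ?inE ?notin_setE/= in_itv/=; first by move=> /fG0E ->.
  by move=> /f_G_out ->; rewrite mul0r.
transitivity (\int[mu]_x (fG0 (logistic x) * h (logistic x) * (logistic x * (1 - logistic x)))%:E)%E; last first.
  by apply: eq_integral => x _; rewrite mulrAC fG0_logistic.
apply: (@ge0_integration_by_substitution_oo R logistic (fun x => logistic x * (1 - logistic x)) (fun x => fG0 x * h x) 0 1).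
- exact: is_derive_logistic.
- have cl := is_derive_continuous is_derive_logistic.
  by move=> x; apply: cvgM; [exact: cl|apply: cvgB; [exact: cvg_cst|exact: cl]].
- by move=> x; have /andP[? ?] := logistic_itv x; rewrite mulr_gt0// subr_gt0.
- exact: logistic_itv.
- exact: logistic_cvg0.
- exact: logistic_cvg1.
- move=> x xI; have := xI; rewrite in_itv/= => x01.
  by apply: cvgM; [exact: fG0_continuous|exact: ch].
- by move=> x x01; rewrite mulr_ge0 ?fG0_ge0 ?h0.
Qed.

End laws_of_kernels.

(** * The Wiener-Gamma kernel as a quantile function *)

Section uniform_kernel.
Context {R : realType}.
Local Notation mu := (@lebesgue_measure R).
Variables (alpha : R) (alpha_gt0 : 0 < alpha) (alpha_lt1 : alpha < 1).

Let pi0 : 0 < pi :> R. Proof. exact: pi_gt0. Qed.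
Let b0 : 0 < pi * (1 - alpha). Proof. exact: beta_gt0. Qed.
Let s0 : 0 < sin (alpha * pi). Proof. exact: sin_pialpha_gt0. Qed.

(** The distribution function of X: the primitive of [cP] from [is_derive_atan_cP] at height pi,
    shifted to vanish at -oo and normalised. *)
Definition cdfX (x : R) : R :=
  (atan ((expR (alpha * x) - cos (alpha * pi)) / sin (alpha * pi)) + (pi / 2 - alpha * pi)) / (pi * (1 - alpha)).

Lemma is_derive_cdfX (x : R) : is_derive x 1 cdfX (gdens alpha x).
Proof.
have h := is_derive_atan_cP x (lt0r_neq0 s0).
apply: is_derive_eq; rewrite /gdens /GRing.scale/=.
by move: (cP alpha pi x) (pi * (1 - alpha))^-1 => u v; ring.
Qed.

Lemma cdfX_itv x : 0 < cdfX x < 1.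
Proof.
apply/andP; split.
  rewrite divr_gt0//.
  have : atan (- cos (alpha * pi) / sin (alpha * pi)) < atan ((expR (alpha * x) - cos (alpha * pi)) / sin (alpha * pi)).
    by apply: lt_atan; rewrite ltr_pM2r ?invr_gt0// ltrDr expR_gt0.
  by rewrite atan_cot//; lra.
rewrite ltr_pdivrMr// mul1r.
by have := atan_ltpi2 ((expR (alpha * x) - cos (alpha * pi)) / sin (alpha * pi)); lra.
Qed.

Lemma cdfX_cvg0 : cdfX (- n%:R) @[n --> \oo] --> (0 : R).
Proof.
rewrite [X in _ --> X](_ : _ = (alpha * pi - pi / 2 + (pi / 2 - alpha * pi)) / (pi * (1 - alpha))); last first.
  by rewrite [X in X / _](_ : _ = 0) ?mul0r//; ring.
apply: cvgM; last exact: cvg_cst.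
by apply: cvgD; [exact: atan_bot_cvg|exact: cvg_cst].
Qed.

Lemma cdfX_cvg1 : cdfX n%:R @[n --> \oo] --> (1 : R).
Proof.
rewrite [X in _ --> X](_ : _ = (pi / 2 + (pi / 2 - alpha * pi)) / (pi * (1 - alpha))); last first.
  rewrite [X in X / _](_ : _ = pi * (1 - alpha)) ?divff ?gt_eqF//; lra.
apply: cvgM; last exact: cvg_cst.
by apply: cvgD; [exact: atan_top_cvg|exact: cvg_cst].
Qed.

(** The real-valued form of the first kernel of part 3; it agrees with [wiener_gamma_kernel] on ]0,
    t], where the sine in the denominator is positive. *)
Definition wgk (t u : R) : R :=
  (1 + (sin (pi * (1 - alpha) * ((t - u) / t)) / sin (pi * (1 - alpha) * (u / t))) `^ alpha^-1)^-1.

Lemma sin_beta_gt0 v : 0 < v <= 1 -> 0 < sin (pi * (1 - alpha) * v).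
Proof.
move=> /andP[v0 v1]; rewrite sin_gt0_pi// mulr_gt0//=.
apply: (@le_lt_trans _ _ (pi * (1 - alpha))); first by rewrite ler_piMr// ltW.
by rewrite gtr_pMr// gtrBl.
Qed.

Lemma wgk_ge0 t u : 0 <= wgk t u.
Proof. by rewrite invr_ge0 addr_ge0// powR_ge0. Qed.

Lemma wgk_le1 t u : wgk t u <= 1.
Proof. by rewrite invf_le1 ?ltr_pwDl ?powR_ge0// lerDl powR_ge0. Qed.

(** In other words v -> [wgk t (t * v)] is the quantile function of G. With tau the arctangent in
    [cdfX x], the two sines become cos tau and cos (tau - alpha pi); the quotient of the second by
    the first is cos (alpha pi) + tan tau sin (alpha pi) = e^(alpha x). *)
Lemma wgk_cdfX t x : 0 < t -> wgk t (t * cdfX x) = logistic x.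
Proof.
move=> t0; rewrite /wgk /logistic.
have -> : t * cdfX x / t = cdfX x by rewrite mulrAC divff ?mul1r// gt_eqF.
have -> : (t - t * cdfX x) / t = 1 - cdfX x by field; rewrite gt_eqF.
set tau := atan ((expR (alpha * x) - cos (alpha * pi)) / sin (alpha * pi)).
have e1 : pi * (1 - alpha) * cdfX x = (tau - alpha * pi) + pi / 2.
  by rewrite /cdfX -/tau mulrCA divff ?mulr1 ?gt_eqF//; ring.
have e2 : pi * (1 - alpha) * (1 - cdfX x) = - tau + pi / 2.
  by rewrite mulrBr e1; lra.
rewrite e1 e2 !sinDpihalf cosN cosB.
have ct : 0 < cos tau by rewrite cos_gt0_pihalf// atan_gtNpi2 atan_ltpi2.
have tt : sin tau = (expR (alpha * x) - cos (alpha * pi)) / sin (alpha * pi) * cos tau.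
  have := atanK ((expR (alpha * x) - cos (alpha * pi)) / sin (alpha * pi)).
  by rewrite -/tau /tan => <-; rewrite mulfVK// gt_eqF.
have -> : cos tau * cos (alpha * pi) + sin tau * sin (alpha * pi) = cos tau * expR (alpha * x).
  by rewrite tt; move: s0; move: (sin _) (cos tau) (cos _) (expR _) => s ? ? ? sp; field; rewrite gt_eqF.
have -> : cos tau / (cos tau * expR (alpha * x)) = expR (- (alpha * x)).
  by rewrite expRN; have := expR_gt0 (alpha * x); move: (expR _) (cos tau) ct => E c c0 E0; field; rewrite !gt_eqF.
by rewrite -expRM; congr (1 + expR _)^-1; field; rewrite gt_eqF.
Qed.

Lemma wgk_continuous (t u : R) : 0 < u < t -> {for u, continuous (wgk t)}.
Proof.
move=> /andP[u0 ut]; have t0 := lt_trans u0 ut.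
have c1 (g : R -> R) : {for u, continuous g} -> {for u, continuous (fun u : R => sin (pi * (1 - alpha) * g u))}.
  move=> cg; apply: (@continuous_comp _ _ _ (fun u => pi * (1 - alpha) * g u) sin); last exact: continuous_sin.
  by apply: cvgM; [exact: cvg_cst|exact: cg].
have ca : {for u, continuous (fun u : R => sin (pi * (1 - alpha) * ((t - u) / t)))}.
  apply: c1; apply: cvgM; last exact: cvg_cst.
  by apply: cvgB; [exact: cvg_cst|exact: cvg_id].
have cb : {for u, continuous (fun u : R => sin (pi * (1 - alpha) * (u / t)))}.
  by apply: c1; apply: cvgM; [exact: cvg_id|exact: cvg_cst].
have b1 : 0 < sin (pi * (1 - alpha) * (u / t)).
  by rewrite sin_beta_gt0// divr_gt0//= ler_pdivrMr// mul1r ltW.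
have a1 : 0 < sin (pi * (1 - alpha) * ((t - u) / t)).
  by rewrite sin_beta_gt0// divr_gt0 ?subr_gt0//= ler_pdivrMr// mul1r gerBl ltW.
apply: cvgV; first by rewrite gt_eqF// ltr_pwDl ?powR_ge0.
apply: cvgD; first exact: cvg_cst.
apply: (@continuous_comp _ _ _ (fun u : R => sin (pi * (1 - alpha) * ((t - u) / t)) / sin (pi * (1 - alpha) * (u / t))) (fun y : R => y `^ alpha^-1)).
  by apply: cvgM; [exact: ca|apply: cvgV; [rewrite gt_eqF|exact: cb]].
by apply: powR_continuous; rewrite divr_gt0.
Qed.

Lemma ln1Ml_continuous (lam x : R) : 0 < lam -> 0 <= x -> {for x, continuous (fun x : R => ln (1 + lam * x))}.
Proof.
move=> l0 x0; apply: (@continuous_comp _ _ _ (fun x : R => 1 + lam * x) (@ln R)).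
  by apply: cvgD; [exact: cvg_cst|apply: cvgM; [exact: cvg_cst|exact: cvg_id]].
by apply: continuous_ln; rewrite ltr_pwDl// mulr_ge0// ltW.
Qed.

Lemma gdens_gt0 x : 0 < gdens alpha x.
Proof.
rewrite /gdens divr_gt0// /cP divr_gt0// ?mulr_gt0// den_pi_gt0//.
by rewrite alpha_gt0 ltW.
Qed.

(** The substitution u = t [cdfX x] turns the integral into t times the one computed in
    [gdens_ln]. *)
Lemma integral_ln_wgk (t lam : R) : 0 < t -> 0 < lam ->
  (\int[mu]_(u in `]0%R, t[) (ln (1 + lam * wgk t u))%:E = (t * Psi alpha lam)%:E)%E.
Proof.
move=> t0 l0.
transitivity (\int[mu]_x (ln (1 + lam * wgk t (t * cdfX x)) * (t * gdens alpha x))%:E)%E.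
  apply: (@ge0_integration_by_substitution_oo R (fun x => t * cdfX x) (fun x => t * gdens alpha x) (fun u => ln (1 + lam * wgk t u)) 0 t).
  - move=> x; have h := is_derive_cdfX x.
    by apply: is_derive_eq; rewrite /GRing.scale/=; ring.
  - by move=> x; apply: cvgM; [exact: cvg_cst|exact: gdens_continuous].
  - by move=> x; rewrite mulr_gt0// gdens_gt0.
  - by move=> x; have /andP[h1 h2] := cdfX_itv x; rewrite mulr_gt0//= gtr_pMr.
  - by rewrite -(mulr0 t); apply: cvgM; [exact: cvg_cst|exact: cdfX_cvg0].
  - by rewrite -[X in _ --> X](mulr1 t); apply: cvgM; [exact: cvg_cst|exact: cdfX_cvg1].
  - move=> u; rewrite in_itv/= => ut.
    apply: (@continuous_comp _ _ _ (wgk t) (fun y => ln (1 + lam * y))); first exact: wgk_continuous.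
    by apply: ln1Ml_continuous; rewrite ?wgk_ge0.
  - by move=> u _; rewrite ln_ge0// lerDl mulr_ge0 ?wgk_ge0// ltW.
rewrite EFinM -(gdens_ln alpha_gt0 alpha_lt1 l0) -ge0_integralZl_EFin//.
- by apply: eq_integral => x _; rewrite wgk_cdfX// /logistic -EFinM; congr EFin; ring.
- move=> x _; rewrite lee_fin mulr_ge0 ?(ltW (gdens_gt0 x))// ln_ge0// lerDl divr_ge0 ?(ltW l0)//.
- apply/measurable_EFinP; have mg := measurable_gdens alpha_gt0 alpha_lt1; mfun.
- exact: ltW.
Qed.

End uniform_kernel.

(** * Frullani's integral and the Levy exponent *)

Section frullani.
Context {R : realType}.
Local Notation mu := (@lebesgue_measure R).

Lemma is_derive_expRNM (c x : R) : is_derive x 1 (fun y => expR (- (c * y))) (- (c * expR (- (c * x)))).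
Proof. exact: is_derive_expRNMl. Qed.

Lemma expRNM_cvgy0 (c : R) : 0 < c -> expR (- (c * x)) @[x --> +oo] --> 0.
Proof.
move=> c0; apply: (@cvg_comp _ _ _ (fun x => c * x) (fun x => expR (- x)) _ (pinfty_nbhs R)).
  exact: gt0_cvgMry.
exact: cvgr_expR.
Qed.

Lemma integral_expRN (c : R) : 0 < c ->
  (\int[mu]_(x in `[0%R, +oo[) (expR (- (c * x)))%:E = (c^-1)%:E)%E.
Proof.
move=> c0.
have dF (x : R) : is_derive x 1 (fun y => - c^-1 * expR (- (c * y))) (expR (- (c * x))).
  have h := is_derive_expRNM c x.
  by apply: is_derive_eq; rewrite /GRing.scale/=; field; rewrite gt_eqF.
rewrite (ge0_integral_is_derivey _ (fun x _ => dF x) (l := 0)) => [|x _|x _|].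
- by rewrite mulr0 oppr0 expR0 mulr1 sub0e -EFinN opprK.
- exact: expR_ge0.
- by apply: (@is_derive_continuous _ _ (fun x => - (c * expR (- (c * x))))) => y; exact: is_derive_expRNM.
- by rewrite -[X in _ --> X](mulr0 (- c^-1)); apply: cvgM; [exact: cvg_cst|exact: expRNM_cvgy0].
Qed.

Lemma integral_expRN_itv (lam x : R) : 0 < lam -> 0 < x ->
  (\int[mu]_(m in `[0%R, lam]) (expR (- (x * m)))%:E = ((1 - expR (- (lam * x))) / x)%:E)%E.
Proof.
move=> l0 x0.
have dF (m : R) : is_derive m 1 (fun y => - x^-1 * expR (- (x * y))) (expR (- (x * m))).
  have h := is_derive_expRNM x m.
  by apply: is_derive_eq; rewrite /GRing.scale/=; field; rewrite gt_eqF.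
rewrite (integral_is_derive l0 (fun m _ => dF m)).
- rewrite mulr0 oppr0 expR0 mulr1 -EFinB; congr EFin; rewrite (mulrC lam).
  by field; rewrite gt_eqF.
- move=> m _; apply: (@is_derive_continuous _ _ (fun m => - (x * expR (- (x * m))))) => y.
  exact: is_derive_expRNM.
Qed.

(** (1 - e^(- lam x)) / x is the integral of e^(- x m) over m in [0, lam]; Tonelli then leaves the
    integral of 1 / (1 / g + m). *)
Lemma frullani (lam g : R) : 0 < lam -> 0 < g ->
  (\int[mu]_(x in `]0%R, +oo[) ((1 - expR (- (lam * x))) * (x^-1 * expR (- x / g)))%:E =
   (ln (1 + lam * g))%:E)%E.
Proof.
move=> l0 g0.
transitivity (\int[mu]_(x in `]0%R, +oo[) \int[mu]_(m in `[0%R, lam]) (expR (- x / g) * expR (- (x * m)))%:E)%E.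
  apply: eq_integral => x; rewrite inE/= in_itv/= andbT => x0.
  under eq_integral do rewrite EFinM.
  rewrite ge0_integralZl_EFin ?expR_ge0//.
  - rewrite integral_expRN_itv// -EFinM; congr EFin; ring.
  - by apply/measurable_EFinP; mfun.
rewrite (@tonelli_on _ _ _ _ R mu mu `]0%R, +oo[ `[0%R, lam] (fun x m => expR (- x / g) * expR (- (x * m))))//; last first.
  by apply: measurable_funTS; mfun.
transitivity (\int[mu]_(m in `[0%R, lam]) ((g^-1 + m)^-1)%:E)%E; last first.
  by rewrite integral_inv_shift ?invr_gt0// invrK.
apply: eq_integral => m; rewrite inE/= in_itv/= => /andP[m0 _].
have c0 : 0 < g^-1 + m by rewrite ltr_pwDl ?invr_gt0.
rewrite -integral_expRN// integral_itv_obnd_cbnd; last first.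
  by apply/measurable_EFinP; apply: measurable_funTS; mfun.
by apply: eq_integral => x _; rewrite -expRD; congr (expR _)%:E; ring.
Qed.

End frullani.

Section part1.
Context {R : realType}.
Local Notation mu := (@lebesgue_measure R).
Variables (alpha : R) (alpha_gt0 : 0 < alpha) (alpha_lt1 : alpha < 1).

(** After Tonelli, Frullani's integral applies at each value p of G in ]0, 1[; elsewhere the density
    vanishes. *)
Lemma levy_exponent_G d (T : measurableType d) (P : probability T R) (G : {RV P >-> R}) (lam : R) :
  has_density P G (f_G alpha) -> 0 < lam ->
  (\int[mu]_(x in `]0%R, +oo[) ((1 - expR (- lam * x))%:E * ((x^-1)%:E * 'E_P[fun w => expR (- x / G w)])) =
  (Psi alpha lam)%:E)%E.
Proof.
move=> dG l0; have [mf f0 _] := dG.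
transitivity (\int[mu]_(x in `]0%R, +oo[) \int[mu]_p (f_G alpha p * ((1 - expR (- (lam * x))) * (x^-1 * expR (- x / p))))%:E)%E.
  apply: eq_integral => x; rewrite inE/= in_itv/= andbT => x0.
  have mh : measurable_fun setT (fun p : R => expR (- x / p)) by mfun.
  rewrite unlock (integral_density _ dG mh)//.
  have e1 : 0 <= 1 - expR (- (lam * x)) by rewrite subr_ge0 expR_le1 oppr_le0 mulr_ge0 ?ltW.
  rewrite muleA -EFinM mulNr -ge0_integralZl_EFin//.
  - by apply: eq_integral => p _; rewrite -EFinM; congr EFin; ring.
  - by move=> p _; rewrite lee_fin mulr_ge0 ?expR_ge0.
  - by apply/measurable_EFinP; mfun.
  - by rewrite mulr_ge0// invr_ge0 ltW.
rewrite (@tonelli_on _ _ _ _ R mu mu `]0%R, +oo[ setT (fun x p => f_G alpha p * ((1 - expR (- (lam * x))) * (x^-1 * expR (- x / p)))))//; last 2 first.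
- apply: measurable_funTS.
  have mf2 : measurable_fun setT (fun z : R * R => f_G alpha z.2) by exact: (measurableT_comp mf measurable_snd).
  by mfun.
- move=> x p; rewrite /= in_itv/= andbT => x0 _.
  rewrite mulr_ge0// mulr_ge0//; last by rewrite mulr_ge0 ?expR_ge0// invr_ge0 ltW.
  by rewrite subr_ge0 expR_le1 oppr_le0 mulr_ge0 ?ltW.
rewrite -(gdens_ln alpha_gt0 alpha_lt1 l0).
transitivity (\int[mu]_p (f_G alpha p * ln (1 + lam * p))%:E)%E.
  apply: eq_integral => p _.
  have [p01|np] := pselect (0 < p < 1); last first.
    rewrite f_G_out// mul0r; apply: integral0_eq => x _; by rewrite mul0r.
  have /andP[p0 p1] := p01.
  under eq_integral do rewrite EFinM.
  rewrite ge0_integralZl_EFin//.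
  - by rewrite frullani.
  - move=> x; rewrite /= in_itv/= andbT => x0; rewrite lee_fin mulr_ge0//.
      by rewrite subr_ge0 expR_le1 oppr_le0 mulr_ge0 ?ltW.
    by rewrite mulr_ge0 ?expR_ge0// invr_ge0 ltW.
  - by apply/measurable_EFinP; apply: measurable_funTS; mfun.
rewrite integral_f_G//.
- move=> p; rewrite in_itv/= => /andP[p0 _]; apply: ln1Ml_continuous => //; exact: ltW.
- by move=> p /andP[p0 _]; rewrite ln_ge0// lerDl mulr_ge0 ?ltW.
Qed.

Lemma expR_Psi (lam t : R) : 0 < lam ->
  expR (- (t * Psi alpha lam)) = (alpha^-1 * (((1 + lam) `^ alpha - 1) / lam)) `^ (t / (1 - alpha)).
Proof.
move=> l0; have g0 := powR_sub1_gt0 alpha_gt0 l0.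
have B0 : 0 < alpha^-1 * (((1 + lam) `^ alpha - 1) / lam) by rewrite mulr_gt0 ?invr_gt0// divr_gt0.
rewrite /powR gt_eqF//; congr expR.
have -> : alpha^-1 * (((1 + lam) `^ alpha - 1) / lam) = (alpha * lam / ((1 + lam) `^ alpha - 1))^-1.
  by field; rewrite !gt_eqF.
rewrite lnV ?posrE; last by rewrite divr_gt0// mulr_gt0.
by rewrite /Psi; field; rewrite gt_eqF// subr_gt0.
Qed.

Lemma laplace_Gamma_inv d1 (T1 : measurableType d1) (P1 : probability T1 R)
    (G : {RV P1 >-> R}) d2 (T2 : measurableType d2) (P2 : probability T2 R)
    (Gam : R -> {RV P2 >-> R}) (lam t : R) :
  has_density P1 G (f_G alpha) -> is_Gamma_inv G Gam -> 0 < lam -> 0 <= t ->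
  ('E_P2[fun w => expR (- lam * Gam t w)] = (expR (- (t * Psi alpha lam)))%:E)%E.
Proof.
move=> dG [_ L] l0 t0; rewrite L ?(ltW l0)//.
by rewrite levy_exponent_G// -EFinM.
Qed.

End part1.

(** * Moments and Laplace transforms determine laws *)

Section sharp_power.
Context {R : realType}.

Lemma natrMexpRN_cvg0 (a : R) : 0 < a -> n%:R * expR (- (a * n%:R)) @[n --> \oo] --> 0.
Proof.
move=> a0.
have h : (2 / a ^+ 2) * (harmonic n : R) @[n --> \oo] --> 0.
  by rewrite -[X in _ --> X](mulr0 (2 / a ^+ 2)); apply: cvgM; [exact: cvg_cst|exact: cvg_harmonic].
rewrite -(cvg_shiftS).
apply: (@squeeze_cvgr _ _ _ _ (cst 0) (fun n => (2 / a ^+ 2) * (harmonic n : R))) => //; last exact: cvg_cst.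
apply: nearW => n; rewrite mulr_ge0 ?expR_ge0//=.
have n0 : 0 < n.+1%:R :> R by rewrite ltr0n.
have := @expR_ge1Dxn R (a * n.+1%:R) 1 (mulr_ge0 (ltW a0) (ltW n0)).
rewrite -[2`!]/2%N => e.
rewrite expRN ler_pdivrMr ?expR_gt0//.
apply: (@le_trans _ _ (2 / a ^+ 2 * harmonic n * ((a * n.+1%:R) ^+ 2 / 2))); last first.
  rewrite ler_pM2l; first lra.
  by rewrite mulr_gt0 ?invr_gt0// divr_gt0// exprn_gt0.
by rewrite le_eqVlt; apply/orP; left; apply/eqP; rewrite /harmonic /=; move: (n.+1%:R) n0 => m m0; field; rewrite !gt_eqF.
Qed.

Definition step_exp (c : R) (n : nat) : nat := (Num.truncn (n%:R / c ^+ n)).+1.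

Lemma bernoulli_ge (x : R) (N : nat) : 0 <= x <= 1 -> 1 - N%:R * x <= (1 - x) ^+ N.
Proof.
move=> /andP[x0 x1]; elim: N => [|N IH]; first by rewrite mul0r subr0.
rewrite exprS; apply: (@le_trans _ _ ((1 - x) * (1 - N%:R * x))); last first.
  by rewrite ler_wpM2l// subr_ge0.
rewrite -natr1; have : 0 <= N%:R * x ^+ 2 by rewrite mulr_ge0// sqr_ge0.
rewrite expr2; lra.
Qed.

(* [(1 - v^n)^N] with [N ~ n c^-n] separates [v < c] from [v >= c], with the
   correct value at [v = c]. *)
Lemma step_exp_cvg (c v : R) : 0 < c <= 1 -> 0 <= v <= 1 ->
  (1 - v ^+ n) ^+ step_exp c n @[n --> \oo] --> (\1_(`]-oo, c[%classic) v : R).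
Proof.
move=> /andP[c0 c1] /andP[v0 v1].
have vn n : 0 <= v ^+ n <= 1 by rewrite exprn_ge0// exprn_ile1.
have ub n : (1 - v ^+ n) ^+ step_exp c n <= 1.
  by have /andP[h1 h2] := vn n; rewrite exprn_ile1// ?subr_ge0// gerBl.
have cn n : 0 < c ^+ n by rewrite exprn_gt0.
rewrite indicE; have [vc|cv] := ltP v c.
  rewrite mem_set/=; last by rewrite in_itv.
  have [v0'|v0'] := eqVneq v 0.
    apply: cvg_near_cst; near=> n; rewrite v0' expr0n (_ : n == 0%N = false) ?subr0 ?expr1n//.
    by apply/negbTE; rewrite -lt0n; near: n; exact: nbhs_infty_gt.
  have vp : 0 < v by rewrite lt_neqAle eq_sym v0'.
  pose a := - ln (v / c).
  have q01 : 0 < v / c < 1 by rewrite divr_gt0//= ltr_pdivrMr// mul1r.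
  have a0 : 0 < a by rewrite oppr_gt0 ln_lt0.
  have qE n : (v / c) ^+ n = expR (- (a * n%:R)).
    by rewrite -mulNr /a opprK expRM_natr lnK// posrE; case/andP: q01.
  (* By Bernoulli's inequality the power is at least 1 - N v^n, and N <= n / c^n + 1 gives N v^n <=
     n (v / c)^n + v^n. *)
  have L : (1 - (n%:R * expR (- (a * n%:R)) + v ^+ n)) @[n --> \oo] --> (1 : R).
    rewrite [X in _ --> X](_ : _ = 1 - (0 + 0)); last by rewrite addr0 subr0.
    apply: cvgB; first exact: cvg_cst.
    apply: cvgD; first exact: natrMexpRN_cvg0.
    by apply: cvg_expr; rewrite ger0_norm// (lt_le_trans vc).
  apply: (@squeeze_cvgr _ _ _ _ (fun n => 1 - (n%:R * expR (- (a * n%:R)) + v ^+ n)) (cst 1)) => //; last exact: cvg_cst.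
  apply: nearW => n; rewrite ub andbT; apply: le_trans (bernoulli_ge _ (vn n)).
  rewrite lerD2l lerN2 -qE expr_div_n.
  have : (step_exp c n)%:R <= n%:R / c ^+ n + 1 :> R.
    rewrite /step_exp -natr1 lerD2r truncn_le.
    by rewrite divr_ge0// ltW.
  have /andP[h1 _] := vn n; move=> /(ler_wpM2r h1); rewrite mulrDl mul1r => /le_trans; apply.
  by rewrite lerD2r mulrAC mulrA.
rewrite memNset/=; last by rewrite in_itv/= ltNge cv.
(* For v >= c, (1 - v^n)^N <= exp (- N v^n) <= exp (- N c^n) <= exp (- n), as N >= n / c^n. *)
apply: (@squeeze_cvgr _ _ _ _ (cst 0) (fun n => expR (- n%:R))) => //; [|exact: cvg_cst|exact: cvgn_expR].
apply: nearW => n; have /andP[h1 h2] := vn n.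
rewrite exprn_ge0 ?subr_ge0//=.
apply: (@le_trans _ _ (expR (- v ^+ n) ^+ step_exp c n)).
  by rewrite lerXn2r ?nnegrE ?subr_ge0 ?expR_ge0// expR_ge1Dx.
rewrite -expRM_natr ler_expR mulNr lerN2.
apply: (@le_trans _ _ (c ^+ n * (step_exp c n)%:R)).
  rewrite mulrC -ler_pdivrMr//; apply: ltW; rewrite /step_exp.
  exact: truncnS_gt.
by rewrite ler_wpM2r// lerXn2r ?nnegrE// ltW.
Unshelve. all: by end_near. Qed.

End sharp_power.

Section moments.
Context {R : realType}.

Lemma integral_pow1B d (T : measurableType d) (P : probability T R) (V : T -> R) (n N : nat) :
  measurable_fun setT V -> (forall w, 0 <= V w <= 1) ->
  (\int[P]_w ((1 - V w ^+ n) ^+ N)%:E =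
   \sum_(i < N.+1) ((((-1) ^+ i) *+ 'C(N, i))%:E * \int[P]_w (V w ^+ (n * i)%N)%:E))%E.
Proof.
move=> mV V01.
have iV m : P.-integrable setT (fun w => (V w ^+ m)%:E).
  apply: measurable_bounded_integrable => //; first by rewrite /= probability_setT ltry.
    exact: measurable_funX.
  exists 1; split => // M M1 w _ /=.
  have /andP[v0 v1] := V01 w.
  by rewrite ger0_norm ?exprn_ge0// (le_trans _ (ltW M1))// exprn_ile1.
transitivity (\int[P]_w (\sum_(i < N.+1) (((-1) ^+ i) *+ 'C(N, i))%:E * (V w ^+ (n * i)%N)%:E))%E.
  apply: eq_integral => w _; rewrite exprBn -sumEFin; apply: eq_bigr => i _.
  by rewrite -EFinM exprM expr1n mulr1 mulrnAl.
rewrite integral_sum//; last by move=> i; exact: (@integrableZl _ _ _ P _ measurableT _ _ (iV (n * i)%N)).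
by apply: eq_bigr => i _; rewrite integralZl.
Qed.

Lemma moments_ltr d (T : measurableType d) (P : probability T R) (V : T -> R)
    d' (T' : measurableType d') (Q : probability T' R) (V' : T' -> R) (c : R) :
  measurable_fun setT V -> (forall w, 0 <= V w <= 1) ->
  measurable_fun setT V' -> (forall w, 0 <= V' w <= 1) ->
  (forall n : nat, \int[P]_w (V w ^+ n)%:E = \int[Q]_w (V' w ^+ n)%:E)%E ->
  0 < c <= 1 -> P (V @^-1` `]-oo, c[) = Q (V' @^-1` `]-oo, c[).
Proof.
move=> mV V01 mV' V01' mom c01.
have L d0 (T0 : measurableType d0) (P0 : probability T0 R) (U : T0 -> R) :
    measurable_fun setT U -> (forall w, 0 <= U w <= 1) ->
    (\int[P0]_w ((1 - U w ^+ n) ^+ step_exp c n)%:E @[n --> \oo] --> P0 (U @^-1` `]-oo, c[))%E.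
  move=> mU U01; rewrite (probability_indic P0 mU)//.
  apply: (@bounded_convergence _ _ _ _ _ _ _ 1) => //.
  - by rewrite /= probability_setT ltry.
  - by move=> n; apply: measurable_funX; apply: measurable_funB => //; exact: measurable_funX.
  - have mi : measurable_fun [set: R] (\1_(`]-oo, c[%classic) : R -> R) by exact: measurable_indic.
    apply: measurable_funM => //; exact: (measurableT_comp mi mU).
  - by apply: aeW => w _; rewrite mul1r; exact: step_exp_cvg.
  - move=> n w _; have /andP[u0 u1] := U01 w.
    have un : 0 <= U w ^+ n <= 1 by rewrite exprn_ge0// exprn_ile1.
    have /andP[h1 h2] := un.
    by rewrite ger0_norm ?exprn_ge0 ?subr_ge0// exprn_ile1 ?subr_ge0// gerBl.
have E n : (\int[P]_w ((1 - V w ^+ n) ^+ step_exp c n)%:E = \int[Q]_w ((1 - V' w ^+ n) ^+ step_exp c n)%:E)%E.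
  by rewrite !integral_pow1B//; apply: eq_bigr => i _; rewrite mom.
have LQ := L _ _ Q V' mV' V01'; have := L _ _ P V mV V01.
under eq_fun do rewrite E.
by move=> LP; exact: cvg_unique LP LQ.
Qed.

End moments.

Section rays.
Context {R : realType} d (T : measurableType d) (P : probability T R)
  d' (T' : measurableType d') (Q : probability T' R).

Lemma eq_law_rays (X : T -> R) (Y : T' -> R) :
  measurable_fun setT X -> measurable_fun setT Y ->
  (forall c, P (X @^-1` `]-oo, c[) = Q (Y @^-1` `]-oo, c[)) -> eq_law P X Q Y.
Proof.
move=> mX mY XY B mB.
pose X' : {mfun T >-> R} := HB.pack X (isMeasurableFun.Build _ _ _ _ _ mX).
pose Y' : {mfun T' >-> R} := HB.pack Y (isMeasurableFun.Build _ _ _ _ _ mY).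
change (pushforward P X' B = pushforward Q Y' B).
apply: (measure_unique (@RGenInftyO.G R) (fun n => `]-oo, n%:R[%classic)) => //.
- exact: RGenInftyO.measurableE.
- move=> _ _ [x ->] [y ->]; exists (Num.min x y); apply/seteqP; split => z /=;
  by rewrite !in_itv/= lt_min => /andP.
- by move=> n; exists n%:R.
- rewrite -subTset => x _; exists (Num.truncn `|x|).+1 => //=.
  by rewrite in_itv/= (le_lt_trans (ler_norm _))// truncnS_gt.
- by move=> _ [x ->]; exact: XY.
- by move=> n; rewrite /pushforward (le_lt_trans (probability_le1 _ _)) ?ltry// -(setTI (_ @^-1` _)); exact: (mX measurableT _ (measurable_itv _)).
Qed.

End rays.

Section ae_rays.
Context {R : realType} d (T : measurableType d) (P : probability T R).

Lemma measurable_preimage (X : T -> R) (B : set R) :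
  measurable_fun setT X -> measurable B -> measurable (X @^-1` B).
Proof. by move=> mX mB; rewrite -(setTI (_ @^-1` _)); exact: mX. Qed.

Lemma ae_probability0 (X : T -> R) (B : set R) :
  measurable_fun setT X -> measurable B -> {ae P, forall w, ~ B (X w)} -> P (X @^-1` B) = 0%E.
Proof.
move=> mX mB h; apply: measure_negligible; first exact: measurable_preimage.
by apply: negligibleS h => w BX /=; apply.
Qed.

Lemma probability0_ae (X : T -> R) (B : set R) :
  measurable_fun setT X -> measurable B -> P (X @^-1` B) = 0%E -> {ae P, forall w, ~ B (X w)}.
Proof.
move=> mX mB h; exists (X @^-1` B); split => //; first exact: measurable_preimage.
by move=> w /= /contrapT.
Qed.

Lemma ae_probability1 (X : T -> R) (B : set R) :
  measurable_fun setT X -> measurable B -> {ae P, forall w, B (X w)} -> P (X @^-1` B) = 1%E.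
Proof.
move=> mX mB h; have mXB := measurable_preimage mX mB.
have := probability_setC P mXB; rewrite (_ : ~` (X @^-1` B) = X @^-1` (~` B))// ae_probability0.
- move=> e; apply/esym; move: e; rewrite -[X in X = _ -> _]/(0%E).
  have /fineK <- : P (X @^-1` B) \is a fin_num by rewrite fin_num_measure.
  by rewrite -EFinB => -[] e; congr EFin; lra.
- exact: mX.
- exact: measurableC.
- by apply: filterS h => w Bw; apply.
Qed.

End ae_rays.

Section determination.
Context {R : realType} d (T : measurableType d) (P : probability T R)
  d' (T' : measurableType d') (Q : probability T' R).

(** Moments of absolute values keep the integrands nonnegative everywhere. Clamping to [0, 1]
    preserves the events X < c for c in ]0, 1] and changes the variables only on null sets; other
    values of c are trivial. *)
Lemma moments_eq_law (X : T -> R) (Y : T' -> R) :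
  measurable_fun setT X -> measurable_fun setT Y ->
  {ae P, forall w, 0 <= X w <= 1} -> {ae Q, forall w, 0 <= Y w <= 1} ->
  (forall n : nat, \int[P]_w (`|X w| ^+ n)%:E = \int[Q]_w (`|Y w| ^+ n)%:E)%E -> eq_law P X Q Y.
Proof.
move=> mX mY X01 Y01 mom; apply: eq_law_rays => // c.
have [c0|c0] := leP c 0.
  rewrite !ae_probability0//.
    by apply: filterS Y01 => w /andP[h _] /=; rewrite in_itv/= ltNge (le_trans c0 h).
  by apply: filterS X01 => w /andP[h _] /=; rewrite in_itv/= ltNge (le_trans c0 h).
have [c1|c1] := ltP 1 c.
  rewrite !ae_probability1//.
    by apply: filterS Y01 => w /andP[_ h] /=; rewrite in_itv/= (le_lt_trans h).
  by apply: filterS X01 => w /andP[_ h] /=; rewrite in_itv/= (le_lt_trans h).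
pose cl (x : R) : R := Num.max 0 (Num.min x 1).
have cl01 x : 0 <= cl x <= 1 by rewrite /cl le_max lexx/= ge_max ler01 ge_min lexx orbT.
have clid x : 0 <= x <= 1 -> cl x = `|x|.
  by move=> /andP[x0 x1]; rewrite /cl min_l// max_r// ger0_norm.
have mcl : measurable_fun [set: R] cl by apply: measurable_maxr => //; apply: measurable_minr.
have clray (S : Type) (Z : S -> R) : Z @^-1` `]-oo, c[ = (cl \o Z) @^-1` `]-oo, c[.
  apply/seteqP; split => w /=; rewrite !in_itv/= /cl gt_max c0/= gt_min.
    by move=> ->.
  by case/orP => //; rewrite ltNge c1.
rewrite clray [in RHS]clray; apply: moments_ltr => //; last by rewrite c0.
- exact: (measurableT_comp mcl mX).
- by move=> w; exact: cl01.
- exact: (measurableT_comp mcl mY).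
- by move=> w; exact: cl01.
- have E d0 (T0 : measurableType d0) (P0 : probability T0 R) (Z : T0 -> R) n :
      measurable_fun setT Z -> {ae P0, forall w, 0 <= Z w <= 1} ->
      (\int[P0]_w ((cl \o Z) w ^+ n)%:E = \int[P0]_w (`|Z w| ^+ n)%:E)%E.
    move=> mZ Z01; apply: ge0_ae_eq_integral => //.
    + by apply/measurable_EFinP; apply: measurable_funX; exact: measurableT_comp.
    + by apply/measurable_EFinP; apply: measurable_funX; exact: measurableT_comp.
    + by move=> w _; rewrite lee_fin exprn_ge0//=; have /andP[] := cl01 (Z w).
    + by apply: filterS Z01 => w h _ /=; rewrite clid.
  by move=> n; rewrite !E.
Qed.

(** 1 - e^-X increases with X, so X < c becomes an event of the form handled by [moments_ltr]. The
    moments of e^-X are Laplace transforms at integers, and those of 1 - e^-X follow by the binomial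
    formula. *)
Lemma laplace_eq_law (X : T -> R) (Y : T' -> R) :
  measurable_fun setT X -> measurable_fun setT Y ->
  {ae P, forall w, 0 <= X w} -> {ae Q, forall w, 0 <= Y w} ->
  (forall lam : R, 0 < lam ->
    (\int[P]_w (expR (- (lam * X w)))%:E = \int[Q]_w (expR (- (lam * Y w)))%:E)%E) ->
  eq_law P X Q Y.
Proof.
move=> mX mY X0 Y0 L; apply: eq_law_rays => // c.
have [c0|c0] := leP c 0.
  rewrite !ae_probability0//.
    by apply: filterS Y0 => w h /=; rewrite in_itv/= ltNge (le_trans c0 h).
  by apply: filterS X0 => w h /=; rewrite in_itv/= ltNge (le_trans c0 h).
pose e (x : R) : R := expR (- Num.max x 0).
have e01 x : 0 <= e x <= 1 by rewrite expR_ge0 expR_le1 oppr_le0 le_max lexx orbT.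
have me : measurable_fun [set: R] e by apply: measurable_fun_expR; apply: measurable_fun_opp; apply: measurable_maxr.
have eray (S : Type) (Z : S -> R) : Z @^-1` `]-oo, c[ = (fun w => 1 - e (Z w)) @^-1` `]-oo, (1 - expR (- c))[.
  by apply/seteqP; split => w /=; rewrite !in_itv/= ltrD2l ltrN2 ltr_expR ltrN2 gt_max c0 andbT.
rewrite eray [in RHS]eray; apply: moments_ltr => //.
- by apply: measurable_funB => //; exact: (measurableT_comp me mX).
- by move=> w; have /andP[h1 h2] := e01 (X w); rewrite subr_ge0 h2 gerBl.
- by apply: measurable_funB => //; exact: (measurableT_comp me mY).
- by move=> w; have /andP[h1 h2] := e01 (Y w); rewrite subr_ge0 h2 gerBl.
- have E d0 (T0 : measurableType d0) (P0 : probability T0 R) (Z : T0 -> R) n :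
      measurable_fun setT Z -> {ae P0, forall w, 0 <= Z w} ->
      (\int[P0]_w (e (Z w) ^+ n)%:E = \int[P0]_w (expR (- (n%:R * Z w)))%:E)%E.
    move=> mZ Z0; apply: ge0_ae_eq_integral => //.
    + by apply/measurable_EFinP; apply: measurable_funX; exact: (measurableT_comp me mZ).
    + by apply/measurable_EFinP; mfun.
    + by move=> w _; rewrite lee_fin exprn_ge0//=; have /andP[] := e01 (Z w).
    + by apply: filterS Z0 => w h _ /=; rewrite /e max_l// -mulrN expRM_natl.
  have E2 (n : nat) : (\int[P]_w (e (X w) ^+ n)%:E = \int[Q]_w (e (Y w) ^+ n)%:E)%E.
    (* The hypothesis is about lam > 0; the moment of order 0 is the total mass. *)
    case: n => [|n]; last by rewrite !E// L.
    by under eq_integral do rewrite expr0; under [RHS]eq_integral do rewrite expr0;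
       rewrite !integral_cst//= !probability_setT.
  move=> n.
  have := @integral_pow1B _ _ _ P (e \o X) 1 n (measurableT_comp me mX) (fun w => e01 (X w)).
  have := @integral_pow1B _ _ _ Q (e \o Y) 1 n (measurableT_comp me mY) (fun w => e01 (Y w)).
  under eq_integral do rewrite /= expr1; move=> ->.
  under eq_integral do rewrite /= expr1; move=> ->.
  by apply: eq_bigr => i _; rewrite E2.
- by rewrite subr_gt0 expR_lt1 oppr_lt0 c0/= gerBl expR_ge0.
Qed.

End determination.

Section independence.
Context {R : realType} d (T : measurableType d) (P : probability T R).

(** Independence makes the joint law agree with the product of the marginal laws on rectangles,
    hence on all measurable sets; Tonelli concludes. *)
Lemma independent_integral (X Y : T -> R) (F : R -> R -> R) :
  measurable_fun setT X -> measurable_fun setT Y -> independent P X Y ->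
  measurable_fun setT (fun z : R * R => F z.1 z.2) -> (forall x y, 0 <= F x y) ->
  (\int[P]_w (F (X w) (Y w))%:E = \int[P]_w \int[P]_v (F (X w) (Y v))%:E)%E.
Proof.
move=> mX mY XY mF F0.
pose X' : {RV P >-> R} := HB.pack X (isMeasurableFun.Build _ _ _ _ _ mX).
pose Y' : {RV P >-> R} := HB.pack Y (isMeasurableFun.Build _ _ _ _ _ mY).
have mXY : measurable_fun setT (fun w => (X w, Y w)) by exact: measurable_fun_pair.
pose XY' : {mfun T >-> (R * R)%type} := HB.pack (fun w => (X w, Y w)) (isMeasurableFun.Build _ _ _ _ _ mXY).
pose f (z : R * R) := (F z.1 z.2)%:E.
have mf : measurable_fun setT f by exact/measurable_EFinP.
have f0 z : (0 <= f z)%E by rewrite lee_fin.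
have U : forall A : set (R * R), measurable A ->
    (distribution P X' \x distribution P Y')%E A = pushforward P XY' A.
  by apply: product_measure_unique => A B mA mB; exact: XY.
transitivity (\int[pushforward P XY']_z f z)%E.
  by rewrite ge0_integral_pushforward.
transitivity (\int[(distribution P X' \x distribution P Y')%E]_z f z)%E.
  by apply: eq_measure_integral => A mA _; exact/esym/U.
rewrite fubini_tonelli1// /fubini_F.
have mG : measurable_fun setT (fun x => \int[distribution P Y']_y f (x, y))%E.
  exact: (@measurable_fun_fubini_tonelli_F _ _ _ _ R (distribution P Y') f mf f0).
transitivity (\int[P]_w \int[distribution P Y']_y f (X w, y))%E.
  rewrite [LHS](@ge0_integral_pushforward _ _ _ _ _ _ mX P setT _ measurableT mG)//.
  by move=> x _; apply: integral_ge0 => y _; exact: f0.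
apply: eq_integral => w _.
by rewrite [LHS](@ge0_integral_pushforward _ _ _ _ _ _ mY P setT (fun y => f (X w, y)) measurableT (measurableT_comp mf (measurable_pair1 (X w)))).
Qed.

Lemma independent_integralM (X Y : T -> R) (f g : R -> R) :
  measurable_fun setT X -> measurable_fun setT Y -> independent P X Y ->
  measurable_fun setT f -> measurable_fun setT g ->
  (forall x, 0 <= f x) -> (forall x, 0 <= g x) ->
  (\int[P]_w (f (X w) * g (Y w))%:E = (\int[P]_w (f (X w))%:E) * (\int[P]_w (g (Y w))%:E))%E.
Proof.
move=> mX mY XY mf mg f0 g0.
rewrite (@independent_integral X Y (fun x y => f x * g y))//; last 2 first.
- by apply: measurable_funM; [exact: (measurableT_comp mf measurable_fst)|exact: (measurableT_comp mg measurable_snd)].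
- by move=> x y; exact: mulr_ge0.
rewrite muleC -ge0_integralZl//; last 3 first.
- by apply/measurable_EFinP; exact: measurableT_comp.
- by move=> w _; rewrite lee_fin.
- by apply: integral_ge0 => w _; rewrite lee_fin.
apply: eq_integral => w _; under eq_integral do rewrite EFinM.
rewrite ge0_integralZl_EFin 1?muleC//.
- by move=> v _; rewrite lee_fin.
- by apply/measurable_EFinP; exact: measurableT_comp.
Qed.

End independence.

(** * Gamma integrals and the density of Gamma_(1-alpha) *)

Section gamma_integrals.
Context {R : realType}.
Local Notation mu := (@lebesgue_measure R).

(** By uniqueness of Lebesgue measure: c times its image under x -> c x gives intervals their
    length. *)
Lemma integral_scale (c : R) (f : R -> R) : 0 < c -> measurable_fun setT f -> (forall x, 0 <= f x) ->
  (\int[mu]_(x in `]0%R, +oo[) (f (c * x))%:E = (c^-1)%:E * \int[mu]_(x in `]0%R, +oo[) (f x)%:E)%E.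
Proof.
move=> c0 mf f0.
have c1 : 0 <= c by exact: ltW.
have mc : measurable_fun [set: measurableTypeR R] ( *%R c : measurableTypeR R -> measurableTypeR R) by apply: measurable_funM.
pose nu0 := (mscale (NngNum c1) (pushforward mu ( *%R c : measurableTypeR R -> measurableTypeR R)) : {measure set (measurableTypeR R) -> \bar R}).
pose nu := nu0 mc.
have E (A : set (measurableTypeR R)) : measurable A -> mu A = nu A.
  move=> mA; apply: lebesgue_measure_unique => //= _ [[a b]] _ <-.
  rewrite /nu/=.
  rewrite /mscale/= /pushforward.
  rewrite (_ : _ @^-1` _ = `]c^-1 * a, c^-1 * b]%classic); last first.
    by apply/seteqP; split => x /=; rewrite !in_itv/= ltr_pdivrMl// ler_pdivlMl.
  rewrite /= !lebesgue_measure_itv/= !lte_fin ltr_pM2l ?invr_gt0//.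
  case: ifPn => _; last by rewrite mule0.
  by rewrite -!EFinB -EFinM; congr EFin; field; rewrite gt_eqF.
have mfE : measurable_fun setT (fun x : measurableTypeR R => (f x)%:E) by exact/measurable_EFinP.
have mD : measurable (`]0, +oo[%classic : set (measurableTypeR R)) by exact: measurable_itv.
transitivity ((c^-1)%:E * \int[nu]_(x in `]0%R, +oo[) (f x)%:E)%E; last first.
  congr (_ * _)%E; apply: eq_measure_integral => A mA _; exact/esym/E.
rewrite ge0_integral_mscale//; last 2 first.
- exact: measurable_funTS.
- by move=> x _; rewrite lee_fin.
rewrite muleA -EFinM /= mulVf ?gt_eqF// mul1e.
rewrite (@ge0_integral_pushforward _ _ _ _ _ ( *%R c : measurableTypeR R -> measurableTypeR R) mc mu `]0%R, +oo[%classic (EFin \o f) mD); last 2 first.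
- exact: measurable_funTS.
- by move=> x _; rewrite /= lee_fin.
rewrite (_ : _ @^-1` _ = `]0, +oo[%classic)//.
by apply/seteqP; split => x /=; rewrite !in_itv/= !andbT pmulr_rgt0.
Qed.

(** Extended-real gamma integral at rate c. [Gamma_fun] is a finite part, so the two can be
    identified only after finiteness is known. *)
Definition gint (s c : R) : \bar R :=
  (\int[mu]_(x in `]0%R, +oo[) (expR (- (c * x)) * x `^ (s - 1))%:E)%E.

Lemma gint_ge0 s c : (0 <= gint s c)%E.
Proof. by apply: integral_ge0 => x _; rewrite lee_fin mulr_ge0 ?expR_ge0 ?powR_ge0. Qed.

Lemma gint_scale s c : 0 < c -> gint s c = ((c `^ (- s))%:E * gint s 1)%E.
Proof.
move=> c0.
pose f (x : R) := expR (- x) * x `^ (s - 1).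
have mf : measurable_fun setT f by rewrite /f; mfun.
have f0 x : 0 <= f x by rewrite mulr_ge0 ?expR_ge0 ?powR_ge0.
have := integral_scale c0 mf f0.
have -> : (\int[mu]_(x in `]0%R, +oo[) (f (c * x))%:E = (c `^ (s - 1))%:E * gint s c)%E.
  rewrite /gint -ge0_integralZl_EFin ?powR_ge0//.
  - apply: eq_integral => x; rewrite inE/= in_itv/= andbT => x0.
    by rewrite -EFinM /f powRM ?(ltW c0) ?(ltW x0)//; congr EFin; ring.
  - by move=> x _; rewrite lee_fin mulr_ge0 ?expR_ge0 ?powR_ge0.
  - by apply/measurable_EFinP; apply: measurable_funTS; mfun.
rewrite (_ : (\int[mu]_(x in `]0%R, +oo[) (f x)%:E)%E = gint s 1); last first.
  by apply: eq_integral => x _; rewrite /f mul1r.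
move=> /(congr1 (fun z => ((c `^ (- (s - 1)))%:E * z)%E)).
have cD u v : c `^ u * c `^ v = c `^ (u + v) by rewrite powRD// (gt_eqF c0) implybT.
rewrite !muleA -!EFinM cD addNr powRr0 mul1e => ->.
congr (_%:E * _)%E; rewrite -powR_inv1 ?(ltW c0)// cD.
by congr powR; ring.
Qed.

Lemma integral_powR01 (s : R) : 0 < s -> (\int[mu]_(x in `]0%R, 1%R]) (x `^ (s - 1))%:E <= (s^-1)%:E)%E.
Proof.
move=> s0.
pose S (n : nat) : set R := `[n.+2%:R^-1, 1]%classic.
have SU : `]0, 1]%classic = \bigcup_n S n.
  apply/seteqP; split => x /=; rewrite in_itv/=.
    move=> /andP[x0 x1]; exists (Num.truncn x^-1) => //=.
    rewrite /S/= in_itv/= x1 andbT -[leRHS]invrK lef_pV2 ?posrE ?invr_gt0//.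
    by apply: ltW; apply: (lt_trans (truncnS_gt _)); rewrite ltr_nat.
  move=> [n _]; rewrite /S/= in_itv/= => /andP[h ->]; rewrite (lt_le_trans _ h)// invr_gt0//.
have n20 n : 0 < n.+2%:R^-1 :> R by rewrite invr_gt0.
have SE n : (\int[mu]_(x in S n) (x `^ (s - 1))%:E = (s^-1)%:E - (s^-1 * n.+2%:R^-1 `^ s)%:E)%E.
  have dP (x : R) : n.+2%:R^-1 <= x -> is_derive x 1 (fun y => s^-1 * y `^ s) (x `^ (s - 1)).
    move=> h; have h2 := is_derive1_powR s (lt_le_trans (n20 n) h).
    by apply: is_derive_eq; rewrite /GRing.scale/=; field; rewrite gt_eqF.
  have n1 : n.+2%:R^-1 < 1 :> R by rewrite invf_lt1// ltr1n.
  rewrite (integral_is_derive n1 (fun x xn => dP x (proj1 (andP xn)))) => [|x /andP[x0 _]].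
  - by rewrite powR1 mulr1.
  - by apply: powR_continuous; exact: lt_le_trans x0.
have h := @ge0_nondecreasing_set_cvg_integral _ (measurableTypeR R) R S (fun x => (x `^ (s - 1))%:E) (@lebesgue_measure R).
rewrite SU; apply: (cvge_le _ (h _ _ _ _)).
- apply: nearW => n; rewrite [leLHS]SE -EFinB lee_fin gerBl mulr_ge0 ?invr_ge0 ?(ltW s0)//.
- apply/nondecreasing_seqP => n; rewrite subsetEset; apply: subset_itv; rewrite bnd_simp//.
  by rewrite lef_pV2 ?posrE// ler_nat.
- by move=> n; exact: measurable_itv.
- by move=> n; apply/measurable_EFinP; apply: measurable_funTS; mfun.
- by move=> n x _; rewrite lee_fin powR_ge0.
Qed.

Lemma gint_fin01 s c : 0 < s <= 1 -> 0 < c -> (gint s c < +oo)%E.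
Proof.
move=> /andP[s0 s1] c0.
pose f (x : R) := x `^ (s - 1) * \1_(`]0, 1]%classic) x + expR (- (c * x)).
have mf : measurable_fun setT f.
  apply: measurable_funD; last by mfun.
  by apply: measurable_funM; [mfun|exact: measurable_indic].
apply: (@le_lt_trans _ _ (\int[mu]_(x in `]0%R, +oo[) (f x)%:E)%E).
  apply: ge0_le_integral => //.
  - by move=> x _; rewrite lee_fin mulr_ge0 ?expR_ge0 ?powR_ge0.
  - by apply/measurable_EFinP; apply: measurable_funTS; mfun.
  - by apply/measurable_EFinP; exact: measurable_funTS.
  - move=> x; rewrite /= in_itv/= andbT => x0; rewrite lee_fin /f indicE.
    have [x1|x1] := leP x 1.
      rewrite mem_set; last by rewrite /= in_itv/= x0.
      rewrite mulr1 ler_wpDr ?expR_ge0//.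
      by rewrite ler_piMl ?powR_ge0// expR_le1 oppr_le0 mulr_ge0 ?ltW.
    rewrite memNset; last by rewrite /= in_itv/= x0 leNgt x1.
    rewrite mulr0 add0r ler_piMr ?expR_ge0//.
    by rewrite -[leRHS](powRr0 x) ler_powR ?(ltW x1)// subr_le0.
rewrite /f; under eq_integral do rewrite EFinD.
have mi : measurable_fun [set: R] (\1_(`]0, 1]%classic) : R -> R) by exact: measurable_indic.
rewrite ge0_integralD//.
all: try by move=> x _; rewrite lee_fin mulr_ge0 ?powR_ge0.
all: try by apply/measurable_EFinP; apply: measurable_funTS; mfun.
apply: lte_add_pinfty; last first.
  rewrite integral_itv_obnd_cbnd; last by apply/measurable_EFinP; apply: measurable_funTS; mfun.
  by rewrite integral_expRN// ltry.
apply: (@le_lt_trans _ _ (s^-1)%:E); last exact: ltry.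
apply: le_trans (integral_powR01 s0).
rewrite [leLHS]integral_mkcond [leRHS]integral_mkcond.
rewrite le_eqVlt; apply/orP; left; apply/eqP; apply: eq_integral => x _.
rewrite !patchE indicE; case: (boolP (x \in `]0, 1]%classic)) => h.
  rewrite mem_set ?mulr1//=.
  by move: h; rewrite inE/= !in_itv/= => /andP[->].
by rewrite mulr0; case: ifPn.
Qed.

(** Half of the exponential absorbs x^n, which leaves an exponent t <= 1, the case of [gint_fin01].
    Exponents are written n + t because those of interest are n + (1 - alpha). *)
Lemma gint_fin (n : nat) t : 0 < t <= 1 -> (gint (n%:R + t) 1 < +oo)%E.
Proof.
move=> t01.
have [C C0 HC] : exists2 C : R, 0 <= C & forall x, 0 < x -> x ^+ n <= C * expR (x / 2).
  case: n => [|n].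
    exists 1 => // x x0; rewrite expr0 mul1r -expR0 ler_expR divr_ge0 // ltW //.
  exists (2 ^+ n.+1 * n.+1`!%:R) => [|x x0]; first by rewrite mulr_ge0.
  have := @expR_ge1Dxn R (x / 2) n (divr_ge0 (ltW x0) (ler0n _ _)).
  have f0 : 0 < n.+1`!%:R :> R by rewrite ltr0n fact_gt0.
  move=> h; have : (x / 2) ^+ n.+1 / n.+1`!%:R <= expR (x / 2) by lra.
  by rewrite ler_pdivrMr// expr_div_n ler_pdivrMr ?exprn_gt0//; lra.
apply: (@le_lt_trans _ _ (C%:E * gint t 2^-1)%E); last first.
  by rewrite lte_mul_pinfty ?lee_fin// gint_fin01// invr_gt0.
rewrite /gint -ge0_integralZl_EFin//; last 2 first.
- by move=> x _; rewrite lee_fin mulr_ge0 ?expR_ge0 ?powR_ge0.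
- by apply/measurable_EFinP; apply: measurable_funTS; mfun.
apply: ge0_le_integral => //.
- by move=> x _; rewrite lee_fin mulr_ge0 ?expR_ge0 ?powR_ge0.
- by apply/measurable_EFinP; apply: measurable_funTS; mfun.
- by apply/measurable_EFinP; apply: measurable_funTS; mfun.
move=> x; rewrite /= in_itv/= andbT => x0; rewrite -EFinM lee_fin.
have -> : x `^ (n%:R + t - 1) = x ^+ n * x `^ (t - 1).
  by rewrite -powR_mulrn ?(ltW x0)// -powRD ?(gt_eqF x0) ?implybT//; congr powR; ring.
have -> : expR (- (1 * x)) = expR (- (2^-1 * x)) * expR (- (x / 2)).
  by rewrite -expRD; congr expR; field.
have e1 : expR (- (x / 2)) * x ^+ n <= C.
  by rewrite expRN ler_pdivrMl ?expR_gt0// mulrC HC.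
have := ler_wpM2r (mulr_ge0 (expR_ge0 (- (2^-1 * x))) (powR_ge0 x (t - 1))) e1; lra.
Qed.

Lemma gint_gt0 s : 0 < s -> (0 < gint s 1)%E.
Proof.
move=> s0.
(* On [1, 2] one has e^-x >= e^-2 and x^(s - 1) >= x^-1 >= 1/2. *)
apply: (@lt_le_trans _ _ (\int[mu]_(x in `[1%R, 2%R]) cst (expR (- 2) / 2)%:E x)%E).
  rewrite integral_cst//= lebesgue_measure_itv/= lte_fin ltr1n -EFinB -EFinM lte_fin.
  by rewrite mulr_gt0 ?divr_gt0 ?expR_gt0//; lra.
apply: (@le_trans _ _ (\int[mu]_(x in `[1%R, 2%R]) (expR (- (1 * x)) * x `^ (s - 1))%:E)%E).
  apply: ge0_le_integral => //.
  - by move=> x _; rewrite lee_fin divr_ge0 ?expR_ge0.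
  - by apply/measurable_EFinP; apply: measurable_funTS; mfun.
  - move=> x; rewrite /= in_itv/= => /andP[x1 x2]; rewrite lee_fin mul1r ler_pM ?expR_ge0//.
      by rewrite ler_expR lerN2.
    apply: (@le_trans _ _ (x `^ (-1))); last by rewrite ler_powR//; lra.
    by rewrite powR_inv1 ?(le_trans _ x1)// lef_pV2 ?posrE// (lt_le_trans _ x1).
apply: ge0_subset_integral => //.
- by apply/measurable_EFinP; apply: measurable_funTS; mfun.
- by move=> x _; rewrite lee_fin mulr_ge0 ?expR_ge0 ?powR_ge0.
- by apply: subset_itv; rewrite bnd_simp.
Qed.

Lemma gintE (n : nat) (t : R) : 0 < t <= 1 -> gint (n%:R + t) 1 = (Gamma_fun (n%:R + t))%:E.
Proof.
move=> t01; rewrite /Gamma_fun /Rintegral.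
rewrite (_ : (\int[mu]_(x in `]0%R, +oo[) (expR (- x) * x `^ (n%:R + t - 1))%:E)%E = gint (n%:R + t) 1); last first.
  by apply: eq_integral => x _; rewrite mul1r.
by rewrite fineK// ge0_fin_numE ?gint_ge0// gint_fin.
Qed.

Lemma Gamma_fun_gt0 (n : nat) (t : R) : 0 < t <= 1 -> 0 < Gamma_fun (n%:R + t) :> R.
Proof.
move=> t01; rewrite -lte_fin -gintE// gint_gt0//.
by have /andP[t0 _] := t01; rewrite ltr_wpDl.
Qed.

Lemma gint_Gamma (n : nat) (t c : R) : 0 < t <= 1 -> 0 < c ->
  gint (n%:R + t) c = (c `^ (- (n%:R + t)) * Gamma_fun (n%:R + t))%:E.
Proof. by move=> t01 c0; rewrite gint_scale// gintE// -EFinM. Qed.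

End gamma_integrals.

(** * Power integrals over [1, +oo[ *)

Section powR_tails.
Context {R : realType}.
Local Notation mu := (@lebesgue_measure R).

Lemma invr_cvgy0 : x^-1 @[x --> +oo] --> (0 : R).
Proof. apply/gtr0_cvgV0; [exact: nbhs_pinfty_gt|exact: cvg_id]. Qed.

Lemma is_derive_invr (x : R) : 0 < x -> is_derive x 1 (fun y : R => y^-1) (- x ^- 2).
Proof.
move=> x0; have h : is_derive x 1 (fun y : R => y^-1) (- x ^- 2 *: (1 : R)).
  by apply: (@is_deriveV _ (fun y : R => y)); rewrite gt_eqF.
by apply: (is_derive_eq h); rewrite /GRing.scale/= mulr1.
Qed.

Lemma integral_tail_pow (n : nat) :
  (\int[mu]_(y in `[1%R, +oo[) (y ^- n.+2)%:E = (n.+1%:R^-1)%:E)%E.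
Proof.
have dF (y : R) : 1 <= y -> is_derive y 1 (fun z => - n.+1%:R^-1 * z^-1 ^+ n.+1) (y ^- n.+2).
  move=> y1; have y0 : 0 < y by exact: lt_le_trans y1.
  have h := is_derive_invr y0.
  have h2 : is_derive y 1 (fun z : R => z^-1 ^+ n.+1) ((n.+1%:R * y^-1 ^+ n) *: - y ^- 2).
    have -> : (fun z : R => z^-1 ^+ n.+1) = (fun z : R => z^-1) ^+ n.+1.
      by apply/funext => z; rewrite exprfctE.
    exact: is_deriveX.
  apply: is_derive_eq; rewrite /GRing.scale/=.
  rewrite -!exprVn !exprS expr0; have : (n.+1%:R : R) != 0 by [].
  move: (n.+1%:R) => m m0; move: (y^-1) => z; field; exact: m0.
rewrite (ge0_integral_is_derivey _ dF (l := 0)) => [|y y1|y y1|].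
- by rewrite invr1 expr1n mulr1 sub0e -EFinN opprK.
- by rewrite invr_ge0 exprn_ge0// (le_trans _ y1).
- apply: cvgV; first by rewrite expf_neq0// gt_eqF// (lt_le_trans _ y1).
  exact: exprn_continuous.
- rewrite -[X in _ --> X](mulr0 (- n.+1%:R^-1)); apply: cvgM; first exact: cvg_cst.
  have -> : (0 : R) = 0 ^+ n.+1 by rewrite expr0n.
  by apply: (@cvg_comp _ _ _ (fun x : R => x^-1) (fun z : R => z ^+ n.+1) _ _ _ invr_cvgy0); exact: exprn_continuous.
Qed.

(** The integrand equals y^-2 (1 + lam / y)^(alpha - 1), so a multiple of (1 + lam / y)^alpha is a
    primitive. *)
Lemma integral_tail_powR (alpha lam : R) : 0 < alpha -> 0 < lam ->
  (\int[mu]_(y in `[1%R, +oo[) (y `^ (- (alpha + 1)) * (lam + y) `^ (- (1 - alpha)))%:E =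
   (((1 + lam) `^ alpha - 1) / (alpha * lam))%:E)%E.
Proof.
move=> a0 l0; pose F (z : R) := - (alpha * lam)^-1 * (1 + lam * z^-1) `^ alpha.
have p0 (y : R) : 1 <= y -> 0 < 1 + lam * y^-1.
  by move=> y1; rewrite ltr_pwDl// mulr_ge0 ?(ltW l0)// invr_ge0 (le_trans _ y1).
have dF (y : R) : 1 <= y -> is_derive y 1 F (y `^ (- (alpha + 1)) * (lam + y) `^ (- (1 - alpha))).
  move=> y1; have y0 : 0 < y by exact: lt_le_trans y1.
  have h := is_derive_invr y0.
  have h1 : is_derive y 1 (fun z : R => 1 + lam * z^-1) (lam * (- y ^- 2)).
    by apply: is_derive_eq; rewrite /GRing.scale/= add0r mul1r.
  have h2 := @is_derive1_comp _ (fun u : R => u `^ alpha) _ y _ _ (is_derive1_powR alpha (p0 y y1)) h1.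
  have h3 : is_derive y 1 (fun z : R => (1 + lam * z^-1) `^ alpha) (alpha * (1 + lam * y^-1) `^ (alpha - 1) * (lam * (- y ^- 2))).
    exact: h2.
  rewrite /F; apply: is_derive_eq; rewrite /GRing.scale/=.
  have -> : lam + y = y * (1 + lam * y^-1) by field; rewrite gt_eqF.
  rewrite powRM ?(ltW y0) ?(ltW (p0 y y1))// [RHS]mulrA -powRD ?(gt_eqF y0) ?implybT//.
  have -> : - (alpha + 1) - (1 - alpha) = - 2%:R by ring.
  rewrite powRN powR_mulrn ?(ltW y0)// (_ : - (1 - alpha) = alpha - 1); last by ring.
  by move: (_ `^ (alpha - 1)) => p; field; rewrite !gt_eqF.
rewrite (ge0_integral_is_derivey _ dF (l := - (alpha * lam)^-1)) => [|y y1|y y1|].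
- by rewrite /F invr1 mulr1 -EFinB; congr EFin; ring.
- by rewrite mulr_ge0 ?powR_ge0.
- have y0 : 0 < y by exact: lt_le_trans y1.
  apply: cvgM; first exact: powR_continuous.
  apply: (@continuous_comp _ _ _ (fun y : R => lam + y) (fun y : R => y `^ _)).
    by apply: cvgD; [exact: cvg_cst|exact: cvg_id].
  by apply: powR_continuous; rewrite addr_gt0.
- rewrite /F -[X in _ --> X](mulr1 (- (alpha * lam)^-1)); apply: cvgM; first exact: cvg_cst.
  have h : 1 + lam * x^-1 @[x --> +oo] --> (1 : R).
    rewrite -[X in _ --> X]addr0 -[X in _ --> _ + X](mulr0 lam).
    by apply: cvgD; [exact: cvg_cst|apply: cvgM; [exact: cvg_cst|exact: invr_cvgy0]].
  have {2}-> : (1 : R) = 1 `^ alpha by rewrite powR1.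
  by apply: (@cvg_comp _ _ _ (fun x : R => 1 + lam * x^-1) (fun z : R => z `^ alpha) _ _ _ h); exact: powR_continuous.
Qed.

End powR_tails.

Section density_prob.
Context {R : realType}.
Local Notation mu := (@lebesgue_measure R).
Variable f : R -> R.

(** The proofs about f are arguments of the set function itself, so that its measure and probability
    structures can be inferred from the term. *)
Definition density_prob (mf : measurable_fun setT f) (f0 : forall x, 0 <= f x)
    (f1 : (\int[mu]_x (f x)%:E = 1)%E) (B : set (measurableTypeR R)) : \bar R :=
  (\int[mu]_(x in B) (f x)%:E)%E.

Hypotheses (mf : measurable_fun setT f) (f0 : forall x, 0 <= f x)
  (f1 : (\int[mu]_x (f x)%:E = 1)%E).
Local Notation Q := (density_prob mf f0 f1).

Let Q_set0 : Q set0 = 0%E.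
Proof. by rewrite /density_prob integral_set0. Qed.

Let Q_ge0 B : (0 <= Q B)%E.
Proof. by apply: integral_ge0 => x _; rewrite lee_fin. Qed.

Let Q_sigma_additive : semi_sigma_additive Q.
Proof.
move=> /= F mF tF mUF; rewrite /density_prob; apply: cvg_toP.
  apply: ereal_nondecreasing_is_cvgn => m n mn.
  apply: lee_sum_nneg_natr => // k _ _.
  by apply: integral_ge0 => x _; rewrite lee_fin.
rewrite ge0_integral_bigcup//=.
- by apply/measurable_EFinP; exact: measurable_funTS.
- by move=> x _; rewrite lee_fin.
Qed.

HB.instance Definition _ := isMeasure.Build _ _ _ Q Q_set0 Q_ge0 Q_sigma_additive.

HB.instance Definition _ := @Measure_isProbability.Build _ _ R Q f1.

Lemma has_density_id : has_density Q (id : R -> R) f.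
Proof. by split. Qed.

End density_prob.

(** * Moments and Laplace transform of [f_Gamma] *)

Section f_Gamma_integrals.
Context {R : realType}.
Local Notation mu := (@lebesgue_measure R).
Variable alpha : R.
Hypotheses (alpha_gt0 : 0 < alpha) (alpha_lt1 : alpha < 1).

Let b01 : 0 < 1 - alpha <= 1. Proof. by move: alpha_gt0 alpha_lt1 => ? ?; apply/andP; split; lra. Qed.

Lemma f_Gamma_ge0 x : 0 <= f_Gamma alpha x.
Proof.
have := @Gamma_fun_gt0 R 0 _ b01; rewrite add0r => G0.
rewrite /f_Gamma !mulr_ge0 ?invr_ge0 ?powR_ge0 ?(ltW G0)//.
by apply: Rintegral_ge0 => y _; rewrite divr_ge0 ?expR_ge0 ?powR_ge0.
Qed.

Lemma measurable_f_Gamma : measurable_fun setT (f_Gamma alpha).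
Proof.
apply: measurable_funM; last exact: measurable_indic.
apply: measurable_funM; first by mfun.
have h : measurable_fun setT (fun x : R => \int[mu]_(y in `[1%R, +oo[) (expR (- x * y) / y `^ (alpha + 1))%:E)%E.
  apply: (@measurable_integral_on _ _ (measurableTypeR R) (measurableTypeR R) R mu `[1%R, +oo[%classic setT (fun (y x : R) => expR (- x * y) / y `^ (alpha + 1))) => //.
  - by apply: measurable_funTS; mfun.
  - by move=> y x _ _; rewrite divr_ge0 ?expR_ge0 ?powR_ge0.
exact: (measurableT_comp (fine_measurable measurableT) h).
Qed.

Lemma f_Gamma_tail_fin (x : R) : 0 < x ->
  ((\int[mu]_(y in `[1%R, +oo[) (expR (- x * y) / y `^ (alpha + 1))%:E) \is a fin_num)%E.
Proof.
move=> x0; rewrite ge0_fin_numE; last first.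
  by apply: integral_ge0 => y _; rewrite lee_fin divr_ge0 ?expR_ge0 ?powR_ge0.
apply: (@le_lt_trans _ _ (\int[mu]_(y in `[1%R, +oo[) (expR (- (x * y)))%:E)%E).
  apply: ge0_le_integral => //.
  - by move=> y _; rewrite lee_fin divr_ge0 ?expR_ge0 ?powR_ge0.
  - by apply/measurable_EFinP; apply: measurable_funTS; mfun.
  - by apply/measurable_EFinP; apply: measurable_funTS; mfun.
  - move=> y; rewrite /= in_itv/= andbT => y1; rewrite lee_fin mulNr.
    rewrite ler_pdivrMr ?powR_gt0 ?(lt_le_trans _ y1)// ler_peMr ?expR_ge0//.
    by rewrite -[leLHS](powRr0 y) ler_powR// addr_ge0// ltW.
apply: (@le_lt_trans _ _ (\int[mu]_(y in `[0%R, +oo[) (expR (- (x * y)))%:E)%E).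
  apply: ge0_subset_integral => //.
  - by apply/measurable_EFinP; apply: measurable_funTS; mfun.
  - by apply: subset_itv; rewrite bnd_simp.
by rewrite integral_expRN// ltry.
Qed.

(** One Tonelli argument serves both the moments (lam = 0) and the Laplace transform (n = 0):
    integrating in x first leaves a gamma integral of exponent n + 1 - alpha at rate lam + y. *)
Lemma f_Gamma_integral (n : nat) (lam : R) : 0 <= lam ->
  (\int[mu]_x (f_Gamma alpha x * (`|x| ^+ n * expR (- (lam * x))))%:E =
   (Gamma_fun (n%:R + (1 - alpha)) / Gamma_fun (1 - alpha))%:E *
   \int[mu]_(y in `[1%R, +oo[) (y `^ (- (alpha + 1)) * (lam + y) `^ (- (n%:R + (1 - alpha))))%:E)%E.
Proof.
move=> l0.
have := @Gamma_fun_gt0 R 0 _ b01; rewrite add0r => G0.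
have Gn := @Gamma_fun_gt0 R n _ b01.
have iG0 : 0 <= (Gamma_fun (1 - alpha))^-1 :> R by rewrite invr_ge0 ltW.
have iGy y : 0 <= (Gamma_fun (1 - alpha))^-1 * y `^ (- (alpha + 1)) :> R.
  exact: mulr_ge0 iG0 (powR_ge0 _ _).
pose k (x y : R) := (Gamma_fun (1 - alpha))^-1 * y `^ (- (alpha + 1)) *
  (expR (- ((lam + y) * x)) * x `^ (n%:R + (1 - alpha) - 1)).
have k0 x y : 0 <= k x y.
  exact: mulr_ge0 (iGy y) (mulr_ge0 (expR_ge0 _) (powR_ge0 _ _)).
transitivity (\int[mu]_(x in `]0%R, +oo[) \int[mu]_(y in `[1%R, +oo[) (k x y)%:E)%E.
  rewrite [RHS]integral_mkcond; apply: eq_integral => x _; rewrite patchE.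
  case: ifPn => [|xN]; last first.
    (* The indicator in [f_Gamma] includes x = 0, but the factor (0^alpha)^-1 is 0 by convention. *)
    rewrite /f_Gamma indicE; have [->|x0] := eqVneq x 0.
      by rewrite powR0 ?gt_eqF// invr0 mulr0 !mul0r.
    rewrite memNset ?mulr0 ?mul0r//= in_itv/= andbT => x1.
    by move: xN; rewrite notin_setE/= in_itv/= andbT lt_neqAle eq_sym x0 x1.
  rewrite inE/= in_itv/= andbT => x0.
  rewrite /f_Gamma indicE mem_set ?mulr1; last by rewrite /= in_itv/= andbT ltW.
  rewrite ger0_norm ?(ltW x0)// /Rintegral.
  set I := (\int[mu]_(y in _) _)%E.
  have If : I \is a fin_num by exact: f_Gamma_tail_fin.
  have -> : (Gamma_fun (1 - alpha))^-1 / x `^ alpha * fine I * (x ^+ n * expR (- (lam * x))) =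
            ((Gamma_fun (1 - alpha))^-1 / x `^ alpha * (x ^+ n * expR (- (lam * x)))) * fine I by ring.
  rewrite EFinM fineK// /I -ge0_integralZl_EFin//; last first.
  - apply: mulr_ge0; last by rewrite mulr_ge0 ?expR_ge0 ?exprn_ge0 ?ltW.
    by apply: (mulr_ge0 iG0); rewrite invr_ge0 powR_ge0.
  - by apply/measurable_EFinP; apply: measurable_funTS; mfun.
  - by move=> y _; rewrite lee_fin divr_ge0 ?expR_ge0 ?powR_ge0.
  apply: eq_integral => y _; rewrite -EFinM; congr EFin; rewrite /k.
  have -> : x `^ (n%:R + (1 - alpha) - 1) = x ^+ n / x `^ alpha.
    rewrite -powR_mulrn ?(ltW x0)// -powRN -powRD ?(gt_eqF x0) ?implybT//.
    by congr powR; ring.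
  have -> : expR (- ((lam + y) * x)) = expR (- (lam * x)) * expR (- x * y).
    by rewrite -expRD; congr expR; ring.
  rewrite powRN; ring.
rewrite (@tonelli_on _ _ _ _ R mu mu `]0%R, +oo[%classic `[1%R, +oo[%classic k)//; last first.
  by apply: measurable_funTS; rewrite /k; mfun.
rewrite -ge0_integralZl_EFin//; last first.
- by rewrite divr_ge0 ?ltW.
- by apply/measurable_EFinP; apply: measurable_funTS; mfun.
- by move=> y _; rewrite lee_fin mulr_ge0 ?powR_ge0.
apply: eq_integral => y; rewrite inE/= in_itv/= andbT => y1.
have ly0 : 0 < lam + y by rewrite ltr_wpDl// (lt_le_trans _ y1).
rewrite /k; under eq_integral do rewrite EFinM.
rewrite ge0_integralZl_EFin//.
- rewrite -/(gint _ _) gint_Gamma// -!EFinM; congr EFin; ring.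
- by move=> x _; rewrite lee_fin mulr_ge0 ?expR_ge0 ?powR_ge0.
- by apply/measurable_EFinP; apply: measurable_funTS; mfun.
Qed.

Lemma f_Gamma_moment (n : nat) :
  (\int[mu]_x (f_Gamma alpha x * `|x| ^+ n)%:E =
   (Gamma_fun (n%:R + (1 - alpha)) / Gamma_fun (1 - alpha) * n.+1%:R^-1)%:E)%E.
Proof.
have := @f_Gamma_integral n 0 (lexx _).
under eq_integral do rewrite mul0r oppr0 expR0 mulr1.
move=> ->; rewrite [RHS]EFinM -integral_tail_pow; congr (_ * _)%E.
apply: eq_integral => y; rewrite inE/= in_itv/= andbT => y1.
have y0 : 0 < y by exact: lt_le_trans y1.
rewrite add0r -powRD ?(gt_eqF y0) ?implybT// -powR_mulrn ?(ltW y0)// -powRN.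
by congr (_ `^ _)%:E; rewrite -[in RHS]addn2 natrD; ring.
Qed.

Lemma f_Gamma_mass : (\int[mu]_x (f_Gamma alpha x)%:E = 1)%E.
Proof.
have := f_Gamma_moment 0; under eq_integral do rewrite expr0 mulr1.
move=> ->; have := @Gamma_fun_gt0 R 0 _ b01; rewrite add0r => G0.
by rewrite invr1 mulr1 divff// gt_eqF.
Qed.

Lemma f_Gamma_laplace (lam : R) : 0 < lam ->
  (\int[mu]_x (f_Gamma alpha x * expR (- (lam * x)))%:E =
   (((1 + lam) `^ alpha - 1) / (alpha * lam))%:E)%E.
Proof.
move=> l0; have := @f_Gamma_integral 0 lam (ltW l0).
under eq_integral do rewrite expr0 mul1r.
move=> ->; have := @Gamma_fun_gt0 R 0 _ b01; rewrite add0r => G0.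
rewrite divff ?gt_eqF// mul1e -integral_tail_powR//.
Qed.

End f_Gamma_integrals.

(** * Gamma and uniform variables *)

Section gamma_and_uniform_laws.
Context {R : realType} d (T : measurableType d) (Q : probability T R).
Local Notation mu := (@lebesgue_measure R).

Lemma gamma_var_gt0 (t : R) (g : {RV Q >-> R}) :
  is_gamma_var Q t g -> {ae Q, forall w, 0 < g w}.
Proof.
move=> [mf f0 gf].
have h : {ae Q, forall w, ~ `]-oo, 0]%classic (g w)}.
  apply: probability0_ae => //; rewrite gf//.
  apply: integral0_eq => x; rewrite /= in_itv/= => x0.
  by rewrite indicE memNset ?mulr0//= in_itv/= andbT ltNge x0.
by apply: filterS h => w /=; rewrite in_itv/= => /negP; rewrite -ltNge.
Qed.

(** As with [f_Gamma_integral], c = 0 gives the moments and n = 0 the Laplace transform. *)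
Lemma gamma_var_integral (n : nat) (t c : R) (g : {RV Q >-> R}) : 0 < t <= 1 -> 0 <= c ->
  is_gamma_var Q t g ->
  (\int[Q]_w (`|g w| ^+ n * expR (- (c * g w)))%:E =
   (Gamma_fun (n%:R + t) / Gamma_fun t * (1 + c) `^ (- (n%:R + t)))%:E)%E.
Proof.
move=> t01 c0 gt.
have := @Gamma_fun_gt0 R 0 _ t01; rewrite add0r => G0.
rewrite (@integral_density _ _ _ Q g _ (fun x => `|x| ^+ n * expR (- (c * x))) _ gt)//.
- transitivity ((Gamma_fun t)^-1%:E * gint (n%:R + t) (1 + c))%E.
    rewrite /gint -ge0_integralZl_EFin ?invr_ge0 ?(ltW G0)//.
    + rewrite [RHS]integral_mkcond; apply: eq_integral => x _; rewrite patchE indicE.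
      case: ifPn => [|_]; last by rewrite mulr0 mul0r.
      rewrite inE/= in_itv/= andbT => x0; rewrite mulr1 -EFinM ger0_norm ?(ltW x0)//; congr EFin.
      have -> : x `^ (n%:R + t - 1) = x ^+ n * x `^ (t - 1).
        rewrite -powR_mulrn ?(ltW x0)// -powRD ?(gt_eqF x0) ?implybT//.
        by congr powR; ring.
      have -> : expR (- ((1 + c) * x)) = expR (- x) * expR (- (c * x)).
        by rewrite -expRD; congr expR; ring.
      by ring.
    + by move=> x _; rewrite lee_fin mulr_ge0 ?expR_ge0 ?powR_ge0.
    + by apply/measurable_EFinP; apply: measurable_funTS; mfun.
  rewrite gint_Gamma//; last by rewrite ltr_wpDr.
  by rewrite -EFinM; congr EFin; ring.
- apply: measurable_funM; last by mfun.
  by apply: measurable_funX; exact: normr_measurable.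
Qed.

Lemma uniform01_eq_law (U : T -> R) :
  is_uniform01 Q U <-> eq_law Q U (uniform_prob (@ltr01 R)) (id : R -> R).
Proof. by split. Qed.

Lemma uniform01_itv (U : T -> R) : measurable_fun setT U -> is_uniform01 Q U ->
  {ae Q, forall w, 0 <= U w <= 1}.
Proof.
move=> mU hU; have h : {ae Q, forall w, ~ (~` `[0, 1]%classic) (U w)}.
  apply: probability0_ae => //; first by apply: measurableC; exact: measurable_itv.
  rewrite hU; last by apply: measurableC; exact: measurable_itv.
  by rewrite /uniform_prob integral_uniform_pdf setICl integral_set0.
by apply: filterS h => w /contrapT /=; rewrite in_itv.
Qed.

Lemma expr1D_ge (x : R) (n : nat) : 0 <= x -> n%:R * x <= (1 + x) ^+ n.
Proof.
move=> x0; elim: n => [|n IH]; first by rewrite mul0r.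
rewrite exprS -natr1 mulrDl mul1r mulrDl [in leRHS]mul1r lerD// ler_peMr//.
by rewrite exprn_ege1// lerDl.
Qed.

(** Markov's inequality: if |X| > 1 + 1 / (k + 1) had probability q > 0, the moment of order n would
    be at least (1 + 1 / (k + 1))^n q, which is unbounded in n. *)
Lemma ae_norm_le1 (X : {RV Q >-> R}) :
  (forall n : nat, \int[Q]_w (`|X w| ^+ n)%:E <= 1)%E -> {ae Q, forall w, `|X w| <= 1}.
Proof.
move=> hX.
pose B (k : nat) : set R := `]1 + k.+1%:R^-1, +oo[%classic.
have mX : measurable_fun setT (fun w => `|X w|) by exact: measurableT_comp.
have QB k : {ae Q, forall w, ~ B k `|X w|}.
  apply: (probability0_ae mX (measurable_itv _)).
  set A := _ @^-1` _; have mA : measurable A.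
    by apply: measurable_preimage => //; exact: measurable_itv.
  have pf : Q A \is a fin_num by rewrite fin_num_measure.
  have p0 : (0 <= Q A)%E by [].
  have e0 : 0 < k.+1%:R^-1 :> R by rewrite invr_gt0.
  suff : fine (Q A) <= 0.
    by move=> h; apply/eqP; rewrite eq_le p0 andbT -(fineK pf) lee_fin.
  rewrite leNgt; apply/negP => q0.
  (* Chosen so that n / (k + 1) > 1 / q for q the probability of [A]; by [expr1D_ge] the bound [key]
     is then violated. *)
  pose n := (Num.truncn (k.+1%:R / fine (Q A))).+1.
  have key : (1 + k.+1%:R^-1) ^+ n * fine (Q A) <= 1.
    rewrite -lee_fin EFinM fineK//; apply: le_trans (hX n).
    rewrite -[X in (_ * Q X)%E](setIT A) -integral_indic//.
    rewrite -ge0_integralZl_EFin ?exprn_ge0 ?addr_ge0//.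
    apply: ge0_le_integral => //.
    - by apply: emeasurable_funM => //; apply/measurable_EFinP; exact: measurable_indic.
    - by apply/measurable_EFinP; exact: measurable_funX.
    move=> w _; rewrite -EFinM lee_fin indicE; case: (boolP (w \in A)) => [|_]; last by rewrite mulr0 exprn_ge0.
    rewrite inE /A /B /= in_itv/= andbT mulr1 => h.
    by rewrite lerXn2r ?nnegrE ?addr_ge0// ltW.
    by apply/measurable_EFinP; exact: measurable_indic.
  have := le_trans (ler_wpM2r (ltW q0) (expr1D_ge n (ltW e0))) key.
  apply/negP; rewrite -ltNge.
  rewrite -ltr_pdivrMr// mul1r ltr_pdivlMr// mulrC; exact: truncnS_gt.
have : {ae Q, forall w, forall k, ~ B k `|X w|} by apply: ae_foralln => k; exact: QB.
apply: filterS => w h; rewrite leNgt; apply/negP => w1.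
have p0 : 0 < `|X w| - 1 by rewrite subr_gt0.
apply: (h (Num.truncn (`|X w| - 1)^-1)); rewrite /B/= in_itv/= andbT -ltrBrDl.
by rewrite -[ltRHS]invrK ltf_pV2 ?posrE ?invr_gt0// truncnS_gt.
Qed.

Lemma uniform_moment (n : nat) :
  (\int[uniform_prob (@ltr01 R)]_x (`|x| ^+ n)%:E = (n.+1%:R^-1)%:E)%E.
Proof.
rewrite (@integral_uniform R 0 1 ltr01 (fun x => (`|x| ^+ n)%:E)).
- rewrite subr0 invr1 mul1e.
  have dF (x : R) : is_derive x 1 (fun y : R => n.+1%:R^-1 * y ^+ n.+1) (x ^+ n).
    have h : is_derive x 1 (fun z : R => z ^+ n.+1) ((n.+1%:R * x ^+ n) *: 1).
      have -> : (fun z : R => z ^+ n.+1) = (fun z : R => z) ^+ n.+1.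
        by apply/funext => z; rewrite exprfctE.
      exact: is_deriveX.
    apply: is_derive_eq; rewrite /GRing.scale/= mulr1 mulrA mulVf ?mul1r//.
  transitivity (\int[mu]_(x in `[0%R, 1%R]) (x ^+ n)%:E)%E.
    by apply: eq_integral => x; rewrite inE/= in_itv/= => /andP[x0 _]; rewrite ger0_norm.
  rewrite (integral_is_derive ltr01 (fun x _ => dF x)) => [|x _].
  + by rewrite expr1n expr0n mulr1 mulr0 sube0.
  + exact: exprn_continuous.
- by apply/measurable_EFinP; apply: measurable_funX; exact: normr_measurable.
- by move=> x; rewrite lee_fin exprn_ge0.
Qed.

End gamma_and_uniform_laws.

(** * The laws of Gamma and D at time 1 - alpha *)

Section part2.
Context {R : realType}.
Local Notation mu := (@lebesgue_measure R).
Variable alpha : R.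
Hypotheses (alpha_gt0 : 0 < alpha) (alpha_lt1 : alpha < 1).

Let b01 : 0 < 1 - alpha <= 1.
Proof. by move: alpha_gt0 alpha_lt1 => ? ?; apply/andP; split; lra. Qed.

Lemma subordinator_ge0 d (T : measurableType d) (P : probability T R) (X : R -> {RV P >-> R}) (t : R) :
  subordinator X -> 0 <= t -> {ae P, forall w, 0 <= X t w}.
Proof.
move=> [X0 _ _ Xp] t0; apply: filterS2 X0 Xp => w X00 [Xm _].
by rewrite -X00 Xm.
Qed.

Context d1 (T1 : measurableType d1) (P1 : probability T1 R) (G : {RV P1 >-> R})
  d2 (T2 : measurableType d2) (P2 : probability T2 R) (Gam : R -> {RV P2 >-> R}).
Hypotheses (G_density : has_density P1 G (f_G alpha)) (Gam_sub : is_Gamma_inv G Gam).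

Lemma laplace_Gam (lam t : R) : 0 < lam -> 0 <= t ->
  (\int[P2]_w (expR (- (lam * Gam t w)))%:E = (expR (- (t * Psi alpha lam)))%:E)%E.
Proof.
move=> l0 t0; rewrite -(laplace_Gamma_inv alpha_gt0 alpha_lt1 G_density Gam_sub l0 t0) unlock.
by apply: eq_integral => w _; rewrite mulNr.
Qed.

Lemma laplace_Gam_1Balpha (lam : R) : 0 < lam ->
  (\int[P2]_w (expR (- (lam * Gam (1 - alpha) w)))%:E = (((1 + lam) `^ alpha - 1) / (alpha * lam))%:E)%E.
Proof.
move=> l0; have /andP[b0 _] := b01; rewrite laplace_Gam ?(ltW b0)//; congr EFin.
rewrite expR_Psi// divff ?gt_eqF// powRr1; first by field; rewrite !gt_eqF.
by rewrite mulr_ge0 ?invr_ge0 ?divr_ge0 ?(ltW alpha_gt0) ?(ltW l0)// ltW// powR_sub1_gt0.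
Qed.

Let Gam_ge0 : {ae P2, forall w, 0 <= Gam (1 - alpha) w}.
Proof.
have [Gs _] := Gam_sub; apply: subordinator_ge0 => //.
by have /andP[/ltW] := b01.
Qed.

(** The reference variable is the identity on the line under the probability with density [f_Gamma];
    it has the Laplace transform of part 1 at t = 1 - alpha. *)
Lemma Gam_density : has_density P2 (Gam (1 - alpha)) (f_Gamma alpha).
Proof.
split; [exact: measurable_f_Gamma|exact: f_Gamma_ge0|].
suff key (Q : probability (measurableTypeR R) R) :
    has_density Q (id : R -> R) (f_Gamma alpha) -> eq_law P2 (Gam (1 - alpha)) Q (id : R -> R).
  exact: (key _ (has_density_id (measurable_f_Gamma alpha)
    (f_Gamma_ge0 alpha_gt0 alpha_lt1) (f_Gamma_mass alpha_gt0 alpha_lt1))).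
move=> Qd.
apply: laplace_eq_law => //.
- have : {ae Q, forall w, ~ `]-oo, 0[%classic w}.
    apply: (@probability0_ae _ _ _ Q (id : R -> R)) => //.
    case: Qd => _ _ ->//; apply: integral0_eq => x; rewrite /= in_itv/= => x0.
    by rewrite /f_Gamma indicE memNset ?mulr0//= in_itv/= andbT leNgt x0.
  by apply: (@filterS _ _ (ae_filter_ringOfSetsType Q)) => x /=; rewrite in_itv/= => /negP; rewrite -leNgt.
- move=> lam l0; rewrite laplace_Gam_1Balpha//.
  rewrite (@integral_density _ _ _ Q (id : R -> R) _ (fun x => expR (- (lam * x))) _ Qd)//; last by mfun.
  by rewrite f_Gamma_laplace.
Qed.

(** Given U = u, the gamma factor yields (1 + lam u)^(alpha - 1), and the integral of this over
    [0, 1] is elementary. *)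
Lemma Gam_eq_law_gU d (T : measurableType d) (Q : probability T R) (g U : {RV Q >-> R}) :
  is_gamma_var Q (1 - alpha) g -> is_uniform01 Q U -> independent Q g U ->
  eq_law P2 (Gam (1 - alpha)) Q (g \* U).
Proof.
move=> hg hU gU.
have mg : measurable_fun setT g by []; have mU : measurable_fun setT U by [].
have mgU : measurable_fun setT (g \* U) by exact: measurable_funM.
apply: laplace_eq_law => //.
  apply: filterS2 (gamma_var_gt0 hg) (uniform01_itv mU hU) => w g0 /andP[u0 _].
  by rewrite mulr_ge0// ltW.
move=> lam l0; rewrite laplace_Gam_1Balpha//.
rewrite (@independent_integral _ _ _ Q g U (fun x y => expR (- (lam * (x * y)))))//; last by mfun.
transitivity (\int[Q]_w \int[mu]_(u in `[0%R, 1%R]) (expR (- (lam * u * g w)))%:E)%E; last first.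
  apply: eq_integral => w _.
  have /uniform01_eq_law hU' := hU.
  rewrite (@integral_eq_law _ _ _ Q _ _ (uniform_prob (@ltr01 R)) U (id : R -> R) (fun y => expR (- (lam * (g w * y)))) _ _ hU')//.
  - rewrite (@integral_uniform R 0 1 ltr01 (fun x => (expR (- (lam * (g w * x))))%:E)).
    + rewrite subr0 invr1 mul1e; apply: eq_integral => u _; congr (expR _)%:E; ring.
    + by apply/measurable_EFinP; mfun.
    + by move=> x; rewrite lee_fin expR_ge0.
  - by mfun.
rewrite (@tonelli_on _ _ _ _ R Q mu setT `[0%R, 1%R]%classic (fun w u => expR (- (lam * u * g w))))//; last first.
  apply: measurable_funTS.
  have mg1 : measurable_fun [set: T * R] (fun z => g z.1) by exact: measurableT_comp.
  by mfun.
transitivity (\int[mu]_(u in `[0%R, 1%R]) ((1 + lam * u) `^ (- (1 - alpha)))%:E)%E; last first.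
  apply: eq_integral => u; rewrite inE/= in_itv/= => /andP[u0 _].
  have := gamma_var_integral 0 b01 (mulr_ge0 (ltW l0) u0) hg.
  under eq_integral do rewrite expr0 mul1r.
  rewrite add0r divff; last first.
    by have := @Gamma_fun_gt0 R 0 _ b01; rewrite add0r => /gt_eqF ->.
  by rewrite mul1r.
pose F (u : R) := (alpha * lam)^-1 * (1 + lam * u) `^ alpha.
have p0 (u : R) : 0 <= u -> 0 < 1 + lam * u by move=> u0; rewrite ltr_pwDl// mulr_ge0// ltW.
have dF (u : R) : 0 <= u -> is_derive u 1 F ((1 + lam * u) `^ (- (1 - alpha))).
  move=> u0.
  have h1 : is_derive u 1 (fun z : R => 1 + lam * z) lam.
    by apply: is_derive_eq; rewrite /GRing.scale/=; ring.
  have h2 := @is_derive1_comp _ (fun u : R => u `^ alpha) _ u _ _ (is_derive1_powR alpha (p0 u u0)) h1.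
  have h3 : is_derive u 1 (fun z : R => (1 + lam * z) `^ alpha) (alpha * (1 + lam * u) `^ (alpha - 1) * lam).
    exact: h2.
  rewrite /F; apply: is_derive_eq; rewrite /GRing.scale/=.
  rewrite (_ : - (1 - alpha) = alpha - 1); last by ring.
  by move: (_ `^ (alpha - 1)) => p; field; rewrite !gt_eqF.
rewrite (integral_is_derive ltr01 (fun u u01 => dF u (proj1 (andP u01)))) => [|y /andP[y0 _]].
- by rewrite /F mulr1 mulr0 addr0 powR1 -EFinB; congr EFin; ring.
- apply: (@continuous_comp _ _ _ (fun y : R => 1 + lam * y) (fun y : R => y `^ _)).
    by apply: cvgD; [exact: cvg_cst|apply: cvgM; [exact: cvg_cst|exact: cvg_id]].
  by apply: powR_continuous; exact: p0.
Qed.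

(** A priori D may take any real values. It is nonnegative because g D is and g > 0; its moments 1 /
    (n + 1) are at most 1, which confines it to [0, 1]; there they determine its law. *)
Lemma gamma_factorization_uniform d (T : measurableType d) (Q : probability T R) (g D : {RV Q >-> R}) :
  gamma_factorization P2 (Gam (1 - alpha)) (1 - alpha) Q g D -> is_uniform01 Q D.
Proof.
move=> [hg gD hl]; have g0 := gamma_var_gt0 hg.
have mg : measurable_fun setT g by []; have mD : measurable_fun setT D by [].
have mgD : measurable_fun setT (g \* D) by exact: measurable_funM.
have mGam : measurable_fun setT (Gam (1 - alpha)) by [].
have mnX n : measurable_fun setT (fun x : R => `|x| ^+ n).
  by apply: measurable_funX; exact: normr_measurable.
have D_ge0 : {ae Q, forall w, 0 <= D w}.
  have h : {ae Q, forall w, ~ `]-oo, 0[%classic ((g \* D) w)}.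
    apply: probability0_ae => //; rewrite -hl//; apply: ae_probability0 => //.
    by apply: filterS Gam_ge0 => w h /=; rewrite in_itv/= ltNge h.
  apply: filterS2 g0 h => w gw /=; rewrite in_itv/= => /negP; rewrite -leNgt.
  by rewrite pmulr_rge0.
have mom n : (\int[Q]_w (`|D w| ^+ n)%:E = (n.+1%:R^-1)%:E)%E.
  (* The moment of g is positive and finite, so it can be cancelled in the extended reals. *)
  have M0 : 0 < Gamma_fun (n%:R + (1 - alpha)) / Gamma_fun (1 - alpha) :> R.
    by have := @Gamma_fun_gt0 R 0 _ b01; rewrite add0r => ?; rewrite divr_gt0// Gamma_fun_gt0.
  have E1 := @independent_integralM _ _ _ Q g D (fun x => `|x| ^+ n) (fun x => `|x| ^+ n) mg mD gD (mnX n) (mnX n) (fun x => exprn_ge0 _ (normr_ge0 _)) (fun x => exprn_ge0 _ (normr_ge0 _)).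
  have := gamma_var_integral n b01 (lexx 0) hg.
  under eq_integral do rewrite mul0r oppr0 expR0 mulr1.
  rewrite addr0 powR1 mulr1 => E2.
  have E3 := integral_eq_law mGam mgD hl (mnX n) (fun x => exprn_ge0 _ (normr_ge0 _)).
  rewrite (integral_density _ Gam_density (mnX n) (fun x => exprn_ge0 _ (normr_ge0 _)))// f_Gamma_moment// in E3.
  move: E1; rewrite E2; under eq_integral do rewrite -exprMn -normrM.
  rewrite -[LHS]E3 EFinM => /(congr1 (fun z => ((Gamma_fun (n%:R + (1 - alpha)) / Gamma_fun (1 - alpha))^-1%:E * z)%E)).
  by rewrite !muleA -!EFinM mulVf ?gt_eqF// !mul1e mul1r => <-.
have D_le1 : {ae Q, forall w, `|D w| <= 1}.
  by apply: ae_norm_le1 => n; rewrite mom lee_fin invf_le1// ler1n.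
apply/uniform01_eq_law; apply: moments_eq_law => //.
- apply: filterS2 D_ge0 D_le1 => w h0; rewrite ger0_norm// => h1.
  by rewrite h0.
- have h : is_uniform01 (uniform_prob (@ltr01 R)) (id : R -> R) by [].
  exact: (uniform01_itv _ h).
- by move=> n; rewrite mom uniform_moment.
Qed.

End part2.

(** * Riemann-Stieltjes sums along the paths of the gamma process *)

Section grid.
Context {R : realType}.

Definition grid (t : R) (n i : nat) : R := t * i%:R / n.+1%:R.

Lemma grid_le (t : R) n i j : 0 <= t -> (i <= j)%N -> grid t n i <= grid t n j.
Proof. by move=> t0 ij; rewrite /grid ler_pM2r// ler_wpM2l// ler_nat. Qed.

Lemma grid_ge0 (t : R) n i : 0 <= t -> 0 <= grid t n i.
Proof. by move=> t0; rewrite /grid !mulr_ge0 ?invr_ge0. Qed.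

Lemma grid_step (t : R) n i : grid t n i.+1 - grid t n i = t / n.+1%:R.
Proof. by rewrite /grid -[in X in X - _]natr1; ring. Qed.

Lemma grid_last (t : R) n : grid t n n.+1 = t.
Proof. by rewrite /grid mulfK// pnatr_eq0. Qed.

Lemma grid_index (t : R) n u : 0 < t -> 0 < u <= t ->
  exists i : 'I_n.+1, grid t n i < u <= grid t n i.+1.
Proof.
move=> t0 /andP[u0 ut].
have ex : exists m, u <= grid t n m by exists n.+1; rewrite grid_last.
case: (ex_minnP ex) => -[|m] um min; first by move: um; rewrite /grid mulr0 mul0r leNgt u0.
have mn : (m < n.+1)%N by apply: min; rewrite grid_last.
exists (Ordinal mn); rewrite um andbT ltNge; apply/negP => h.
by have := min _ h; rewrite ltnn.
Qed.

(** Values are taken at right end points: t is a grid point for every n, so the step function is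
    exact at t, where h may be discontinuous and the measure may have an atom. *)
Definition step_fun (h : R -> R) (t : R) (n : nat) (u : R) : R :=
  \sum_(i < n.+1) h (grid t n i.+1) * \1_(`]grid t n i, grid t n i.+1]%classic) u.

Lemma step_funE (h : R -> R) (t : R) n (i : 'I_n.+1) u : 0 <= t ->
  grid t n i < u <= grid t n i.+1 -> step_fun h t n u = h (grid t n i.+1).
Proof.
move=> t0 ui; rewrite /step_fun (bigD1 i)//= big1 => [|j ji].
  by rewrite addr0 indicE mem_set ?mulr1//= in_itv.
rewrite indicE memNset ?mulr0//= in_itv/= => /andP[uj1 uj2].
have /andP[ui1 ui2] := ui.
have [ij|ij|ij] := ltngtP i j.
- by have := lt_le_trans uj1 (le_trans ui2 (grid_le n t0 ij)); rewrite ltxx.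
- by have := lt_le_trans ui1 (le_trans uj2 (grid_le n t0 ij)); rewrite ltxx.
- by move/eqP : ji; apply; apply/val_inj.
Qed.

End grid.

Section stieltjes_sums.
Context {R : realType}.

Lemma lebesgue_stieltjes_itv (F : cumulative R R) (a b : R) : a <= b ->
  lebesgue_stieltjes_measure F `]a, b]%classic = (F b - F a)%:E.
Proof.
move=> ab; rewrite /lebesgue_stieltjes_measure /measure_extension/=.
by rewrite measurable_mu_extE/= ?wlength_itv_bnd//; exact: is_ocitv.
Qed.

Lemma stieltjes_integral_fin (F : cumulative R R) (h : R -> R) (t M : R) : 0 < t ->
  measurable_fun setT h -> (forall u, `|h u| <= M) ->
  (\int[lebesgue_stieltjes_measure F]_(u in `]0%R, t]) (h u)%:E)%E \is a fin_num.
Proof.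
move=> t0 mh hM; apply: integrable_fin_num => //.
apply: measurable_bounded_integrable => //; last 2 first.
- exact: measurable_funTS.
- by exists M; split; [exact: num_real|] => N MN u _; exact: le_trans (ltW MN).
by have := lebesgue_stieltjes_itv F (ltW t0); rewrite /= => ->; rewrite ltry.
Qed.

(** The sums are integrals of [step_fun], which tends to h at every point of ]0, t], so the jumps of
    F are harmless. With F the identity the lemma gives the convergence of Riemann sums. *)
Lemma stieltjes_sum_cvg (F : cumulative R R) (h : R -> R) (t M : R) : 0 < t ->
  measurable_fun setT h -> (forall u, `|h u| <= M) ->
  (forall u, 0 < u < t -> {for u, continuous h}) ->
  ((\sum_(i < n.+1) h (grid t n i.+1) * (F (grid t n i.+1) - F (grid t n i)))%:E
    @[n --> \oo] --> \int[lebesgue_stieltjes_measure F]_(u in `]0%R, t]) (h u)%:E)%E.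
Proof.
move=> t0 mh hM ch; have t0' := ltW t0.
pose m := lebesgue_stieltjes_measure F.
have mfin : (m `]0%R, t]%classic < +oo)%E by rewrite /m lebesgue_stieltjes_itv// ltry.
have iI (A : set (measurableTypeR R)) : measurable A -> m.-integrable `]0, t]%classic (fun u => (\1_A u)%:E).
  move=> mA; apply: measurable_bounded_integrable => //.
  exists 1; split => // N N1 u _ /=.
  by rewrite indicE ger0_norm// (le_trans _ (ltW N1))// lern1; case: (_ \in _).
have E n : (\int[m]_(u in `]0%R, t]) (step_fun h t n u)%:E =
    (\sum_(i < n.+1) h (grid t n i.+1) * (F (grid t n i.+1) - F (grid t n i)))%:E)%E.
  rewrite /step_fun; under eq_integral do rewrite -sumEFin.
  rewrite integral_sum//.
  - rewrite -sumEFin; apply: eq_bigr => i _.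
    under eq_integral do rewrite EFinM.
    rewrite integralZl//; last first.
      exact: iI.
    rewrite integral_indic// EFinM -(lebesgue_stieltjes_itv F (grid_le n t0' (leqnSn i))) setIidl//.
    move=> u /=; rewrite !in_itv/= => /andP[u1 u2].
    rewrite (le_lt_trans (grid_ge0 n i t0') u1)/=.
    by rewrite (le_trans u2)// -[leRHS](grid_last t n) grid_le.
  - move=> i; have mi : measurable (`]grid t n i, grid t n i.+1]%classic : set (measurableTypeR R)) by exact: measurable_itv.
    exact: (@integrableZl _ _ _ m _ (measurable_itv _) (h (grid t n i.+1)) _ (iI _ mi)).
under eq_fun do rewrite -E.
apply: (@bounded_convergence _ _ _ _ _ _ _ M) => //.
- move=> n; apply: measurable_funTS; apply: measurable_sum => i.
  by apply: measurable_funM => //; exact: measurable_indic.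
- exact: measurable_funTS.
- apply: aeW => u; rewrite /= in_itv/= => /andP[u0 ut].
  move: ut; rewrite le_eqVlt => /predU1P[->|ut].
    apply: cvg_near_cst; apply: nearW => n.
    rewrite (@step_funE _ _ _ _ ord_max)//= grid_last// lexx andbT.
    by rewrite /grid ltr_pdivrMr// ltr_pM2l// ltr_nat.
  apply/cvgrPdist_lt => e e0.
  have uu : 0 < u < t by rewrite u0.
  have /cvgrPdist_lt /(_ e e0) := ch u uu.
  move=> -[r /= r0 hr].
  near=> n; have [|i ui] := @grid_index _ t n u t0; first by rewrite u0 ltW.
  rewrite (step_funE _ _ ui)//; apply: hr => /=.
  have /andP[u1 u2] := ui.
  rewrite ler0_norm ?subr_le0// opprB.
  apply: (@le_lt_trans _ _ (t / n.+1%:R)); first by rewrite -(grid_step t n i) lerD2l lerN2 ltW.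
  rewrite ltr_pdivrMr// mulrC -ltr_pdivrMr//.
  by apply: (@lt_le_trans _ _ n%:R); [near: n; exact: nbhs_infty_gtr|rewrite ler_nat].
- move=> n u; rewrite /= in_itv/= => uu.
  by have [i ui] := grid_index n t0 uu; rewrite (step_funE _ _ ui).
Unshelve. all: by end_near. Qed.

End stieltjes_sums.

(** * Expectations of products of independent variables *)

Section product_of_independent.
Context {R : realType} d (T : measurableType d) (P : probability T R) (n : nat)
  (X : 'I_n -> T -> R).
Hypothesis mX : forall i, measurable_fun setT (X i).

Definition unit_valued (phi : 'I_n -> R -> R) : Prop :=
  forall i, measurable_fun setT (phi i) /\ forall x, 0 <= phi i x <= 1.

Definition product_rule (phi : 'I_n -> R -> R) : Prop :=
  (\int[P]_w (\prod_(i < n) phi i (X i w))%:E =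
   \prod_(i < n) \int[P]_w (phi i (X i w))%:E)%E.

Definition subst_fun (phi : 'I_n -> R -> R) (k : 'I_n) (psi : R -> R) (i : 'I_n) : R -> R :=
  if i == k then psi else phi i.

Lemma unit_valued_subst phi k (B : set R) : measurable B ->
  unit_valued phi -> unit_valued (subst_fun phi k (\1_B)).
Proof.
move=> mB h i; rewrite /subst_fun; case: eqP => // _; split; first exact: measurable_indic.
by move=> x; rewrite indicE; case: (_ \in _); rewrite ?lexx ?ler01.
Qed.

(** Take the other factors as the weight W and the product C of their expectations as a constant
    weight. The rule for indicators at k says that both weights give the same measure of every event
    about [X k]; [eq_integral_law] passes to [phi k]. *)
Lemma product_rule_subst phi k : unit_valued phi ->
  (forall B : set R, measurable B -> product_rule (subst_fun phi k (\1_B))) ->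
  product_rule phi.
Proof.
move=> hphi h.
have mphi i : measurable_fun setT (fun w => phi i (X i w)).
  by have [m _] := hphi i; exact: measurableT_comp.
have phi01 i w : 0 <= phi i (X i w) <= 1 by have [_ ->] := hphi i.
pose W w := \prod_(i < n | i != k) phi i (X i w).
have W0 w : 0 <= W w by apply: prodr_ge0 => i _; have /andP[] := phi01 i w.
have mW : measurable_fun setT W.
  rewrite /W; under eq_fun do rewrite big_mkcond/=.
  apply: measurable_prod => i _; case: (i != k) => //.
pose C := (\prod_(i < n | i != k) \int[P]_w (phi i (X i w))%:E)%E.
have C0 : (0 <= C)%E.
  apply: prode_ge0 => i _; apply: integral_ge0 => w _; rewrite lee_fin.
  by have /andP[] := phi01 i w.
have Cfin : C \is a fin_num.
  apply: prode_fin_num => i _; rewrite ge0_fin_numE; last first.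
    by apply: integral_ge0 => w _; rewrite lee_fin; have /andP[] := phi01 i w.
  apply: (@le_lt_trans _ _ (\int[P]_w (cst 1%E w))%E); last first.
    by rewrite integral_cst//= mul1e probability_setT ltry.
  apply: ge0_le_integral => //.
  - by move=> w _; rewrite lee_fin; have /andP[] := phi01 i w.
  - exact/measurable_EFinP.
  - by move=> w _; rewrite lee_fin; have /andP[] := phi01 i w.
have cE (psi : R -> R) : measurable_fun setT psi -> (forall x, 0 <= psi x) ->
    (\int[P]_w (fine C * psi (X k w))%:E = C * \int[P]_w (psi (X k w))%:E)%E.
  move=> mpsi psi0; under eq_integral do rewrite EFinM.
  rewrite ge0_integralZl_EFin ?fine_ge0// ?fineK//.
  - by move=> w _; rewrite lee_fin.
  - by apply/measurable_EFinP; exact: measurableT_comp.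
have [mk phik] := hphi k.
have phik0 x : 0 <= phi k x by have /andP[] := phik x.
transitivity (\int[P]_w (W w * phi k (X k w))%:E)%E.
  by apply: eq_integral => w _; rewrite (bigD1 k)//= mulrC.
rewrite (@eq_integral_law _ _ _ _ _ P P W (X k) (cst (fine C)) (X k))//.
- by rewrite cE// [RHS](bigD1 k)//= muleC.
- by move=> w; exact: fine_ge0.
- move=> B mB; rewrite cE//.
  have Ek : subst_fun phi k (\1_B) k = \1_B by rewrite /subst_fun eqxx.
  have Ei i : i != k -> subst_fun phi k (\1_B) i = phi i by move=> /negbTE ik; rewrite /subst_fun ik.
  have := h B mB; rewrite /product_rule [RHS](bigD1 k)//= Ek.
  rewrite [X in (_ * X)%E](eq_bigr (fun i => \int[P]_w (phi i (X i w))%:E)%E); last first.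
    by move=> i /Ei ->.
  rewrite -/C muleC => <-; apply: eq_integral => w _; congr EFin.
  rewrite (bigD1 k)//= Ek mulrC; congr (_ * _).
  by apply: eq_bigr => i /Ei ->.
Qed.

Hypothesis X_indep : mutually_independent P X.

Lemma product_rule_indic (A : 'I_n -> set R) : (forall i, measurable (A i)) ->
  product_rule (fun i => \1_(A i)).
Proof.
move=> mA; rewrite /product_rule.
transitivity (\prod_(i < n) P (X i @^-1` A i))%E; last first.
  apply: eq_bigr => i _; rewrite (probability_indic P (mX i) (mA i)).
  by apply: eq_integral => w _; rewrite mul1r.
rewrite -X_indep// -[in RHS](setIT (\bigcap_i _)) -integral_indic//; last first.
  by apply: fin_bigcap_measurable => // i _; rewrite -(setTI (_ @^-1` _)); exact: mX.
apply: eq_integral => w _; congr EFin.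
have [h|h] := pselect (forall i, A i (X i w)).
  rewrite indicE mem_set => [|i _]; last exact: h.
  by rewrite big1// => i _; rewrite indicE mem_set.
have /existsNP[i hi] := h.
rewrite [RHS]indicE memNset; last by move=> /(_ i Logic.I).
by rewrite (bigD1 i)//= indicE memNset ?mul0r.
Qed.

Lemma independent_product phi : unit_valued phi -> product_rule phi.
Proof.
(* Induction on the number k of leading coordinates that carry arbitrary functions, those from k on
   carrying indicators; the case k = 0 is independence itself. *)
suff key (k : nat) : forall phi, unit_valued phi ->
    (forall i : 'I_n, (k <= i)%N -> exists2 B : set R, measurable B & phi i = \1_B) -> product_rule phi.
  by move=> h; apply: (key n) => // i; rewrite leqNgt ltn_ord.
elim: k => [|k IH] phi' hphi hA.
  have /choice[A hAA] : forall i : 'I_n, exists B : set R, measurable B /\ phi' i = \1_B.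
    by move=> i; have [B mB e] := hA i (leq0n _); exists B.
  have -> : phi' = (fun i => \1_(A i)) by apply/funext => i; have [] := hAA i.
  by apply: product_rule_indic => i; have [] := hAA i.
have [kn|nk] := ltnP k n; last first.
  by apply: IH => // i ki; have := leq_ltn_trans (leq_trans nk ki) (ltn_ord i); rewrite ltnn.
apply: (@product_rule_subst _ (Ordinal kn)) => // B mB.
apply: IH; first exact: unit_valued_subst.
move=> i ki; rewrite /subst_fun; case: eqP => [_|ik]; first by exists B.
apply: hA; rewrite ltn_neqAle ki andbT; apply/eqP => e; apply: ik.
by apply/val_inj; rewrite /= e.
Qed.

End product_of_independent.

(** * Integrals along the paths of the gamma process *)

Section path.
Context {R : realType} d (T : measurableType d) (P : probability T R) (X : R -> {RV P >-> R}).

(** The path is frozen at its value at 0 for negative times, since [cumulative] asks for a function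
    on the whole line. *)
Definition path_ext (w : T) (s : R) : R := X (Num.max s 0) w.

Lemma path_cumulative (w : T) :
  (forall s t, 0 <= s -> s <= t -> X s w <= X t w) ->
  (forall s, 0 <= s -> X u w @[u --> s^'+] --> X s w) ->
  exists F : cumulative R R, forall s, 0 <= s -> F s = X s w.
Proof.
move=> Xm Xr.
have nd : nondecreasing (path_ext w).
  move=> s t st; rewrite /path_ext; apply: Xm; first by rewrite le_max lexx orbT.
  by rewrite ge_max !le_max st lexx orbT.
have rc : right_continuous (path_ext w).
  move=> s; rewrite /path_ext; have [s0|s0] := leP 0 s.
    apply: cvg_trans (Xr s s0); apply: near_eq_cvg; near=> u.
    by rewrite max_l// (le_trans s0)// ltW.
  apply: cvg_near_cst; near=> u; rewrite max_r//; apply: ltW.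
  by near: u; exact: nbhs_right_lt.
pose F : cumulative R R := HB.pack (path_ext w) (isCumulative.Build R _ R (path_ext w) nd rc).
by exists F => s s0; rewrite /F/= /path_ext max_l.
Unshelve. all: by end_near. Qed.

End path.

Section wiener_gamma.
Context {R : realType} d (T : measurableType d) (P : probability T R) (gam : R -> {RV P >-> R}).
Hypothesis gam_std : standard_gamma_process gam.
Local Notation mu := (@lebesgue_measure R).

(** The exponent is Frullani's integral with g = 1. The absolute value agrees with the variable
    almost surely and keeps the integrand in [0, 1] everywhere. *)
Lemma standard_gamma_laplace (a s : R) : 0 <= a -> 0 <= s ->
  (\int[P]_w (expR (- (a * `|gam s w|)))%:E = (expR (- (s * ln (1 + a))))%:E)%E.
Proof.
move=> a0 s0; have [gsub L] := gam_std.
transitivity (\int[P]_w (expR (- (a * gam s w)))%:E)%E.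
  apply: ae_eq_integral => //.
  - by apply/measurable_EFinP; have m : measurable_fun setT (fun w => `|gam s w|) by [exact: measurableT_comp]; mfun.
  - by apply/measurable_EFinP; have m : measurable_fun setT (gam s) by []; mfun.
  - by apply: filterS (subordinator_ge0 gsub s0) => w h _; rewrite ger0_norm.
move: a0; rewrite le_eqVlt => /predU1P[<-|a0].
  under eq_integral do rewrite mul0r oppr0 expR0.
  by rewrite integral_cst//= probability_setT mule1 addr0 ln1 mulr0 oppr0 expR0.
have := L a s (ltW a0) s0; rewrite unlock.
under eq_integral do rewrite mulNr.
move=> ->; rewrite (_ : (\int[mu]_(x in _) _)%E = (ln (1 + a))%:E) -?EFinM//.
rewrite -[in RHS](mulr1 a) -frullani//; apply: eq_integral => x _.
by rewrite -EFinM mulNr divr1 [_ / x]mulrC.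
Qed.

Variables (h : R -> R) (t : R).
Hypotheses (t0 : 0 < t) (mh : measurable_fun setT h) (h01 : forall u, 0 <= h u <= 1)
  (hcont : forall u : R, 0 < u < t -> {for u, continuous h}).

Definition incr (n : nat) (i : 'I_n.+1) (w : T) : R := gam (grid t n i.+1) w - gam (grid t n i) w.

(** Absolute values make the sums nonnegative everywhere and put the factors of the Laplace
    transform in [0, 1]; almost surely the increments are nonnegative already. *)
Definition gamma_sum (n : nat) (w : T) : R := \sum_(i < n.+1) h (grid t n i.+1) * `|incr i w|.

Let h_norm u : `|h u| <= 1.
Proof. by have /andP[h0 h1] := h01 u; rewrite ger0_norm. Qed.

Let gsub : subordinator gam. Proof. by have [] := gam_std. Qed.

Let mincr n (i : 'I_n.+1) : measurable_fun setT (incr i).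
Proof. by apply: measurable_funB. Qed.

Lemma measurable_gamma_sum n : measurable_fun setT (gamma_sum n).
Proof.
apply: measurable_sum => i; apply: measurable_funM => //.
exact: measurableT_comp (mincr i).
Qed.

Lemma incr_eq_law n (i : 'I_n.+1) : eq_law P (incr i) P (gam (t / n.+1%:R)).
Proof.
have := subordinator_stationary gsub (grid_ge0 n i (ltW t0)) (divr_ge0 (ltW t0) (ler0n _ n.+1)).
by rewrite -(grid_step t n i) addrC subrK.
Qed.

Definition log_kernel (lam u : R) : R := ln (1 + lam * h u).

(** By stationarity each increment has the law of [gam (t / (n + 1))], so the product of the
    transforms is the exponential of minus a Riemann sum of [log_kernel]. *)
Lemma gamma_sum_laplace n (lam : R) : 0 < lam ->
  (\int[P]_w (expR (- (lam * gamma_sum n w)))%:E =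
   (expR (- \sum_(i < n.+1) log_kernel lam (grid t n i.+1) * (t / n.+1%:R)))%:E)%E.
Proof.
move=> l0.
pose phi (i : 'I_n.+1) (x : R) := expR (- (lam * h (grid t n i.+1) * `|x|)).
have a0 i : 0 <= lam * h (grid t n i) by rewrite mulr_ge0 ?(ltW l0)//; have /andP[] := h01 (grid t n i).
have hphi : unit_valued phi.
  move=> i; split; last by move=> x; rewrite /phi expR_ge0 expR_le1 oppr_le0 mulr_ge0.
  by rewrite /phi; have mn := @normr_measurable R setT; mfun.
have := independent_product (@mincr n) (@subordinator_independent _ _ _ _ _ gsub n.+1 (grid t n) (grid_ge0 n 0 (ltW t0)) (fun i => grid_le n (ltW t0) (leqnSn i))) hphi.
rewrite /product_rule.
have -> : (\int[P]_w (\prod_(i < n.+1) phi i (incr i w))%:E =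
   \int[P]_w (expR (- (lam * gamma_sum n w)))%:E)%E.
  apply: eq_integral => w _; rewrite /phi -expR_sum; congr (expR _)%:E.
  by rewrite /gamma_sum mulr_sumr -sumrN; apply: eq_bigr => i _; rewrite mulrA.
move=> ->; rewrite -sumrN expR_sum -prodEFin; apply: eq_bigr => i _.
have [mphi phi01] := hphi i.
rewrite (integral_eq_law (mincr i) _ (@incr_eq_law n i) mphi)//; last first.
  by move=> x; have /andP[] := phi01 x.
by rewrite /phi standard_gamma_laplace ?divr_ge0 ?(ltW t0)// /log_kernel [_ * ln _]mulrC.
Qed.

(** An upper limit is measurable without knowing that the sums converge; absolute value and finite
    part make it real and nonnegative also on the exceptional null set. *)
Definition stieltjes_limit (w : T) : R := fine `|limn_esup (fun n => (gamma_sum n w)%:E)|%E.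

Lemma stieltjes_limit_ge0 w : 0 <= stieltjes_limit w.
Proof. by rewrite fine_ge0. Qed.

Lemma measurable_stieltjes_limit : measurable_fun setT stieltjes_limit.
Proof.
have m : measurable_fun setT (fun w => limn_esup (fun n => (gamma_sum n w)%:E)).
  apply: (@measurable_fun_limn_esup _ _ _ setT (fun n w => (gamma_sum n w)%:E)) => n.
  exact/measurable_EFinP/measurable_gamma_sum.
exact: (measurableT_comp (fine_measurable measurableT) (measurableT_comp (@abse_measurable R setT) m)).
Qed.

Lemma stieltjes_limitP : {ae P, forall w,
  (exists F : cumulative R R, (forall s, 0 <= s -> F s = gam s w) /\
    (\int[lebesgue_stieltjes_measure F]_(u in `]0%R, t]) (h u)%:E = (stieltjes_limit w)%:E)%E) /\
  gamma_sum n w @[n --> \oo] --> stieltjes_limit w}.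
Proof.
apply: filterS (subordinator_paths gsub) => w [gm gr].
have [F FE] := path_cumulative gm gr.
have SE n : gamma_sum n w = \sum_(i < n.+1) h (grid t n i.+1) * (F (grid t n i.+1) - F (grid t n i)).
  apply: eq_bigr => i _; rewrite !FE ?grid_ge0 ?(ltW t0)// ger0_norm// subr_ge0.
  by rewrite gm ?grid_ge0 ?grid_le// ltW.
have cv := @stieltjes_sum_cvg _ F _ _ _ t0 mh h_norm hcont.
have If := @stieltjes_integral_fin _ F _ _ _ t0 mh h_norm.
set J := (\int[_]_(u in _) _)%E in cv If *.
have J0 : (0 <= J)%E by apply: integral_ge0 => u _; rewrite lee_fin; have /andP[] := h01 u.
have cv' : (gamma_sum n w)%:E @[n --> \oo] --> J by under eq_fun do rewrite SE.
have SJ : (stieltjes_limit w)%:E = J.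
  rewrite /stieltjes_limit is_cvg_limn_esupE; last by apply/cvg_ex; exists J.
  by rewrite (cvg_lim _ cv')// gee0_abs// fineK.
split; first by exists F; rewrite SJ.
by apply: (@fine_cvg _ _ _ _ (fun n => (gamma_sum n w)%:E)); rewrite SJ.
Qed.

Lemma stieltjes_limit_laplace (lam : R) : 0 < lam ->
  (\int[P]_w (expR (- (lam * stieltjes_limit w)))%:E =
   (expR (- fine (\int[mu]_(u in `]0%R, t]) (log_kernel lam u)%:E)))%:E)%E.
Proof.
move=> l0.
have p0 u : 1 <= 1 + lam * h u.
  by rewrite lerDl mulr_ge0 ?(ltW l0)//; have /andP[] := h01 u.
have ml : measurable_fun setT (log_kernel lam) by rewrite /log_kernel; mfun.
have lM u : `|log_kernel lam u| <= ln (1 + lam).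
  rewrite /log_kernel ger0_norm ?ln_ge0// ler_ln ?posrE ?(lt_le_trans _ (p0 u))//.
    by rewrite lerD2l ler_piMr ?(ltW l0)//; have /andP[] := h01 u.
  by rewrite addr_gt0.
have cl u : 0 < u < t -> {for u, continuous (log_kernel lam)}.
  move=> ut; apply: (@continuous_comp _ _ _ (fun u => 1 + lam * h u) (@ln R)).
    by apply: cvgD; [exact: cvg_cst|apply: cvgM; [exact: cvg_cst|exact: hcont]].
  by apply: continuous_ln; exact: lt_le_trans (p0 u).
(* With the identity as F, the Stieltjes measure is Lebesgue measure and the sums are those in the
   exponent of [gamma_sum_laplace]. *)
have cvr := @stieltjes_sum_cvg _ idfun _ _ _ t0 ml lM cl.
have If := @stieltjes_integral_fin _ idfun _ _ _ t0 ml lM.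
have mS := measurable_gamma_sum; have mI := measurable_stieltjes_limit.
have c1 : (\int[P]_w (expR (- (lam * gamma_sum n w)))%:E @[n --> \oo] -->
    \int[P]_w (expR (- (lam * stieltjes_limit w)))%:E)%E.
  apply: (@bounded_convergence _ _ _ _ _ _ _ 1) => //.
  - by rewrite /= probability_setT ltry.
  - by move=> n; have m := mS n; mfun.
  - by mfun.
  - apply: filterS stieltjes_limitP => w [_ cw] _.
    apply: (@cvg_comp _ _ _ (fun n => - (lam * gamma_sum n w)) (@expR R)); last exact: continuous_expR.
    by apply: cvgN; apply: cvgM => //; exact: cvg_cst.
  - move=> n w _; rewrite ger0_norm ?expR_ge0// expR_le1 oppr_le0 mulr_ge0 ?(ltW l0)//.
    by apply: sumr_ge0 => i _; rewrite mulr_ge0//; have /andP[] := h01 (grid t n i.+1).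
have c2 : (\int[P]_w (expR (- (lam * gamma_sum n w)))%:E @[n --> \oo] -->
    (expR (- fine (\int[mu]_(u in `]0%R, t]) (log_kernel lam u)%:E)))%:E)%E.
  under eq_fun do rewrite gamma_sum_laplace//.
  apply: cvg_EFin; first exact: nearW.
  apply: (@cvg_comp _ _ _ _ (@expR R)); last exact: continuous_expR.
  apply: cvgN; apply: (@fine_cvg _ _ _ _ (fun n => (\sum_(i < n.+1) log_kernel lam (grid t n i.+1) * (t / n.+1%:R))%:E)).
  rewrite fineK//; apply: cvg_trans cvr; apply: near_eq_cvg; apply: nearW => n.
  by congr EFin; apply: eq_bigr => i _; rewrite /= -(grid_step t n i).
exact: cvg_unique c1 c2.
Qed.

End wiener_gamma.

(** * The two kernels of the representation *)

Section wiener_gamma_kernels.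
Context {R : realType}.
Local Notation mu := (@lebesgue_measure R).
Variables (alpha : R) (alpha_gt0 : 0 < alpha) (alpha_lt1 : alpha < 1).

Lemma wiener_gamma_kernelE (a b : R) : b != 0 ->
  wiener_gamma_kernel alpha a b = ((1 + (a / b) `^ alpha^-1)^-1)%:E.
Proof.
move=> b0; rewrite /wiener_gamma_kernel inver (negbTE b0) -EFinM poweR_EFin -EFinD inver gt_eqF//.
by rewrite ltr_pwDl// powR_ge0.
Qed.

Lemma wiener_gamma_kernel0 (a : R) : 0 < a -> wiener_gamma_kernel alpha a 0 = 0%E.
Proof.
move=> a0; rewrite /wiener_gamma_kernel inve0 gt0_muley ?lte_fin// poweRyr ?invr_neq0 ?gt_eqF//.
Qed.

Lemma measurable_wgk (t : R) : measurable_fun setT (wgk alpha t).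
Proof.
have ms : measurable_fun setT (@sin R) by apply: continuous_measurable_fun; exact: continuous_sin.
have msin (f : R -> R) : measurable_fun setT f -> measurable_fun setT (fun u => sin (f u)).
  by move=> mf; exact: (measurableT_comp ms mf).
rewrite /wgk.
have m1 : measurable_fun setT (fun u : R => sin (pi * (1 - alpha) * ((t - u) / t))) by apply: msin; mfun.
have m2 : measurable_fun setT (fun u : R => sin (pi * (1 - alpha) * (u / t))) by apply: msin; mfun.
by mfun.
Qed.

(* The value at [u = t] is that of [wiener_gamma_kernel], where [wgk] has a
   junk value. *)
Definition wgk_rev (t u : R) : R := wgk alpha t (t - u) * \1_(`]-oo, t[%classic) u.

Lemma measurable_wgk_rev (t : R) : measurable_fun setT (wgk_rev t).
Proof.
have m := measurable_wgk t.
apply: measurable_funM; last exact: measurable_indic.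
by apply: (measurableT_comp m); mfun.
Qed.

Lemma wgk_rev_itv (t u : R) : 0 <= wgk_rev t u <= 1.
Proof.
rewrite /wgk_rev indicE; case: (_ \in _); rewrite ?mulr1 ?mulr0 ?wgk_ge0 ?wgk_le1//.
by rewrite lexx ler01.
Qed.

Lemma wgk_revE (t u : R) : u < t -> wgk_rev t u = wgk alpha t (t - u).
Proof. by move=> ut; rewrite /wgk_rev indicE mem_set ?mulr1//= in_itv. Qed.

Lemma wgk_rev_continuous (t u : R) : 0 < u < t -> {for u, continuous (wgk_rev t)}.
Proof.
move=> /andP[u0 ut].
have c : {for u, continuous (fun v : R => wgk alpha t (t - v))}.
  apply: (@continuous_comp _ _ _ (fun v : R => t - v) (wgk alpha t)).
    by apply: cvgB; [exact: cvg_cst|exact: cvg_id].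
  by apply: wgk_continuous => //; rewrite subr_gt0 ut/= gtrBl.
rewrite /prop_for /continuous_at wgk_revE//; apply: cvg_trans c.
apply: near_eq_cvg; near=> v; rewrite wgk_revE//.
by near: v; exact: lt_nbhsl.
Unshelve. all: by end_near. Qed.

Lemma kernel_wgk (t u : R) : 0 < u <= t ->
  wiener_gamma_kernel alpha (sin (pi * (1 - alpha) * ((t - u) / t)))
    (sin (pi * (1 - alpha) * (u / t))) = (wgk alpha t u)%:E.
Proof.
move=> /andP[u0 ut]; have t0 : 0 < t by exact: lt_le_trans ut.
by rewrite wiener_gamma_kernelE// gt_eqF// sin_beta_gt0// divr_gt0//= ler_pdivrMr// mul1r.
Qed.

Lemma kernel_wgk_rev (t u : R) : 0 < u <= t ->
  wiener_gamma_kernel alpha (sin (pi * (1 - alpha) * (u / t)))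
    (sin (pi * (1 - alpha) * ((t - u) / t))) = (wgk_rev t u)%:E.
Proof.
move=> /andP[u0 ut]; have t0 : 0 < t by exact: lt_le_trans ut.
move: ut; rewrite le_eqVlt => /predU1P[->|ut].
  rewrite subrr mul0r mulr0 sin0 wiener_gamma_kernel0.
    by rewrite /wgk_rev indicE memNset ?mulr0//= in_itv/= ltxx.
  by rewrite sin_beta_gt0// divff ?gt_eqF// ltr01 lexx.
rewrite wgk_revE// wiener_gamma_kernelE.
  by rewrite /wgk opprB addrCA subrr addr0.
by rewrite gt_eqF// sin_beta_gt0// divr_gt0 ?subr_gt0//= ler_pdivrMr// mul1r gerBl ltW.
Qed.

(** Lebesgue measure is invariant under x -> t - x, by its uniqueness on intervals. *)
Lemma integral_reflect (t : R) (f : R -> R) : measurable_fun setT f -> (forall x, 0 <= f x) ->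
  (\int[mu]_(x in `]0%R, t[) (f (t - x))%:E = \int[mu]_(x in `]0%R, t[) (f x)%:E)%E.
Proof.
move=> mf f0.
pose r : measurableTypeR R -> measurableTypeR R := fun x => t - x.
have mr : measurable_fun [set: measurableTypeR R] r by apply: measurable_funB.
pose nu0 := (pushforward mu r : {measure set (measurableTypeR R) -> \bar R}).
pose nu := nu0 mr.
have E (A : set (measurableTypeR R)) : measurable A -> mu A = nu A.
  move=> mA; apply: lebesgue_measure_unique => //= _ [[a b]] _ <-.
  rewrite /nu/= /pushforward.
  rewrite (_ : _ @^-1` _ = `[t - b, t - a[%classic); last first.
    by apply/seteqP; split => x /=; rewrite !in_itv/= /r; lra.
  by rewrite /= !lebesgue_measure_itv/= !lte_fin ltrD2l ltrN2 -!EFinB; case: ifP => // _; congr EFin; ring.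
have mD : measurable (`]0, t[%classic : set (measurableTypeR R)) by exact: measurable_itv.
transitivity (\int[nu]_(x in `]0%R, t[) (f x)%:E)%E; last first.
  apply: eq_measure_integral => A mA _; exact/esym/E.
rewrite (@ge0_integral_pushforward _ _ _ _ _ r mr mu `]0%R, t[%classic (EFin \o f) mD); last 2 first.
- by apply/measurable_EFinP; exact: measurable_funTS.
- by move=> x _; rewrite /= lee_fin.
rewrite (_ : _ @^-1` _ = `]0, t[%classic)//.
by apply/seteqP; split => x /=; rewrite !in_itv/= /r; lra.
Qed.

Lemma integral_log_wgk (t lam : R) : 0 < t -> 0 < lam ->
  (\int[mu]_(u in `]0%R, t]) (log_kernel (wgk alpha t) lam u)%:E = (t * Psi alpha lam)%:E)%E.
Proof.
move=> t0 l0; have m := measurable_wgk t.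
rewrite -integral_ln_wgk// -integral_itv_bndo_bndc//.
by apply/measurable_EFinP; apply: measurable_funTS; mfun.
Qed.

(** The reflection u -> t - u exchanges the two kernels, so both integrals have the same Laplace
    transform. *)
Lemma integral_log_wgk_rev (t lam : R) : 0 < t -> 0 < lam ->
  (\int[mu]_(u in `]0%R, t]) (log_kernel (wgk_rev t) lam u)%:E = (t * Psi alpha lam)%:E)%E.
Proof.
move=> t0 l0; have m := measurable_wgk t; have m' := measurable_wgk_rev t.
rewrite -integral_ln_wgk// -integral_itv_bndo_bndc//; last first.
  by apply/measurable_EFinP; apply: measurable_funTS; rewrite /log_kernel; mfun.
rewrite -(@integral_reflect t (fun u => ln (1 + lam * wgk alpha t u))).
- apply: eq_integral => u; rewrite inE/= in_itv/= => /andP[_ ut].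
  by rewrite /log_kernel wgk_revE.
- by mfun.
- by move=> u; rewrite ln_ge0// lerDl mulr_ge0 ?wgk_ge0// ltW.
Qed.

End wiener_gamma_kernels.

Section wiener_gamma_representation.
Context {R : realType} d (T : measurableType d) (Q : probability T R) (gam : R -> {RV Q >-> R}).
Hypothesis gam_std : standard_gamma_process gam.
Local Notation mu := (@lebesgue_measure R).

(** Common to both kernels: hE is the extended-real kernel of the statement, and h is a real
    function equal to it on ]0, t], the domain of integration, and measurable with values in [0, 1]
    on the whole line. *)
Lemma stieltjes_integral_exists (hE : R -> \bar R) (h : R -> R) (t : R) (J : R -> R) : 0 < t ->
  measurable_fun setT h -> (forall u, 0 <= h u <= 1) ->
  (forall u : R, 0 < u < t -> {for u, continuous h}) ->
  (forall u, 0 < u <= t -> hE u = (h u)%:E) ->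
  (forall lam : R, 0 < lam -> (\int[mu]_(u in `]0%R, t]) (log_kernel h lam u)%:E = (J lam)%:E)%E) ->
  exists I : {RV Q >-> R}, [/\ is_stieltjes_integral gam t hE I, (forall w, 0 <= I w) &
    forall lam : R, 0 < lam -> (\int[Q]_w (expR (- (lam * I w)))%:E = (expR (- J lam))%:E)%E].
Proof.
move=> t0 mh h01 hc hEh hJ.
have mI : measurable_fun setT (stieltjes_limit gam h t) by exact: measurable_stieltjes_limit.
pose I : {RV Q >-> R} := HB.pack (stieltjes_limit gam h t) (isMeasurableFun.Build _ _ _ _ _ mI).
exists I; split.
- apply: filterS (stieltjes_limitP gam_std t0 mh h01 hc) => w [[F [FE FI]] _].
  exists F; split => //; rewrite -[RHS]FI; apply: eq_integral => u.
  by rewrite inE/= in_itv/= => /hEh.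
- by move=> w; exact: stieltjes_limit_ge0.
- by move=> lam l0; rewrite [LHS]stieltjes_limit_laplace// hJ.
Qed.

End wiener_gamma_representation.

Theorem theorem3 (R : realType) (alpha : R)
    (alpha_gt0 : 0 < alpha) (alpha_lt1 : alpha < 1)
    (d1 : measure_display) (T1 : measurableType d1) (P1 : probability T1 R)
    (G : {RV P1 >-> R}) (G_density : has_density P1 G (f_G alpha))
    (d2 : measure_display) (T2 : measurableType d2) (P2 : probability T2 R)
    (Gam : R -> {RV P2 >-> R}) (Gam_sub : is_Gamma_inv G Gam) :
  (* 1. Laplace transform *)
  [/\ (forall lambda t : R, 0 < lambda -> 0 <= t ->
        ('E_P2[fun w => expR (- lambda * Gam t w)] =
         ((alpha^-1 * (((1 + lambda) `^ alpha - 1) / lambda))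
            `^ (t / (1 - alpha)))%:E)%E),
  (* 2. laws of Gamma_(1-alpha)(1/G) and D_(1-alpha)(1/G) *)
      (forall (d : measure_display) (T : measurableType d)
          (Q : probability T R) (g U : {RV Q >-> R}),
        is_gamma_var Q (1 - alpha) g -> is_uniform01 Q U ->
        independent Q g U ->
        eq_law P2 (Gam (1 - alpha)) Q (g \* U)),
      (forall (d : measure_display) (T : measurableType d)
          (Q : probability T R) (g D : {RV Q >-> R}),
        gamma_factorization P2 (Gam (1 - alpha)) (1 - alpha) Q g D ->
        is_uniform01 Q D),
      has_density P2 (Gam (1 - alpha)) (f_Gamma alpha) &
  (* 3. Wiener-Gamma representation *)
      (forall (d : measure_display) (T : measurableType d)
          (Q : probability T R) (gam : R -> {RV Q >-> R}),
        standard_gamma_process gam ->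
        forall t : R, 0 < t ->
        exists I1 I2 : {RV Q >-> R},
          [/\ is_stieltjes_integral gam t
                (fun u => wiener_gamma_kernel alpha
                   (sin (pi * (1 - alpha) * ((t - u) / t)))
                   (sin (pi * (1 - alpha) * (u / t)))) I1,
              is_stieltjes_integral gam t
                (fun u => wiener_gamma_kernel alpha
                   (sin (pi * (1 - alpha) * (u / t)))
                   (sin (pi * (1 - alpha) * ((t - u) / t)))) I2,
              eq_law P2 (Gam t) Q I1 &
              eq_law Q I1 Q I2])].
Proof.
split.
- move=> lam t l0 t0.
  by rewrite (laplace_Gamma_inv alpha_gt0 alpha_lt1 G_density Gam_sub)// expR_Psi.
- by move=> d T Q g U; exact: Gam_eq_law_gU G_density Gam_sub _ _ _ _ _.
- by move=> d T Q g D; exact: gamma_factorization_uniform G_density Gam_sub _ _ _ _ _.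
- exact: Gam_density G_density Gam_sub.
move=> d T Q gam gam_std t t0.
have h1c (u : R) : 0 < u < t -> {for u, continuous (wgk alpha t)} by exact: wgk_continuous.
have h2c (u : R) : 0 < u < t -> {for u, continuous (wgk_rev alpha t)} by exact: wgk_rev_continuous.
have h101 u : 0 <= wgk alpha t u <= 1 by rewrite wgk_ge0 wgk_le1.
have [I1 [S1 I1_ge0 L1]] := stieltjes_integral_exists gam_std t0 (measurable_wgk alpha t) h101 h1c
  (fun u => @kernel_wgk _ _ alpha_gt0 alpha_lt1 t u) (fun lam => @integral_log_wgk _ _ alpha_gt0 alpha_lt1 t lam t0).
have [I2 [S2 I2_ge0 L2]] := stieltjes_integral_exists gam_std t0 (measurable_wgk_rev alpha t) (wgk_rev_itv alpha t) h2c
  (fun u => @kernel_wgk_rev _ _ alpha_gt0 alpha_lt1 t u) (fun lam => @integral_log_wgk_rev _ _ alpha_gt0 alpha_lt1 t lam t0).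
exists I1, I2; split => //.
- apply: laplace_eq_law => //.
  + by have [Gs _] := Gam_sub; apply: subordinator_ge0 => //; exact: ltW.
  + exact: aeW.
  + by move=> lam l0; rewrite L1// (laplace_Gam alpha_gt0 alpha_lt1 G_density Gam_sub)// ltW.
- apply: laplace_eq_law => //; [exact: aeW|exact: aeW|].
  by move=> lam l0; rewrite L1// L2.
Qed.
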